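(* In the case $m=2$, the following transformation formulas hold for $(\tau,z)\in\mathbb{C}_+\times\mathbb{C}$. (For $H(\Lambda^{[-1,1]})$ the honest and modified characters coincide, so ${\rm ch}$ and $\widetilde{\rm ch}$ may be interchanged for it.) 1) $S$-transformation: (i) $\widetilde{\rm ch}^{(+)}_{H(\Lambda^{[-1,0]})}(-\frac1\tau,\frac z\tau)=i\,e^{\frac{\pi iz^2}{\tau}}\,{\rm ch}^{(+)}_{H(\Lambda^{[-1,1]})}(\tau,z)$; (ii) ${\rm ch}^{(+)}_{H(\Lambda^{[-1,1]})}(-\frac1\tau,\frac z\tau)=-i\,e^{\frac{\pi iz^2}{\tau}}\,\widetilde{\rm ch}^{(+)}_{H(\Lambda^{[-1,0]})}(\tau,z)$; (iii) $\widetilde{\rm ch}^{(-)}_{H(\Lambda^{[-1,0]})}(-\frac1\tau,\frac z\tau)=-\frac12e^{\frac{\pi iz^2}{\tau}}\big\{{\rm ch}^{(+){\rm tw}(\sigma_-)}_{H(\Lambda^{[-1,1]})}(\tau,z)+\widetilde{\rm ch}^{(+){\rm tw}(\sigma_+)}_{H(\Lambda^{[-1,1]})}(\tau,z)\big\}$; (iv) ${\rm ch}^{(-)}_{H(\Lambda^{[-1,1]})}(-\frac1\tau,\frac z\tau)=-\frac12e^{\frac{\pi iz^2}{\tau}}\big\{{\rm ch}^{(+){\rm tw}(\sigma_-)}_{H(\Lambda^{[-1,1]})}(\tau,z)-\widetilde{\rm ch}^{(+){\rm tw}(\sigma_+)}_{H(\Lambda^{[-1,1]})}(\tau,z)\big\}$;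 (v) ${\rm ch}^{(+){\rm tw}(\sigma_-)}_{H(\Lambda^{[-1,1]})}(-\frac1\tau,\frac z\tau)=-e^{\frac{\pi iz^2}{\tau}}\big\{\widetilde{\rm ch}^{(-)}_{H(\Lambda^{[-1,0]})}(\tau,z)+{\rm ch}^{(-)}_{H(\Lambda^{[-1,1]})}(\tau,z)\big\}$; (vi) $\widetilde{\rm ch}^{(+){\rm tw}(\sigma_+)}_{H(\Lambda^{[-1,1]})}(-\frac1\tau,\frac z\tau)=-e^{\frac{\pi iz^2}{\tau}}\big\{\widetilde{\rm ch}^{(-)}_{H(\Lambda^{[-1,0]})}(\tau,z)-{\rm ch}^{(-)}_{H(\Lambda^{[-1,1]})}(\tau,z)\big\}$. 2) $T$-transformation: (i) $\widetilde{\rm ch}^{(+)}_{H(\Lambda^{[-1,0]})}(\tau+1,z)=-e^{\frac{7}{24}\pi i}\,\widetilde{\rm ch}^{(-)}_{H(\Lambda^{[-1,0]})}(\tau,z)$; (ii) ${\rm ch}^{(+)}_{H(\Lambda^{[-1,1]})}(\tau+1,z)=-e^{\frac{7}{24}\pi i}\,{\rm ch}^{(-)}_{H(\Lambda^{[-1,1]})}(\tau,z)$; (iii) $\widetilde{\rm ch}^{(-)}_{H(\Lambda^{[-1,0]})}(\tau+1,z)=e^{\frac{7}{24}\pi i}\,\widetilde{\rm ch}^{(+)}_{H(\Lambda^{[-1,0]})}(\tau,z)$; (iv) ${\rm ch}^{(-)}_{H(\Lambda^{[-1,1]})}(\tau+1,z)=-e^{\frac{7}{24}\pi i}\,{\rm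 ch}^{(+)}_{H(\Lambda^{[-1,1]})}(\tau,z)$; (v) ${\rm ch}^{(+){\rm tw}(\sigma_-)}_{H(\Lambda^{[-1,1]})}(\tau+1,z)=e^{-\frac{\pi i}{12}}\,{\rm ch}^{(+){\rm tw}(\sigma_-)}_{H(\Lambda^{[-1,1]})}(\tau,z)$; (vi) $\widetilde{\rm ch}^{(+){\rm tw}(\sigma_+)}_{H(\Lambda^{[-1,1]})}(\tau+1,z)=-e^{-\frac{\pi i}{12}}\,\widetilde{\rm ch}^{(+){\rm tw}(\sigma_+)}_{H(\Lambda^{[-1,1]})}(\tau,z)$.
   Context: Notation: $\mathbb{C}_+$ is the upper half-plane, $q^a:=e^{2\pi i a\tau}$, $\eta(\tau)=q^{1/24}\prod_{n\ge1}(1-q^n)$, and for $a,b\in\{0,1\}$ the Mumford theta functions are $\vartheta_{ab}(\tau,z)=\sum_{n\in\mathbb{Z}}e^{\pi i\tau(n+\frac a2)^2+2\pi i(n+\frac a2)(z+\frac b2)}$. For $m\in\frac12\mathbb{N}$, $s\in\frac12\mathbb{Z}$ put $\Phi_1^{[m,s]}(\tau,z_1,z_2,t)=e^{-2\pi imt}\sum_{j\in\mathbb{Z}}\frac{e^{2\pi imj(z_1+z_2)+2\pi isz_1}e^{2\pi i\tau(mj^2+sj)}}{1-e^{2\pi iz_1}e^{2\pi ij\tau}}$, $\Phi_2^{[m,s]}(\tau,z_1,z_2,t)=e^{-2\pi imt}\sum_{j\in\mathbb{Z}}\frac{e^{-2\pi imj(z_1+z_2)-2\pi isz_2}e^{2\pi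 i\tau(mj^2+sj)}}{1-e^{-2\pi iz_2}e^{2\pi ij\tau}}$, $\Phi^{[m,s]}=\Phi_1^{[m,s]}-\Phi_2^{[m,s]}$. Let $\theta_{k,m}(\tau,z)=\sum_{j\in\mathbb{Z}}e^{2\pi im(j+\frac{k}{2m})z}e^{2\pi i\tau m(j+\frac{k}{2m})^2}$, $E(x)=2\int_0^xe^{-\pi t^2}dt$, and $R_{j;m}(\tau,w)=\sum_{n\in j+2m\mathbb{Z}}\big\{{\rm sgn}(n-\frac12-j+2m)-E\big((n-2m\frac{{\rm Im}\,w}{{\rm Im}\,\tau})\sqrt{{\rm Im}(\tau)/m}\big)\big\}e^{-\frac{\pi in^2\tau}{2m}+2\pi inw}$. The correction term is $\Phi^{[m,s]}_{\rm add}(\tau,z_1,z_2,t)=-\frac12e^{-2\pi imt}\sum_{k\in s+\mathbb{Z},\,s\le k<s+2m}R_{k;m}(\tau,\frac{z_1-z_2}{2})[\theta_{k,m}-\theta_{-k,m}](\tau,z_1+z_2)$, and the modification is $\widetilde\Phi^{[m,s]}=\Phi^{[m,s]}+\Phi^{[m,s]}_{\rm add}$. N=3 denominators: $R^{(+)}(\tau,z)=\eta(\frac\tau2)\eta(2\tau)\frac{\vartheta_{11}(\tau,z)}{\vartheta_{00}(\tau,z)}$, $R^{(-)}(\tau,z)=\frac{\eta(\tau)^3}{\eta(\frac\tau2)}\frac{\vartheta_{11}(\tau,z)}{\vartheta_{01}(\tau,z)}$, $R^{(+){\rm tw}}(\tau,z)=\frac1{\sqrt2}\frac{\eta(\tau)^3}{\eta(2\tau)}\frac{\vartheta_{11}(\tau,z)}{\vartheta_{10}(\tau,z)}$.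 For $m_2\in\{0,1,2\}$ let $H(\Lambda^{[-1,m_2]})$ be the N=3 superconformal module obtained by quantum Hamiltonian reduction of the $\widehat{osp}(3|2)$-module of highest weight $-\Lambda_0-\frac{m_2}{2}\alpha_1$. Its honest character, supercharacter and twisted characters, with $s=\frac{m_2+1}{2}$, are the functions of $(\tau,z)$ given by $R^{(+)}{\rm ch}^{(+)}=\Phi^{[1,s]}(2\tau,z+\frac\tau2-\frac12,z-\frac\tau2+\frac12,\frac\tau8)$, $R^{(-)}{\rm ch}^{(-)}=\Phi^{[1,s]}(2\tau,z+\frac\tau2,z-\frac\tau2,\frac\tau8)$, $R^{(+){\rm tw}}{\rm ch}^{(+){\rm tw}(\sigma_+)}=\Phi^{[1,s]}(2\tau,z+\tau-\frac12,z-\tau+\frac12,\frac\tau2)$, $R^{(+){\rm tw}}{\rm ch}^{(+){\rm tw}(\sigma_-)}=\Phi^{[1,s]}(2\tau,z-\frac12,z+\frac12,0)$. The modified characters $\widetilde{\rm ch}$ are defined by the same formulas with $\Phi$ replaced by $\widetilde\Phi$. *)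

(* Defs.v *)
From Stdlib Require Import Reals ZArith.
From Coquelicot Require Import Coquelicot.
Open Scope R_scope.
Open Scope C_scope.

Definition Cexp (w : C) : C :=
  ((exp (Re w) * cos (Im w))%R, (exp (Re w) * sin (Im w))%R).

Definition CSeries (a : nat -> C) : C :=
  (Series (fun n => Re (a n)), Series (fun n => Im (a n))).

(** All two-sided series below converge absolutely for [0 < Im tau], away from
    the zeros of the denominators, so the order of summation is immaterial. *)
Definition CSumZ (f : Z -> C) : C :=
  CSeries (fun n => f (Z.of_nat n)) + CSeries (fun n => f (- Z.of_nat (S n))%Z).

Fixpoint Csum (f : nat -> C) (N : nat) : C :=
  match N with O => 0 | S n => Csum f n + f n end.

Fixpoint Cprod (f : nat -> C) (N : nat) : C :=
  match N with O => 1 | S n => Cprod f n * f n end.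

Definition CProdInf (f : nat -> C) : C :=
  (real (Lim_seq (fun N => Re (Cprod f N))),
   real (Lim_seq (fun N => Im (Cprod f N)))).

Definition eta (tau : C) : C :=
  Cexp (2 * PI * Ci * (tau / 24)) *
  CProdInf (fun n => 1 - Cexp (2 * PI * Ci * (INR (S n) * tau))).

Definition vartheta (a b : nat) (tau z : C) : C :=
  CSumZ (fun n =>
    let p := IZR n + INR a / 2 in
    Cexp (PI * Ci * tau * (p * p) + 2 * PI * Ci * p * (z + INR b / 2))).

(** In [Phi1], [Phi2], [Phi], [Phi_add] and [Phi_mod] the half-integers
    m and s are given by their doubles: m = M/2 with [M : nat], s = S/2 with
    [S : Z]. *)
Definition Phi1 (M : nat) (S : Z) (tau z1 z2 t : C) : C :=
  let m := (INR M / 2)%R in let s := (IZR S / 2)%R in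
  Cexp (- (2 * PI * Ci * m * t)) *
  CSumZ (fun n =>
    let j := IZR n in
    Cexp (2 * PI * Ci * m * j * (z1 + z2) + 2 * PI * Ci * s * z1) *
    Cexp (2 * PI * Ci * tau * (m * (j * j) + s * j)) /
    (1 - Cexp (2 * PI * Ci * z1) * Cexp (2 * PI * Ci * j * tau))).

Definition Phi2 (M : nat) (S : Z) (tau z1 z2 t : C) : C :=
  let m := (INR M / 2)%R in let s := (IZR S / 2)%R in
  Cexp (- (2 * PI * Ci * m * t)) *
  CSumZ (fun n =>
    let j := IZR n in
    Cexp (- (2 * PI * Ci * m * j * (z1 + z2)) - 2 * PI * Ci * s * z2) *
    Cexp (2 * PI * Ci * tau * (m * (j * j) + s * j)) /
    (1 - Cexp (- (2 * PI * Ci * z2)) * Cexp (2 * PI * Ci * j * tau))).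

Definition Phi (M : nat) (S : Z) (tau z1 z2 t : C) : C :=
  Phi1 M S tau z1 z2 t - Phi2 M S tau z1 z2 t.

Definition theta (k m : R) (tau z : C) : C :=
  CSumZ (fun n =>
    let p := (IZR n + k / (2 * m))%R in
    Cexp (2 * PI * Ci * m * p * z) * Cexp (2 * PI * Ci * tau * m * (p * p))).

Definition E (x : R) : R :=
  (2 * RInt (fun t => exp (- (PI * (t * t)))) 0 x)%R.

Definition R_jm (j m : R) (tau w : C) : C :=
  CSumZ (fun l =>
    let n := (j + 2 * m * IZR l)%R in
    RtoC (sign (n - 1 / 2 - j + 2 * m)
          - E ((n - 2 * m * (Im w / Im tau)) * sqrt (Im tau / m)))%R *
    Cexp (- (PI * Ci * (n * n) * tau / (2 * m)) + 2 * PI * Ci * n * w)).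

Definition Phi_add (M : nat) (S : Z) (tau z1 z2 t : C) : C :=
  let m := (INR M / 2)%R in let s := (IZR S / 2)%R in
  - (1 / 2) * Cexp (- (2 * PI * Ci * m * t)) *
  Csum (fun i =>
    let k := (s + INR i)%R in
    R_jm k m tau ((z1 - z2) / 2) *
    (theta k m tau (z1 + z2) - theta (- k) m tau (z1 + z2))) M.

Definition Phi_mod (M : nat) (S : Z) (tau z1 z2 t : C) : C :=
  Phi M S tau z1 z2 t + Phi_add M S tau z1 z2 t.

Definition R_p (tau z : C) : C :=
  eta (tau / 2) * eta (2 * tau) * (vartheta 1 1 tau z / vartheta 0 0 tau z).

Definition R_m (tau z : C) : C :=
  eta tau ^ 3 / eta (tau / 2) * (vartheta 1 1 tau z / vartheta 0 1 tau z).

Definition R_tw (tau z : C) : C :=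
  1 / sqrt 2 * (eta tau ^ 3 / eta (2 * tau)) *
  (vartheta 1 1 tau z / vartheta 1 0 tau z).

(** The relation [R * ch = F] determines ch, for fixed tau, as a meromorphic
    function of z, and [mquot F R z] is its value at z: the limit of [F w / R w]
    as [w] tends to z.  Where [F] is regular and R is defined and nonzero this
    limit is just [F z / R z]; at the zeros of the theta functions in R and at
    the poles of [F] it is the value after removing the singularity.  (All the
    characters that enter the transformation formulas are entire in z, so the
    limit exists at every z and [C_lim] returns it, by [is_C_lim_unique].) *)
Definition mquot (F D : C -> C) (z : C) : C :=
  C_lim (fun w => F w / D w) z.

(** Characters of H(Lambda^[-1,m2]): here m = 1 and s = (m2 + 1)/2, that is
    [M = 2] and [S = m2 + 1].  [F] is [Phi] for the honest characters and
    [Phi_mod] for the modified ones. *)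
Definition char_p (F : nat -> Z -> C -> C -> C -> C -> C) (m2 : nat)
    (tau z : C) : C :=
  mquot (fun w => F 2%nat (Z.of_nat m2 + 1)%Z (2 * tau)
                    (w + tau / 2 - 1 / 2) (w - tau / 2 + 1 / 2) (tau / 8))
        (R_p tau) z.

Definition char_m (F : nat -> Z -> C -> C -> C -> C -> C) (m2 : nat)
    (tau z : C) : C :=
  mquot (fun w => F 2%nat (Z.of_nat m2 + 1)%Z (2 * tau)
                    (w + tau / 2) (w - tau / 2) (tau / 8))
        (R_m tau) z.

Definition char_tw_sp (F : nat -> Z -> C -> C -> C -> C -> C) (m2 : nat)
    (tau z : C) : C :=
  mquot (fun w => F 2%nat (Z.of_nat m2 + 1)%Z (2 * tau)
                    (w + tau - 1 / 2) (w - tau + 1 / 2) (tau / 2))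
        (R_tw tau) z.

Definition char_tw_sm (F : nat -> Z -> C -> C -> C -> C -> C) (m2 : nat)
    (tau z : C) : C :=
  mquot (fun w => F 2%nat (Z.of_nat m2 + 1)%Z (2 * tau)
                    (w - 1 / 2) (w + 1 / 2) 0)
        (R_tw tau) z.

Definition ch_p := char_p Phi.
Definition ch_m := char_m Phi.
Definition ch_tw_sp := char_tw_sp Phi.
Definition ch_tw_sm := char_tw_sm Phi.

Definition mch_p := char_p Phi_mod.
Definition mch_m := char_m Phi_mod.
Definition mch_tw_sp := char_tw_sp Phi_mod.
Definition mch_tw_sm := char_tw_sm Phi_mod.

(* Main.v *)
Require Import Defs.
From Stdlib Require Import Reals ZArith Lia Lra Psatz List Permutation.
From Stdlib Require Import Classical ClassicalEpsilon FunctionalExtensionality.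
From Coquelicot Require Import Coquelicot.
Local Open Scope C_scope.

(** At the points of the statement the correction of [Phi^[1,s]] is a sum of
    error functions that cancel in pairs, and the modified function collapses to
    a single Appell sum with numerators [x^n q^(n^2/2)]. Multiplied by a theta
    function vanishing at its poles, such a sum lies in a two-dimensional space
    of theta functions of index one; comparing two values identifies it as a theta
    quotient, so that each character is an eta quotient times a theta constant
    times [th tau z]. The modular laws follow from theta inversion, obtained from
    finite Fourier analysis of Gaussian sums on a grid with mesh tending to zero,
    and from the inversion of [eta], written as a theta value by Euler's
    pentagonal number theorem. *)

(** * Sequential limits of complex numbers *)

(** Two facts make the correction terms elementary. For s = 1/2 the points of the statement put the
    argument of every error function at an integer multiple of one number, so oddness of [E] leaves
    a single exponential. For s = 1 the correction is zero, because theta_{k,1} depends on k modulo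
    2 only. Everything runs on absolutely convergent sums. Where a classical proof would use
    Liouville's theorem, Laurent coefficients of a double sum are regrouped; where it would use a
    Gaussian integral, Riemann sums are compared with each other and eliminated. The multiplier of
    theta inversion, classically the square root of -i tau, therefore stays a quotient [th_mult] of
    theta constants. Each character has weight 0 (an eta quotient of weight -1 times two theta
    values), so the multiplier cancels as soon as its values at tau/2, tau and 2 tau are related.
    That is why the scaling law [th_mult_scal], with a real square root, is enough. The inversion of
    [eta] uses the same law at r = 1/3. *)

Definition cvg (u : nat -> C) (l : C) : Prop :=
  forall eps : R, (0 < eps)%R ->
  exists N, forall n, (N <= n)%nat -> (Cmod (u n - l) < eps)%R.

Lemma Cmod_minus_sym (a b : C) : Cmod (a - b) = Cmod (b - a).
Proof. rewrite <- Cmod_opp. f_equal. ring. Qed.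

Lemma Cmod_rev_triangle (a b : C) : (Cmod a - Cmod b <= Cmod (a - b))%R.
Proof.
  pose proof (Cmod_triangle (a - b) b) as H.
  replace (a - b + b) with a in H by ring. lra.
Qed.

Lemma Cmod_minus_triangle (a b c : C) :
  (Cmod (a - c) <= Cmod (a - b) + Cmod (b - c))%R.
Proof.
  replace (a - c) with ((a - b) + (b - c)) by ring. apply Cmod_triangle.
Qed.

Lemma Cmod_minus_le (a b : C) : (Cmod (a - b) <= Cmod a + Cmod b)%R.
Proof.
  unfold Cminus. rewrite <- (Cmod_opp b). apply Cmod_triangle.
Qed.

Lemma Cmod_small_0 (a : C) :
  (forall eps : R, (0 < eps)%R -> (Cmod a <= eps)%R) -> a = 0.
Proof.
  intros H. apply Cmod_eq_0.
  apply Rle_antisym; [ | apply Cmod_ge_0].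
  apply Rnot_lt_le; intros Hlt.
  specialize (H (Cmod a / 2)%R ltac:(lra)). lra.
Qed.

Lemma cvg_const (c : C) : cvg (fun _ => c) c.
Proof.
  intros eps He. exists 0%nat. intros n _.
  replace (c - c) with (RtoC 0) by ring. rewrite Cmod_0. exact He.
Qed.

Lemma cvg_unique (u : nat -> C) (l l' : C) : cvg u l -> cvg u l' -> l = l'.
Proof.
  intros H H'.
  cut (l - l' = 0). { intros E. replace l with (l - l' + l') by ring. rewrite E; ring. }
  apply Cmod_small_0. intros eps He.
  destruct (H (eps / 2)%R ltac:(lra)) as [N HN].
  destruct (H' (eps / 2)%R ltac:(lra)) as [N' HN'].
  specialize (HN (max N N') ltac:(lia)). specialize (HN' (max N N') ltac:(lia)).
  rewrite Cmod_minus_sym in HN.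
  pose proof (Cmod_minus_triangle l (u (max N N')) l'). lra.
Qed.

Lemma cvg_eventually (u v : nat -> C) (l : C) (N0 : nat) :
  (forall n, (N0 <= n)%nat -> u n = v n) -> cvg u l -> cvg v l.
Proof.
  intros E H eps He. destruct (H eps He) as [N HN].
  exists (max N N0). intros n Hn. rewrite <- E by lia. apply HN; lia.
Qed.

Lemma cvg_ext (u v : nat -> C) (l : C) :
  (forall n, u n = v n) -> cvg u l -> cvg v l.
Proof. intros E. apply cvg_eventually with 0%nat; auto. Qed.

Lemma cvg_plus (u v : nat -> C) (l m : C) :
  cvg u l -> cvg v m -> cvg (fun n => u n + v n) (l + m).
Proof.
  intros H H' eps He.
  destruct (H (eps / 2)%R ltac:(lra)) as [N HN].
  destruct (H' (eps / 2)%R ltac:(lra)) as [N' HN'].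
  exists (max N N'). intros n Hn.
  specialize (HN n ltac:(lia)). specialize (HN' n ltac:(lia)).
  replace (u n + v n - (l + m)) with ((u n - l) + (v n - m)) by ring.
  pose proof (Cmod_triangle (u n - l) (v n - m)). lra.
Qed.

Lemma cvg_bounded (u : nat -> C) (l : C) : cvg u l ->
  exists N, forall n, (N <= n)%nat -> (Cmod (u n) <= Cmod l + 1)%R.
Proof.
  intros H. destruct (H 1%R ltac:(lra)) as [N HN]. exists N. intros n Hn.
  specialize (HN n Hn). pose proof (Cmod_rev_triangle (u n) l). lra.
Qed.

Lemma cvg_mult (u v : nat -> C) (l m : C) :
  cvg u l -> cvg v m -> cvg (fun n => u n * v n) (l * m).
Proof.
  intros H H' eps He.
  destruct (cvg_bounded u l H) as [N0 HN0].
  pose proof (Cmod_ge_0 l) as Pl. pose proof (Cmod_ge_0 m) as Pm.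
  destruct (H (eps / (2 * (Cmod m + 1)))%R) as [N HN].
  { apply Rdiv_lt_0_compat; lra. }
  destruct (H' (eps / (2 * (Cmod l + 1)))%R) as [N' HN'].
  { apply Rdiv_lt_0_compat; lra. }
  exists (max N0 (max N N')). intros n Hn.
  specialize (HN n ltac:(lia)). specialize (HN' n ltac:(lia)).
  specialize (HN0 n ltac:(lia)).
  replace (u n * v n - l * m) with (u n * (v n - m) + (u n - l) * m) by ring.
  pose proof (Cmod_triangle (u n * (v n - m)) ((u n - l) * m)) as T.
  rewrite !Cmod_mult in T.
  apply Rlt_div_r in HN; [ | lra]. apply Rlt_div_r in HN'; [ | lra].
  pose proof (Cmod_ge_0 (u n - l)). pose proof (Cmod_ge_0 (v n - m)).
  pose proof (Cmod_ge_0 (u n)).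
  assert (Cmod (u n) * Cmod (v n - m) <= (Cmod l + 1) * Cmod (v n - m))%R
    by (apply Rmult_le_compat_r; lra).
  nra.
Qed.

Lemma cvg_scal (c : C) (u : nat -> C) (l : C) :
  cvg u l -> cvg (fun n => c * u n) (c * l).
Proof. intros H. apply (cvg_mult (fun _ => c)); [apply cvg_const | exact H]. Qed.

Lemma cvg_opp (u : nat -> C) (l : C) : cvg u l -> cvg (fun n => - u n) (- l).
Proof.
  intros H. apply cvg_ext with (fun n => (-1) * u n); [intros; ring | ].
  replace (- l) with ((-1) * l) by ring. apply cvg_scal, H.
Qed.

Lemma cvg_minus (u v : nat -> C) (l m : C) :
  cvg u l -> cvg v m -> cvg (fun n => u n - v n) (l - m).
Proof. intros H H'. apply (cvg_plus u (fun n => - v n)); auto using cvg_opp. Qed.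

Lemma cvg_inv (u : nat -> C) (l : C) :
  l <> 0 -> cvg u l -> cvg (fun n => / u n) (/ l).
Proof.
  intros Hl H eps He.
  pose proof (Cmod_gt_0 l) as [Pl _]. specialize (Pl Hl).
  destruct (H (Cmod l / 2)%R ltac:(lra)) as [N0 HN0].
  destruct (H (eps * (Cmod l * Cmod l) / 2)%R) as [N HN].
  { apply Rdiv_lt_0_compat; [ | lra]. repeat apply Rmult_lt_0_compat; lra. }
  exists (max N0 N). intros n Hn.
  specialize (HN0 n ltac:(lia)). specialize (HN n ltac:(lia)).
  assert (Hu : (Cmod l / 2 < Cmod (u n))%R).
  { rewrite Cmod_minus_sym in HN0. pose proof (Cmod_rev_triangle l (u n)). lra. }
  assert (Hun : u n <> 0). { intros E. rewrite E, Cmod_0 in Hu. lra. }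
  replace (/ u n - / l) with ((l - u n) / (u n * l)) by (field; auto).
  rewrite Cmod_div by (apply Cmult_neq_0; auto). rewrite Cmod_mult, Cmod_minus_sym.
  apply Rlt_div_l; [apply Rmult_lt_0_compat; lra | ].
  apply Rlt_le_trans with (1 := HN).
  replace (eps * (Cmod l * Cmod l) / 2)%R with (eps * (Cmod l / 2 * Cmod l))%R by field.
  apply Rmult_le_compat_l; [lra | ]. apply Rmult_le_compat_r; lra.
Qed.

Lemma cvg_div (u v : nat -> C) (l m : C) :
  m <> 0 -> cvg u l -> cvg v m -> cvg (fun n => u n / v n) (l / m).
Proof. intros Hm H H'. apply cvg_mult; auto using cvg_inv. Qed.

Lemma cvg_squeeze (u : nat -> C) (l : C) (b : nat -> R) :
  (forall n, (Cmod (u n - l) <= b n)%R) -> is_lim_seq b 0%R -> cvg u l.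
Proof.
  intros H Hb eps He. apply is_lim_seq_spec in Hb.
  destruct (Hb (mkposreal eps He)) as [N HN]. exists N. intros n Hn.
  specialize (HN n Hn). simpl in HN. specialize (H n).
  rewrite Rminus_0_r in HN. apply Rabs_def2 in HN. lra.
Qed.

Lemma cvg_subseq (u : nat -> C) (l : C) (f : nat -> nat) :
  (forall n, (n <= f n)%nat) -> cvg u l -> cvg (fun n => u (f n)) l.
Proof.
  intros Hf H eps He. destruct (H eps He) as [N HN]. exists N.
  intros n Hn. apply HN. specialize (Hf n). lia.
Qed.

Lemma cvg_RtoC (u : nat -> R) (l : R) :
  is_lim_seq u l -> cvg (fun n => RtoC (u n)) l.
Proof.
  intros H eps He. apply is_lim_seq_spec in H.
  destruct (H (mkposreal eps He)) as [N HN]. exists N. intros n Hn.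
  rewrite <- RtoC_minus, Cmod_R. apply (HN n Hn).
Qed.

Lemma im_le_Cmod (c : C) : (Rabs (Im c) <= Cmod c)%R.
Proof.
  destruct c as [x y]. simpl. unfold Cmod. simpl. apply Rsqr_incr_0_var; [ | apply sqrt_pos].
  rewrite <- Rsqr_abs, Rsqr_sqrt by nra. unfold Rsqr. nra.
Qed.

Lemma cvg_Re_Im (u : nat -> C) (l : C) : cvg u l ->
  is_lim_seq (fun n => Re (u n)) (Re l) /\ is_lim_seq (fun n => Im (u n)) (Im l).
Proof.
  intros H. split; apply is_lim_seq_spec; intros eps;
    destruct (H eps (cond_pos eps)) as [N HN]; exists N; intros n Hn;
    specialize (HN n Hn).
  - replace (Re (u n) - Re l)%R with (Re (u n - l)) by reflexivity.
    pose proof (re_le_Cmod (u n - l)). lra.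
  - replace (Im (u n) - Im l)%R with (Im (u n - l)) by reflexivity.
    pose proof (im_le_Cmod (u n - l)). lra.
Qed.

(** * Unconditional sums *)

Section Sums.
Context {A : Type}.
Implicit Types (f : A -> C) (g : A -> R) (l : list A).

Definition eq_dec_classic (a b : A) : {a = b} + {a <> b} :=
  excluded_middle_informative (a = b).

Definition lsumR g l : R := fold_right (fun a s => (g a + s)%R) 0%R l.
Definition lsum f l : C := fold_right (fun a s => f a + s) 0 l.

(** [bndR] keeps the constant explicit, as the grid estimates need; [summR] forgets it. *)
Definition bndR g (B : R) : Prop := forall l, NoDup l -> (lsumR g l <= B)%R.
Definition summR g : Prop := exists B, bndR g B.
Definition summ f : Prop := summR (fun a => Cmod (f a)).

(** Convergence along the net of finite sets, a finite set being a duplicate-free list compared by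
    [incl]. No enumeration of the index type is fixed, so reindexing, splitting and Fubini hold over
    any type. *)
Definition has_sum f (s : C) : Prop :=
  forall eps : R, (0 < eps)%R -> exists l0, NoDup l0 /\
  forall l, NoDup l -> incl l0 l -> (Cmod (lsum f l - s) < eps)%R.

(** Choice makes the sum a total function, so that [tsum_ext] is plain equality of functions; it is
    the true sum whenever one exists. *)
Definition tsum f : C := epsilon (inhabits (RtoC 0)) (has_sum f).

Lemma lsum_app f l l' : lsum f (l ++ l') = lsum f l + lsum f l'.
Proof. induction l as [|a l IH]; simpl; [ | rewrite IH]; ring. Qed.

Lemma lsumR_app g l l' : lsumR g (l ++ l') = (lsumR g l + lsumR g l')%R.
Proof. induction l as [|a l IH]; simpl; [ | rewrite IH]; ring. Qed.

Lemma lsum_perm f l l' : Permutation l l' -> lsum f l = lsum f l'.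
Proof.
  induction 1; simpl; try congruence; ring.
Qed.

Lemma lsumR_perm g l l' : Permutation l l' -> lsumR g l = lsumR g l'.
Proof.
  induction 1; simpl; try congruence; ring.
Qed.

(** The tool for comparing finite sums: a larger finite set is the smaller one followed by a
    remainder. *)
Lemma incl_perm l0 : forall l, NoDup l0 -> NoDup l -> incl l0 l ->
  exists l', Permutation l (l0 ++ l').
Proof.
  induction l0 as [|a l0 IH]; intros l H0 H Hi.
  - exists l. apply Permutation_refl.
  - inversion H0; subst.
    destruct (in_split a l (Hi a (or_introl eq_refl))) as [l1 [l2 ->]].
    destruct (IH (l1 ++ l2)) as [l' Hl']; auto.
    + eapply NoDup_remove_1; eauto.
    + intros x Hx. assert (Hx' := Hi x (or_intror Hx)).
      apply in_app_or in Hx'. apply in_or_app.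
      destruct Hx' as [?|[->|?]]; auto. contradiction.
    + exists l'. rewrite <- Permutation_middle. simpl. now apply perm_skip.
Qed.

Lemma lsumR_nonneg g l : (forall a, (0 <= g a)%R) -> (0 <= lsumR g l)%R.
Proof.
  intros H. induction l as [|a l IH]; simpl; [lra | specialize (H a); lra].
Qed.

Lemma lsumR_incl g l l' : (forall a, (0 <= g a)%R) ->
  NoDup l -> NoDup l' -> incl l l' -> (lsumR g l <= lsumR g l')%R.
Proof.
  intros Hg H H' Hi. destruct (incl_perm l l' H H' Hi) as [m Hm].
  rewrite (lsumR_perm g _ _ Hm), lsumR_app.
  pose proof (lsumR_nonneg g m Hg). lra.
Qed.

Lemma lsumR_le g g' l : (forall a, (g a <= g' a)%R) -> (lsumR g l <= lsumR g' l)%R.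
Proof.
  intros H. induction l as [|a l IH]; simpl; [lra | specialize (H a); lra].
Qed.

Lemma Cmod_lsum f l : (Cmod (lsum f l) <= lsumR (fun a => Cmod (f a)) l)%R.
Proof.
  induction l as [|a l IH]; simpl; [rewrite Cmod_0; lra | ].
  pose proof (Cmod_triangle (f a) (lsum f l)). lra.
Qed.

Lemma lsum_plus f f' l : lsum (fun a => f a + f' a) l = lsum f l + lsum f' l.
Proof. induction l as [|a l IH]; simpl; [ | rewrite IH]; ring. Qed.

Lemma lsum_scal c f l : lsum (fun a => c * f a) l = c * lsum f l.
Proof. induction l as [|a l IH]; simpl; [ | rewrite IH]; ring. Qed.

Lemma lsumR_plus g g' l : lsumR (fun a => g a + g' a)%R l = (lsumR g l + lsumR g' l)%R.
Proof. induction l as [|a l IH]; simpl; [ | rewrite IH]; ring. Qed.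

Lemma lsumR_scal c g l : lsumR (fun a => c * g a)%R l = (c * lsumR g l)%R.
Proof. induction l as [|a l IH]; simpl; [ | rewrite IH]; ring. Qed.

Lemma lsum_ext f f' l : (forall a, In a l -> f a = f' a) -> lsum f l = lsum f' l.
Proof.
  induction l as [|a l IH]; simpl; intros H; [reflexivity | ].
  rewrite IH, H; auto.
Qed.

Lemma lsum_Re_Im f l :
  lsum f l = (lsumR (fun a => Re (f a)) l, lsumR (fun a => Im (f a)) l).
Proof.
  induction l as [|a l IH]; simpl; [reflexivity | ]. rewrite IH.
  reflexivity.
Qed.

Lemma union_NoDup l l' : exists m, NoDup m /\ incl l m /\ incl l' m.
Proof.
  exists (nodup eq_dec_classic (l ++ l')). split; [apply NoDup_nodup | ].
  split; intros a Ha; apply nodup_In, in_or_app; auto.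
Qed.

Lemma bndR_le g g' B : (forall a, (g a <= g' a)%R) -> bndR g' B -> bndR g B.
Proof. intros H HB l Hl. pose proof (lsumR_le g g' l H). specialize (HB l Hl). lra. Qed.

Lemma bndR_plus g g' B B' : bndR g B -> bndR g' B' -> bndR (fun a => g a + g' a)%R (B + B').
Proof. intros H H' l Hl. rewrite lsumR_plus. specialize (H l Hl). specialize (H' l Hl). lra. Qed.

Lemma bndR_scal g B c : (0 <= c)%R -> bndR g B -> bndR (fun a => c * g a)%R (c * B).
Proof. intros Hc H l Hl. rewrite lsumR_scal. apply Rmult_le_compat_l; auto. Qed.

Lemma bndR_nonneg g B : bndR g B -> (0 <= B)%R.
Proof. intros H. specialize (H nil (NoDup_nil _)). exact H. Qed.

Lemma summR_le g g' : (forall a, (g a <= g' a)%R) -> summR g' -> summR g.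
Proof. intros H [B HB]. exists B. eapply bndR_le; eauto. Qed.

Lemma summR_scal g c : (0 <= c)%R -> summR g -> summR (fun a => c * g a)%R.
Proof. intros Hc [B HB]. exists (c * B)%R. now apply bndR_scal. Qed.

Lemma summR_plus g g' : summR g -> summR g' -> summR (fun a => g a + g' a)%R.
Proof. intros [B HB] [B' HB']. exists (B + B')%R. now apply bndR_plus. Qed.

Lemma summ_dom f g : (forall a, (Cmod (f a) <= g a)%R) -> summR g -> summ f.
Proof. apply summR_le. Qed.

Lemma summ_plus f f' : summ f -> summ f' -> summ (fun a => f a + f' a).
Proof.
  intros H H'. apply summ_dom with (fun a => Cmod (f a) + Cmod (f' a))%R.
  - intros a. apply Cmod_triangle.
  - now apply summR_plus.
Qed.

Lemma summ_scal c f : summ f -> summ (fun a => c * f a).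
Proof.
  intros H. apply summ_dom with (fun a => Cmod c * Cmod (f a))%R.
  - intros a. rewrite Cmod_mult. lra.
  - apply summR_scal; [apply Cmod_ge_0 | exact H].
Qed.

Lemma summ_ext f f' : (forall a, f a = f' a) -> summ f -> summ f'.
Proof. intros E H. apply summ_dom with (2 := H). intros a. rewrite E. apply Rle_refl. Qed.

Lemma has_sum_unique f s s' : has_sum f s -> has_sum f s' -> s = s'.
Proof.
  intros H H'.
  cut (s - s' = 0). { intros E. replace s with (s - s' + s') by ring. rewrite E; ring. }
  apply Cmod_small_0. intros eps He.
  destruct (H (eps / 2)%R ltac:(lra)) as [l [Hl Hs]].
  destruct (H' (eps / 2)%R ltac:(lra)) as [l' [Hl' Hs']].
  destruct (union_NoDup l l') as [m [Hm [I I']]].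
  specialize (Hs m Hm I). specialize (Hs' m Hm I').
  rewrite Cmod_minus_sym in Hs.
  pose proof (Cmod_minus_triangle s (lsum f m) s'). lra.
Qed.

Lemma has_sum_tsum f s : has_sum f s -> tsum f = s.
Proof.
  intros H. apply (has_sum_unique f); [ | exact H].
  unfold tsum. apply epsilon_spec. now exists s.
Qed.

(** The number s is the supremum of the finite sums; for nonnegative terms every larger finite set
    stays within eps of it. *)
Lemma bounded_tail g : (forall a, (0 <= g a)%R) -> summR g ->
  exists s, forall eps, (0 < eps)%R -> exists l0, NoDup l0 /\
  forall l, NoDup l -> incl l0 l -> (s - eps < lsumR g l <= s)%R.
Proof.
  intros Hg [B HB].
  destruct (completeness (fun x => exists l, NoDup l /\ x = lsumR g l)) as [s [Hub Hlub]].
  - exists B. intros x [l [Hl ->]]. auto.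
  - exists 0%R, nil. split; [constructor | reflexivity].
  - exists s. intros eps He.
    destruct (classic (exists l0, NoDup l0 /\ (s - eps < lsumR g l0)%R)) as [[l0 [H0 H1]]|Hn].
    + exists l0. split; auto. intros l Hl Hi. split.
      * apply Rlt_le_trans with (1 := H1). now apply lsumR_incl.
      * apply Hub. now exists l.
    + exfalso. assert (s <= s - eps)%R; [ | lra]. apply Hlub.
      intros x [l [Hl ->]]. apply Rnot_lt_le. intros Hlt. apply Hn. now exists l.
Qed.

Lemma has_sum_real_nonneg g : (forall a, (0 <= g a)%R) -> summR g ->
  exists s : R, has_sum (fun a => RtoC (g a)) s.
Proof.
  intros Hg H. destruct (bounded_tail g Hg H) as [s Hs]. exists s.
  intros eps He. destruct (Hs eps He) as [l0 [H0 H1]]. exists l0. split; auto.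
  intros l Hl Hi. specialize (H1 l Hl Hi).
  replace (lsum (fun a => RtoC (g a)) l) with (RtoC (lsumR g l)).
  - rewrite <- RtoC_minus, Cmod_R. apply Rabs_def1; lra.
  - clear. induction l as [|a l IH]; simpl; [reflexivity | ].
    rewrite RtoC_plus, IH. reflexivity.
Qed.

Lemma has_sum_plus f f' s s' :
  has_sum f s -> has_sum f' s' -> has_sum (fun a => f a + f' a) (s + s').
Proof.
  intros H H' eps He.
  destruct (H (eps / 2)%R ltac:(lra)) as [l [Hl Hs]].
  destruct (H' (eps / 2)%R ltac:(lra)) as [l' [Hl' Hs']].
  destruct (union_NoDup l l') as [m [Hm [I I']]].
  exists m. split; auto. intros k Hk Hi.
  specialize (Hs k Hk (fun x h => Hi x (I x h))).
  specialize (Hs' k Hk (fun x h => Hi x (I' x h))).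
  rewrite lsum_plus.
  replace (lsum f k + lsum f' k - (s + s')) with ((lsum f k - s) + (lsum f' k - s')) by ring.
  pose proof (Cmod_triangle (lsum f k - s) (lsum f' k - s')). lra.
Qed.

Lemma has_sum_scal c f s : has_sum f s -> has_sum (fun a => c * f a) (c * s).
Proof.
  intros H eps He. pose proof (Cmod_ge_0 c).
  destruct (H (eps / (Cmod c + 1))%R) as [l [Hl Hs]].
  { apply Rdiv_lt_0_compat; lra. }
  exists l. split; auto. intros k Hk Hi. specialize (Hs k Hk Hi).
  rewrite lsum_scal. replace (c * lsum f k - c * s) with (c * (lsum f k - s)) by ring.
  rewrite Cmod_mult. apply Rlt_div_r in Hs; [ | lra].
  pose proof (Cmod_ge_0 (lsum f k - s)). nra.
Qed.

Lemma has_sum_ext f f' s : (forall a, f a = f' a) -> has_sum f s -> has_sum f' s.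
Proof. intros E. replace f' with f; auto. now apply functional_extensionality. Qed.

Lemma summ_has_sum_ex f : summ f -> exists s, has_sum f s.
Proof.
  intros H.
  (* A real family dominated by |f| is the difference of the nonnegative families g + |f| and |f|.
     This is then applied to the real and imaginary parts of f. *)
  assert (K : forall g : A -> R, (forall a, (Rabs (g a) <= Cmod (f a))%R) ->
    exists s : R, has_sum (fun a => RtoC (g a)) s).
  { intros g Hg.
    destruct (has_sum_real_nonneg (fun a => g a + Cmod (f a))%R) as [s Hs].
    - intros a. specialize (Hg a). apply Rabs_le_between in Hg. lra.
    - apply summR_le with (fun a => 2 * Cmod (f a))%R.
      + intros a. specialize (Hg a). apply Rabs_le_between in Hg. lra.
      + apply summR_scal; [lra | exact H].
    - destruct (has_sum_real_nonneg (fun a => Cmod (f a))) as [t Ht].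
      + intros a. apply Cmod_ge_0.
      + exact H.
      + exists (s + (-1) * t)%R. rewrite RtoC_plus, RtoC_mult.
        apply has_sum_ext with (fun a => RtoC (g a + Cmod (f a)) + RtoC (-1) * RtoC (Cmod (f a))).
        * intros a. rewrite RtoC_plus. ring.
        * apply has_sum_plus; [exact Hs | now apply has_sum_scal]. }
  destruct (K (fun a => Re (f a))) as [s Hs]; [intros; apply re_le_Cmod | ].
  destruct (K (fun a => Im (f a))) as [t Ht]; [intros; apply im_le_Cmod | ].
  exists (s + Ci * t).
  apply has_sum_ext with (fun a => RtoC (Re (f a)) + Ci * RtoC (Im (f a))).
  - intros a. destruct (f a) as [x y]. unfold Re, Im, Ci, Cplus, Cmult, RtoC. simpl.
    f_equal; ring.
  - apply has_sum_plus; [exact Hs | now apply has_sum_scal].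
Qed.

Lemma summ_has_sum f : summ f -> has_sum f (tsum f).
Proof. intros H. unfold tsum. apply epsilon_spec. now apply summ_has_sum_ex. Qed.

Lemma tsum_plus f f' : summ f -> summ f' ->
  tsum (fun a => f a + f' a) = tsum f + tsum f'.
Proof. intros H H'. apply has_sum_tsum, has_sum_plus; now apply summ_has_sum. Qed.

Lemma tsum_scal c f : summ f -> tsum (fun a => c * f a) = c * tsum f.
Proof. intros H. apply has_sum_tsum, has_sum_scal; now apply summ_has_sum. Qed.

Lemma tsum_ext f f' : (forall a, f a = f' a) -> tsum f = tsum f'.
Proof. intros E. f_equal. now apply functional_extensionality. Qed.

Lemma summ_opp f : summ f -> summ (fun a => - f a).
Proof.
  intros H. apply summ_ext with (fun a => (-1) * f a); [intros; ring | now apply summ_scal].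
Qed.

Lemma tsum_opp f : summ f -> tsum (fun a => - f a) = - tsum f.
Proof.
  intros H. rewrite (tsum_ext _ (fun a => (-1) * f a)) by (intros; ring).
  rewrite tsum_scal by exact H. ring.
Qed.

Lemma summ_minus f f' : summ f -> summ f' -> summ (fun a => f a - f' a).
Proof. intros H H'. apply (summ_plus f (fun a => - f' a)); auto using summ_opp. Qed.

Lemma tsum_minus f f' : summ f -> summ f' ->
  tsum (fun a => f a - f' a) = tsum f - tsum f'.
Proof.
  intros H H'. unfold Cminus. rewrite tsum_plus; auto using summ_opp.
  now rewrite tsum_opp.
Qed.

Lemma tsum_bound f g B : (forall a, (Cmod (f a) <= g a)%R) -> bndR g B ->
  (Cmod (tsum f) <= B)%R.
Proof.
  intros H HB. assert (S : summ f) by (apply summ_dom with g; [auto | now exists B]).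
  apply Rnot_lt_le. intros Hlt.
  destruct (summ_has_sum f S (Cmod (tsum f) - B)%R ltac:(lra)) as [l [Hl Hs]].
  specialize (Hs l Hl (fun x h => h)). rewrite Cmod_minus_sym in Hs.
  pose proof (Cmod_rev_triangle (tsum f) (lsum f l)).
  pose proof (Cmod_lsum f l). pose proof (lsumR_le _ _ l H). specialize (HB l Hl). lra.
Qed.

(** The finite set depends on the majorant alone and serves all dominated families at once. This
    uniformity is what [tannery] rests on. *)
Lemma tail_bound g eps : (forall a, (0 <= g a)%R) -> summR g -> (0 < eps)%R ->
  exists l0, NoDup l0 /\ forall f, (forall a, (Cmod (f a) <= g a)%R) ->
  (Cmod (tsum f - lsum f l0) <= eps)%R.
Proof.
  intros Hg Hs He. destruct (bounded_tail g Hg Hs) as [s Ht].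
  destruct (Ht eps He) as [l0 [H0 H1]]. exists l0. split; auto. intros f Hf.
  apply Rnot_lt_le. intros Hlt.
  destruct (summ_has_sum f (summ_dom f g Hf Hs) (Cmod (tsum f - lsum f l0) - eps)%R ltac:(lra))
    as [l [Hl Hfl]].
  destruct (union_NoDup l0 l) as [m [Hm [I I']]].
  specialize (Hfl m Hm I').
  destruct (incl_perm l0 m H0 Hm I) as [k Hk].
  assert (Hb : (Cmod (lsum f m - lsum f l0) < eps)%R).
  { rewrite (lsum_perm f _ _ Hk), lsum_app.
    replace (lsum f l0 + lsum f k - lsum f l0) with (lsum f k) by ring.
    pose proof (Cmod_lsum f k). pose proof (lsumR_le _ _ k Hf).
    pose proof (H1 m Hm I) as E1. rewrite (lsumR_perm g _ _ Hk), lsumR_app in E1.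
    pose proof (H1 l0 H0 (fun x h => h)). lra. }
  rewrite Cmod_minus_sym in Hfl.
  pose proof (Cmod_minus_triangle (tsum f) (lsum f m) (lsum f l0)). lra.
Qed.

Lemma cvg_lsum (u : nat -> A -> C) f l :
  (forall a, cvg (fun n => u n a) (f a)) -> cvg (fun n => lsum (u n) l) (lsum f l).
Proof.
  intros H. induction l as [|a l IH]; simpl; [apply cvg_const | now apply cvg_plus].
Qed.

(** Dominated convergence for sums: beyond a finite set all terms are uniformly small, and on that
    set the convergence is termwise. *)
Lemma tannery (u : nat -> A -> C) f g :
  summR g -> (forall n a, (Cmod (u n a) <= g a)%R) ->
  (forall a, cvg (fun n => u n a) (f a)) -> cvg (fun n => tsum (u n)) (tsum f).
Proof.
  intros Hs Hb Hc.
  assert (Hg : forall a, (0 <= g a)%R).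
  { intros a. apply Rle_trans with (2 := Hb 0%nat a). apply Cmod_ge_0. }
  assert (Hf : forall a, (Cmod (f a) <= g a)%R).
  { intros a. apply Rnot_lt_le. intros Hlt.
    destruct (Hc a (Cmod (f a) - g a)%R ltac:(lra)) as [N HN].
    specialize (HN N (le_n _)). specialize (Hb N a).
    rewrite Cmod_minus_sym in HN. pose proof (Cmod_rev_triangle (f a) (u N a)). lra. }
  intros eps He.
  destruct (tail_bound g (eps / 4)%R Hg Hs ltac:(lra)) as [l [Hl Ht]].
  destruct (cvg_lsum u f l Hc (eps / 4)%R ltac:(lra)) as [N HN].
  exists N. intros n Hn. specialize (HN n Hn).
  pose proof (Ht (u n) (Hb n)) as E1. pose proof (Ht f Hf) as E2.
  rewrite Cmod_minus_sym in E2.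
  pose proof (Cmod_minus_triangle (tsum (u n)) (lsum (u n) l) (tsum f)).
  pose proof (Cmod_minus_triangle (lsum (u n) l) (lsum f l) (tsum f)). lra.
Qed.

End Sums.

Lemma lsum_map {A B} (f : B -> C) (h : A -> B) l :
  lsum f (map h l) = lsum (fun a => f (h a)) l.
Proof. induction l as [|a l IH]; simpl; [ | rewrite IH]; reflexivity. Qed.

Lemma lsumR_map {A B} (f : B -> R) (h : A -> B) l :
  lsumR f (map h l) = lsumR (fun a => f (h a)) l.
Proof. induction l as [|a l IH]; simpl; [ | rewrite IH]; reflexivity. Qed.

Lemma bndR_inj {A B} (g : B -> R) (h : A -> B) K :
  (forall a a', h a = h a' -> a = a') -> bndR g K -> bndR (fun a => g (h a)) K.
Proof.
  intros Hi H l Hl. rewrite <- lsumR_map. apply H.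
  apply FinFun.Injective_map_NoDup; auto.
Qed.

Lemma summ_inj {A B} (f : B -> C) (h : A -> B) :
  (forall a a', h a = h a' -> a = a') -> summ f -> summ (fun a => f (h a)).
Proof.
  intros Hi [K H]. exists K.
  apply (bndR_inj (fun b => Cmod (f b)) h K Hi H).
Qed.

Lemma has_sum_supp {A B} (f : B -> C) (h : A -> B) s :
  (forall a a', h a = h a' -> a = a') ->
  (forall b, (forall a, h a <> b) -> f b = 0) ->
  has_sum f s -> has_sum (fun a => f (h a)) s.
Proof.
  intros Hi H0 H eps He. destruct (H eps He) as [l0 [Hl0 Hs]].
  assert (K : forall l : list B, exists m : list A,
    forall b, In b l -> (exists a, h a = b) -> exists a, In a m /\ h a = b).
  { induction l as [|b l [m IH]].
    - exists nil. intros b [].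
    - destruct (classic (exists a, h a = b)) as [[a Ha]|Hn].
      + exists (a :: m). intros b' [<-|Hb'] Hex; [exists a; simpl; auto | ].
        destruct (IH b' Hb' Hex) as [a' [? ?]]. exists a'; simpl; auto.
      + exists m. intros b' [<-|Hb'] Hex; [contradiction | auto]. }
  destruct (K l0) as [m Hm].
  exists (nodup eq_dec_classic m). split; [apply NoDup_nodup | ].
  intros l Hl Hil. rewrite <- (lsum_map f h).
  (* Points of [l0] outside the image of h carry zero terms. Appending them produces a list that
     contains [l0] and has the same sum. *)
  set (out := filter (fun b => if excluded_middle_informative (exists a, h a = b)
                               then false else true) l0).
  assert (Eo : lsum f out = 0).
  { assert (Ho : forall b, In b out -> f b = 0).
    { intros b Hb. apply filter_In in Hb. destruct Hb as [_ Hb].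
      destruct (excluded_middle_informative _) as [?|Hn]; [discriminate | ].
      apply H0. intros a Ha. apply Hn. now exists a. }
    clearbody out. revert Ho. clear. induction out as [|b out IH]; simpl; intros Ho; [reflexivity | ].
    rewrite IH, Ho; auto. ring. }
  replace (lsum f (map h l)) with (lsum f (map h l ++ out)) by (rewrite lsum_app, Eo; ring).
  apply Hs.
  - apply NoDup_app.
    + apply FinFun.Injective_map_NoDup; auto.
    + apply NoDup_filter; auto.
    + intros b Hb Hb'. apply in_map_iff in Hb. destruct Hb as [a [<- Ha]].
      apply filter_In in Hb'. destruct Hb' as [_ Hb'].
      destruct (excluded_middle_informative _) as [?|Hn]; [discriminate | ].
      apply Hn. now exists a.
  - intros b Hb. apply in_or_app.
    destruct (classic (exists a, h a = b)) as [Hex|Hn].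
    + left. destruct (Hm b Hb Hex) as [a [Ha <-]]. apply in_map, Hil, nodup_In, Ha.
    + right. apply filter_In. split; auto.
      destruct (excluded_middle_informative _); [contradiction | reflexivity].
Qed.

Lemma tsum_supp {A B} (f : B -> C) (h : A -> B) :
  (forall a a', h a = h a' -> a = a') ->
  (forall b, (forall a, h a <> b) -> f b = 0) ->
  summ f -> tsum f = tsum (fun a => f (h a)).
Proof.
  intros Hi H0 H. symmetry. apply has_sum_tsum.
  apply has_sum_supp; auto. now apply summ_has_sum.
Qed.

Lemma tsum_bij {A B} (f : B -> C) (h : A -> B) (k : B -> A) :
  (forall a, k (h a) = a) -> (forall b, h (k b) = b) ->
  summ f -> tsum f = tsum (fun a => f (h a)).
Proof.
  intros H1 H2 H. apply tsum_supp; auto.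
  - intros a a' E. rewrite <- (H1 a), <- (H1 a'), E. reflexivity.
  - intros b Hb. exfalso. apply (Hb (k b)), H2.
Qed.

Lemma tsum_single {B} (f : B -> C) (b0 : B) :
  (forall b, b <> b0 -> f b = 0) -> tsum f = f b0.
Proof.
  intros H. apply has_sum_tsum. intros eps He. exists (b0 :: nil).
  split; [constructor; [intros [] | constructor] | ].
  intros l Hl Hi.
  destruct (incl_perm (b0 :: nil) l ltac:(constructor; [intros [] | constructor]) Hl Hi) as [k Hk].
  rewrite (lsum_perm f _ _ Hk). simpl.
  assert (Hnb : ~ In b0 k).
  { apply (Permutation_NoDup Hk) in Hl. simpl in Hl. now inversion Hl. }
  assert (E : lsum f k = 0).
  { clear Hk. induction k as [|b k IH]; simpl in *; [reflexivity | ].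
    rewrite IH by tauto. rewrite H by (intros ->; tauto). ring. }
  rewrite E. replace (f b0 + 0 - f b0) with (RtoC 0) by ring. now rewrite Cmod_0.
Qed.

Lemma has_sum_fubini {A B} (f : A * B -> C) (g : A -> C) s :
  has_sum f s -> (forall a, has_sum (fun b => f (a, b)) (g a)) -> has_sum g s.
Proof.
  intros H Hg eps He.
  destruct (H (eps / 2)%R ltac:(lra)) as [l0 [Hl0 Hs]].
  exists (nodup eq_dec_classic (map fst l0)). split; [apply NoDup_nodup | ].
  intros l Hl Hi.
  assert (Hi' : incl (map fst l0) l).
  { intros x Hx. apply Hi, nodup_In, Hx. }
  (* The error allowed per row, so that all rows of l together cost at most eps / 2. *)
  set (d := (eps / (2 * (INR (length l) + 1)))%R).
  pose proof (pos_INR (length l)) as Hlen.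
  assert (Hd : (0 < d)%R) by (apply Rdiv_lt_0_compat; lra).
  (* For finitely many rows m, built up one row at a time: a finite set of points in these rows that
     contains the part of [l0] lying there and whose sum is close to the sum of the row totals. *)
  assert (K : forall m, NoDup m -> exists L : list (A * B), NoDup L /\
    (forall p, In p L -> In (fst p) m) /\
    (forall p, In p l0 -> In (fst p) m -> In p L) /\
    (Cmod (lsum f L - lsum g m) <= INR (length m) * d)%R).
  { induction m as [|a m IH]; intros Hm.
    - exists nil. repeat split; [constructor | intros p [] | intros p _ [] | ].
      simpl. replace (0 - 0) with (RtoC 0) by ring. rewrite Cmod_0. lra.
    - inversion Hm; subst.
      destruct (IH ltac:(assumption)) as [L [HL [H1 [HL2 HL3]]]].
      destruct (Hg a d Hd) as [b0 [Hb0 Hb]].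
      destruct (union_NoDup b0 (map snd l0)) as [bb [Hbb [Ib Ib']]].
      specialize (Hb bb Hbb Ib).
      exists (map (fun b => (a, b)) bb ++ L). repeat split.
      + apply NoDup_app; auto.
        * apply FinFun.Injective_map_NoDup; auto. intros x y E. now inversion E.
        * intros p Hp Hp'. apply in_map_iff in Hp. destruct Hp as [b [<- _]].
          apply H1 in Hp'. simpl in Hp'. contradiction.
      + intros p Hp. apply in_app_or in Hp. destruct Hp as [Hp|Hp].
        * apply in_map_iff in Hp. destruct Hp as [b [<- _]]. now left.
        * right. auto.
      + intros p Hp [Ha|Hm']; apply in_or_app.
        * left. destruct p as [a' b]. simpl in Ha. subst a'.
          apply in_map. apply Ib'. apply in_map_iff. now exists (a, b).
        * right. auto.
      + rewrite lsum_app, lsum_map. simpl length. rewrite S_INR. simpl lsum.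
        replace (lsum (fun b => f (a, b)) bb + lsum f L - (g a + lsum g m))
          with ((lsum (fun b => f (a, b)) bb - g a) + (lsum f L - lsum g m)) by ring.
        pose proof (Cmod_triangle (lsum (fun b => f (a, b)) bb - g a) (lsum f L - lsum g m)).
        lra. }
  destruct (K l Hl) as [L [HL [_ [HL2 HL3]]]].
  assert (HL4 : (Cmod (lsum f L - s) < eps / 2)%R).
  { apply Hs; auto. intros p Hp. apply HL2; auto. apply Hi', in_map, Hp. }
  rewrite Cmod_minus_sym in HL3.
  pose proof (Cmod_minus_triangle (lsum g l) (lsum f L) s).
  assert (INR (length l) * d <= eps / 2)%R; [ | lra].
  replace (INR (length l) * d)%R
    with (eps / 2 * (INR (length l) / (INR (length l) + 1)))%R by (unfold d; field; lra).
  assert (INR (length l) / (INR (length l) + 1) <= 1)%R; [ | nra].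
  apply Rle_div_l; lra.
Qed.

Lemma summ_slice {A B} (f : A * B -> C) a : summ f -> summ (fun b => f (a, b)).
Proof. apply (summ_inj f (fun b => (a, b))). intros b b' E. now inversion E. Qed.

Lemma tsum_fubini {A B} (f : A * B -> C) : summ f ->
  tsum f = tsum (fun a => tsum (fun b => f (a, b))).
Proof.
  intros H. symmetry. apply has_sum_tsum. apply has_sum_fubini with f.
  - now apply summ_has_sum.
  - intros a. now apply summ_has_sum, summ_slice.
Qed.

(** A finite set of pairs lies in the product of its two projections, over which the sum factors. *)
Lemma summR_prod {A B} (g : A -> R) (h : B -> R) :
  (forall a, (0 <= g a)%R) -> (forall b, (0 <= h b)%R) -> summR g -> summR h ->
  summR (fun p : A * B => g (fst p) * h (snd p))%R.
Proof.
  intros Hg Hh [K HK] [K' HK']. exists (K * K')%R. intros l Hl.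
  set (la := nodup eq_dec_classic (map fst l)).
  set (lb := nodup eq_dec_classic (map snd l)).
  apply Rle_trans with (lsumR (fun p : A * B => g (fst p) * h (snd p))%R (list_prod la lb)).
  - apply lsumR_incl; auto.
    + intros p. now apply Rmult_le_pos.
    + assert (ND : forall (x : list A) (y : list B), NoDup x -> NoDup y -> NoDup (list_prod x y)).
      { induction x as [|a x IH]; intros y Hx Hy; simpl; [constructor | ].
        inversion Hx; subst. apply NoDup_app; auto.
        - apply FinFun.Injective_map_NoDup; auto. intros u v E. now inversion E.
        - intros p Hp Hp'. apply in_map_iff in Hp. destruct Hp as [b [<- _]].
          apply in_prod_iff in Hp'. tauto. }
      apply ND; apply NoDup_nodup.
    + intros [a b] Hp. apply in_prod_iff. split; apply nodup_In, in_map_iff;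
        exists (a, b); auto.
  - assert (E : forall (x : list A) (y : list B),
      lsumR (fun p : A * B => g (fst p) * h (snd p))%R (list_prod x y) = (lsumR g x * lsumR h y)%R).
    { induction x as [|a x IH]; intros y; simpl; [ring | ].
      rewrite lsumR_app, IH, lsumR_map. simpl. rewrite lsumR_scal. ring. }
    rewrite E.
    pose proof (lsumR_nonneg g la Hg). pose proof (lsumR_nonneg h lb Hh).
    apply Rmult_le_compat; auto; [apply HK | apply HK']; apply NoDup_nodup.
Qed.

(** * Sums over [nat] and [Z] *)

Lemma cvg_partial_sums (f : nat -> C) : summ f ->
  cvg (fun N => lsum f (seq 0 N)) (tsum f).
Proof.
  intros H eps He. destruct (summ_has_sum f H eps He) as [l0 [Hl0 Hs]].
  exists (S (list_max l0)). intros n Hn. apply Hs; [apply seq_NoDup | ].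
  intros x Hx. apply in_seq.
  pose proof (proj1 (list_max_le l0 (list_max l0)) (le_n _)) as Hm.
  rewrite Forall_forall in Hm. specialize (Hm x Hx). lia.
Qed.

Lemma lsum_seq_S (f : nat -> C) N : lsum f (seq 0 (S N)) = lsum f (seq 0 N) + f N.
Proof. rewrite seq_S, lsum_app. simpl. ring. Qed.

Lemma lsumR_seq_S (f : nat -> R) N : lsumR f (seq 0 (S N)) = (lsumR f (seq 0 N) + f N)%R.
Proof. rewrite seq_S, lsumR_app. simpl. ring. Qed.

Lemma CSeries_tsum (f : nat -> C) : summ f -> CSeries f = tsum f.
Proof.
  intros H. pose proof (cvg_partial_sums f H) as Hc.
  assert (Hc' : cvg (fun N => lsum f (seq 0 (S N))) (tsum f)).
  { apply (cvg_subseq _ _ S) in Hc; [exact Hc | intros; lia]. }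
  destruct (cvg_Re_Im _ _ Hc') as [Hr Hi].
  assert (Er : forall g : nat -> R, forall n, sum_n g n = lsumR g (seq 0 (S n))).
  { intros g. induction n as [|n IH].
    - rewrite sum_O. simpl. ring.
    - rewrite sum_Sn, IH, (lsumR_seq_S g (S n)). reflexivity. }
  unfold CSeries. rewrite (surjective_pairing (tsum f)). f_equal.
  - apply is_series_unique. apply is_lim_seq_ext with (2 := Hr).
    intros n. rewrite Er, lsum_Re_Im. reflexivity.
  - apply is_series_unique. apply is_lim_seq_ext with (2 := Hi).
    intros n. rewrite Er, lsum_Re_Im. reflexivity.
Qed.

Lemma tsum_split {A B C' : Type} (f : C' -> C) (h : A -> C') (k : B -> C') :
  (forall a a', h a = h a' -> a = a') -> (forall b b', k b = k b' -> b = b') ->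
  (forall a b, h a <> k b) -> (forall c, (exists a, h a = c) \/ (exists b, k b = c)) ->
  summ f -> tsum f = tsum (fun a => f (h a)) + tsum (fun b => f (k b)).
Proof.
  intros Hh Hk Hd Hc Hf.
  set (P c := exists a, h a = c).
  set (fh c := (if excluded_middle_informative (P c) then f c else RtoC 0)).
  set (fk c := (if excluded_middle_informative (P c) then RtoC 0 else f c)).
  assert (Sh : summ fh).
  { apply summ_dom with (2 := Hf). intros c. unfold fh.
    destruct (excluded_middle_informative _); [lra | ]. rewrite Cmod_0. apply Cmod_ge_0. }
  assert (Sk : summ fk).
  { apply summ_dom with (2 := Hf). intros c. unfold fk.
    destruct (excluded_middle_informative _); [ | lra]. rewrite Cmod_0. apply Cmod_ge_0. }
  rewrite (tsum_ext f (fun c => fh c + fk c)).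
  2: { intros c. unfold fh, fk. destruct (excluded_middle_informative _); ring. }
  rewrite tsum_plus by auto. f_equal.
  - rewrite (tsum_supp fh h); auto.
    + apply tsum_ext. intros a. unfold fh. destruct (excluded_middle_informative _) as [|n]; auto.
      exfalso. apply n. now exists a.
    + intros c Hn. unfold fh. destruct (excluded_middle_informative _) as [[a Ha]|]; auto.
      exfalso. now apply (Hn a).
  - rewrite (tsum_supp fk k); auto.
    + apply tsum_ext. intros b. unfold fk. destruct (excluded_middle_informative _) as [[a Ha]|]; auto.
      exfalso. now apply (Hd a b).
    + intros c Hn. unfold fk. destruct (excluded_middle_informative _) as [|n]; auto.
      destruct (Hc c) as [?|[b Hb]]; [contradiction | ]. exfalso. now apply (Hn b).
Qed.

(** The bridge from the series of the statement, taken in a fixed order, to sums whose terms may be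
    regrouped freely. *)
Lemma CSumZ_tsum (f : Z -> C) : summ f -> CSumZ f = tsum f.
Proof.
  intros H. unfold CSumZ.
  assert (I1 : forall a a' : nat, Z.of_nat a = Z.of_nat a' -> a = a') by (intros; lia).
  assert (I2 : forall a a' : nat, (- Z.of_nat (S a))%Z = (- Z.of_nat (S a'))%Z -> a = a')
    by (intros; lia).
  rewrite (CSeries_tsum _ (summ_inj f _ I1 H)), (CSeries_tsum _ (summ_inj f _ I2 H)).
  symmetry. apply (tsum_split f Z.of_nat (fun n => (- Z.of_nat (S n))%Z)); auto.
  - intros; lia.
  - intros c. destruct (Z_le_gt_dec 0 c).
    + left. exists (Z.to_nat c). lia.
    + right. exists (Z.to_nat (- c - 1)). lia.
Qed.

Lemma bndR_Z (g : Z -> R) B : (forall n, (0 <= g n)%R) ->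
  (forall M, (lsumR (fun n => g (Z.of_nat n)) (seq 0 M)
            + lsumR (fun n => g (- Z.of_nat (S n))%Z) (seq 0 M) <= B)%R) -> bndR g B.
Proof.
  intros Hg HB l Hl.
  set (M := S (list_max (map Z.abs_nat l))).
  set (L := map Z.of_nat (seq 0 M) ++ map (fun n => (- Z.of_nat (S n))%Z) (seq 0 M)).
  apply Rle_trans with (lsumR g L).
  - apply lsumR_incl; auto.
    + apply NoDup_app.
      * apply FinFun.Injective_map_NoDup; [intros ? ?; lia | apply seq_NoDup].
      * apply FinFun.Injective_map_NoDup; [intros ? ?; lia | apply seq_NoDup].
      * intros x Hx Hx'. apply in_map_iff in Hx, Hx'.
        destruct Hx as [n [? _]], Hx' as [n' [? _]]. lia.
    + intros x Hx.
      pose proof (proj1 (list_max_le (map Z.abs_nat l) _) (le_n _)) as Hm.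
      rewrite Forall_forall in Hm. specialize (Hm (Z.abs_nat x) (in_map _ _ _ Hx)).
      apply in_or_app. destruct (Z_le_gt_dec 0 x).
      * left. apply in_map_iff. exists (Z.to_nat x). split; [lia | ].
        apply in_seq. unfold M. lia.
      * right. apply in_map_iff. exists (Z.to_nat (- x - 1)). split; [lia | ].
        apply in_seq. unfold M. lia.
  - unfold L. rewrite lsumR_app, !lsumR_map. apply HB.
Qed.

Lemma bndR_nat (g : nat -> R) B : (forall n, (0 <= g n)%R) ->
  (forall M, (lsumR g (seq 0 M) <= B)%R) -> bndR g B.
Proof.
  intros Hg HB l Hl. apply Rle_trans with (2 := HB (S (list_max l))).
  apply lsumR_incl; auto; [apply seq_NoDup | ].
  intros x Hx. apply in_seq.
  pose proof (proj1 (list_max_le l (list_max l)) (le_n _)) as Hm.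
  rewrite Forall_forall in Hm. specialize (Hm x Hx). lia.
Qed.

Lemma geom_partial (r : R) M : (0 <= r < 1)%R ->
  (lsumR (fun n => r ^ n)%R (seq 0 M) <= / (1 - r))%R.
Proof.
  intros Hr.
  assert (E : (lsumR (fun n => r ^ n)%R (seq 0 M) = (1 - r ^ M) / (1 - r))%R).
  { induction M as [|M IH]; [simpl; field; lra | ].
    rewrite lsumR_seq_S, IH. simpl. field. lra. }
  rewrite E. unfold Rdiv. rewrite <- (Rmult_1_l (/ (1 - r))) at 2.
  apply Rmult_le_compat_r.
  - left. apply Rinv_0_lt_compat. lra.
  - pose proof (pow_le r M (proj1 Hr)). lra.
Qed.

Lemma bndR_geom (r : R) : (0 <= r < 1)%R -> bndR (fun n : nat => r ^ n)%R (/ (1 - r)).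
Proof.
  intros Hr. apply bndR_nat; [intros; apply pow_le; lra | intros; now apply geom_partial].
Qed.

Lemma exp_INR_pow x n : exp (- (x * INR n)) = (exp (- x) ^ n)%R.
Proof.
  induction n as [|n IH]; [simpl; rewrite Rmult_0_r, Ropp_0; apply exp_0 | ].
  rewrite S_INR. simpl. rewrite <- IH, <- exp_plus. f_equal. ring.
Qed.

Lemma bndR_exp_abs (c : R) : (0 < c)%R ->
  bndR (fun n : Z => exp (- (c * Rabs (IZR n)))) (2 / (1 - exp (- c))).
Proof.
  intros Hc. assert (Hr : (0 <= exp (- c) < 1)%R).
  { split; [left; apply exp_pos | ]. rewrite <- exp_0. apply exp_increasing. lra. }
  apply bndR_Z; [intros; left; apply exp_pos | ].
  intros M.
  assert (E1 : lsumR (fun n => exp (- (c * Rabs (IZR (Z.of_nat n))))) (seq 0 M)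
    = lsumR (fun n => exp (- c) ^ n)%R (seq 0 M)).
  { f_equal. apply functional_extensionality. intros n.
    rewrite <- INR_IZR_INZ, Rabs_pos_eq by apply pos_INR. apply exp_INR_pow. }
  assert (E2 : (lsumR (fun n => exp (- (c * Rabs (IZR (- Z.of_nat (S n)))))) (seq 0 M)
    <= lsumR (fun n => exp (- c) ^ n)%R (seq 0 M))%R).
  { apply lsumR_le. intros n.
    rewrite opp_IZR, Rabs_Ropp, <- INR_IZR_INZ, Rabs_pos_eq by apply pos_INR.
    rewrite exp_INR_pow. simpl. pose proof (pow_le (exp (- c)) n (proj1 Hr)). nra. }
  rewrite E1. pose proof (geom_partial (exp (- c)) M Hr).
  unfold Rdiv. lra.
Qed.

Lemma summR_exp_abs (c : R) : (0 < c)%R -> summR (fun n : Z => exp (- (c * Rabs (IZR n)))).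
Proof. intros Hc. eexists. now apply bndR_exp_abs. Qed.

Lemma exp_le (x y : R) : (x <= y)%R -> (exp x <= exp y)%R.
Proof.
  intros [H|<-]; [left; now apply exp_increasing | apply Rle_refl].
Qed.

(** Completing the square with b + 1 instead of b leaves a spare -|x|, so a Gaussian times exp(b|x|)
    is dominated by a two-sided geometric series. *)
Lemma gauss_le (a b x : R) : (0 < a)%R ->
  (- a * (x * x) + b * Rabs x <= (b + 1) ^ 2 / (4 * a) - Rabs x)%R.
Proof.
  intros Ha. rewrite <- (Rabs_right (x * x)%R) by nra. rewrite Rabs_mult.
  set (y := Rabs x).
  replace ((b + 1) ^ 2 / (4 * a) - y)%R with
    (- a * (y * y) + b * y + a * (y - (b + 1) / (2 * a)) ^ 2)%R by (field; lra).
  pose proof (pow2_ge_0 (y - (b + 1) / (2 * a))). nra.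
Qed.

Lemma summR_gauss (a b c : R) : (0 < a)%R ->
  summR (fun n : Z => exp (- a * (IZR n * IZR n) + b * Rabs (IZR n) + c)).
Proof.
  intros Ha.
  apply summR_le with
    (fun n : Z => exp ((b + 1) ^ 2 / (4 * a) + c) * exp (- (1 * Rabs (IZR n))))%R.
  - intros n. rewrite <- exp_plus. apply exp_le.
    pose proof (gauss_le a b (IZR n) Ha). lra.
  - apply summR_scal; [left; apply exp_pos | apply summR_exp_abs; lra].
Qed.

(** Odd integers are written -2j - 1 because this is where the j-th term of [Phi2] lands in the
    combined Appell sum; the even ones 2j come from [Phi1]. *)
Lemma tsum_parity (f : Z -> C) : summ f ->
  tsum f = tsum (fun j => f (2 * j)%Z) + tsum (fun j => f (- 2 * j - 1)%Z).
Proof.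
  intros H. apply (tsum_split f (fun j => 2 * j)%Z (fun j => - 2 * j - 1)%Z); auto;
    try (intros; lia).
  intros c. destruct (Z.Even_or_Odd c) as [[k Hk]|[k Hk]].
  - left. exists k. lia.
  - right. exists (- k - 1)%Z. lia.
Qed.

(** * The exponential [e x = exp (2 pi i x)] *)

Definition e (x : C) : C := Cexp (2 * PI * Ci * x).

Lemma C2_neq0 : RtoC 2 <> 0.
Proof. intros H. apply RtoC_inj in H. lra. Qed.

Lemma Cexp_plus (a b : C) : Cexp (a + b) = Cexp a * Cexp b.
Proof.
  destruct a as [a1 a2], b as [b1 b2]. unfold Cexp, Cmult, Re, Im, Cplus. simpl.
  rewrite exp_plus, cos_plus, sin_plus. f_equal; ring.
Qed.

Lemma Cexp_0 : Cexp 0 = 1.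
Proof. unfold Cexp, Re, Im. simpl. rewrite exp_0, cos_0, sin_0. apply injective_projections; simpl; ring. Qed.

Lemma Cmod_Cexp (a : C) : Cmod (Cexp a) = exp (Re a).
Proof.
  unfold Cmod, Cexp. simpl.
  replace (exp (Re a) * cos (Im a) * (exp (Re a) * cos (Im a) * 1)
    + exp (Re a) * sin (Im a) * (exp (Re a) * sin (Im a) * 1))%R
    with (Rsqr (exp (Re a)) * ((sin (Im a))² + (cos (Im a))²))%R by (unfold Rsqr; ring).
  rewrite sin2_cos2, Rmult_1_r. apply sqrt_Rsqr. left. apply exp_pos.
Qed.

Lemma e_plus (a b : C) : e (a + b) = e a * e b.
Proof. unfold e. rewrite <- Cexp_plus. f_equal. ring. Qed.

Lemma e_0 : e 0 = 1.
Proof. unfold e. rewrite Cmult_0_r. apply Cexp_0. Qed.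

Lemma Cmod_e (a : C) : Cmod (e a) = exp (- (2 * PI * Im a)).
Proof.
  unfold e. rewrite Cmod_Cexp. f_equal. destruct a as [x y].
  unfold Re, Im, Ci. simpl. ring.
Qed.

Lemma e_neq0 (a : C) : e a <> 0.
Proof.
  intros H. pose proof (exp_pos (- (2 * PI * Im a))) as P.
  rewrite <- Cmod_e, H, Cmod_0 in P. lra.
Qed.

Lemma e_opp (a : C) : e (- a) = / e a.
Proof.
  assert (H : e a * e (- a) = 1).
  { rewrite <- e_plus, <- e_0. f_equal. ring. }
  rewrite <- (Cmult_1_r (/ e a)), <- H. field. apply e_neq0.
Qed.

Lemma e_real (x : R) : e x = (cos (2 * PI * x), sin (2 * PI * x)).
Proof.
  unfold e, Cexp, Re, Im, Ci. simpl.
  replace (((2 * PI - 0 * 0) * 0 - (2 * 0 + 0 * PI) * 1) * x - ((2 * PI - 0 * 0) * 1 + (2 * 0 + 0 * PI) * 0) * 0)%R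
    with 0%R by ring.
  replace (((2 * PI - 0 * 0) * 0 - (2 * 0 + 0 * PI) * 1) * 0 + ((2 * PI - 0 * 0) * 1 + (2 * 0 + 0 * PI) * 0) * x)%R
    with (2 * PI * x)%R by ring.
  rewrite exp_0. f_equal; ring.
Qed.

Lemma e_half : e (/ 2) = - 1.
Proof.
  rewrite <- RtoC_inv by lra. rewrite e_real.
  replace (2 * PI * / 2)%R with PI by field. rewrite cos_PI, sin_PI.
  apply injective_projections; simpl; ring.
Qed.

Lemma e_quarter : e (/ 4) = Ci.
Proof.
  rewrite <- RtoC_inv by lra. rewrite e_real.
  replace (2 * PI * / 4)%R with (PI / 2)%R by field. rewrite cos_PI2, sin_PI2. reflexivity.
Qed.

Lemma e_1 : e 1 = 1.
Proof.
  rewrite e_real. rewrite Rmult_1_r, cos_2PI, sin_2PI. reflexivity.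
Qed.

Lemma e_Z (n : Z) : e (IZR n) = 1.
Proof.
  assert (H : forall k : nat, e (IZR (Z.of_nat k)) = 1).
  { induction k as [|k IH]; [apply e_0 | ].
    rewrite Nat2Z.inj_succ, succ_IZR, RtoC_plus, e_plus, IH, e_1. ring. }
  destruct (Z_le_gt_dec 0 n).
  - rewrite <- (Z2Nat.id n) by lia. apply H.
  - replace n with (- Z.of_nat (Z.to_nat (- n)))%Z by lia.
    rewrite opp_IZR, RtoC_opp, e_opp, H. field.
Qed.

Lemma e_shift (n : Z) (a b : C) : a = b + IZR n -> e a = e b.
Proof. intros ->. rewrite e_plus, e_Z. ring. Qed.

(** The modulus forces w to be real, and then cos(2 pi w) = 1 forces sin(pi w) = 0. *)
Lemma e_eq1 (w : C) : e w = 1 -> exists n : Z, w = IZR n.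
Proof.
  intros H. assert (Hy : Im w = 0%R).
  { pose proof (Cmod_e w) as E. rewrite H, Cmod_1 in E.
    rewrite <- exp_0 in E. apply exp_inv in E. pose proof PI_RGT_0. nra. }
  destruct w as [x y]. unfold Im in Hy. simpl in Hy. subst y.
  change (x, 0%R) with (RtoC x) in *. rewrite e_real in H.
  pose proof (f_equal fst H) as Hc. pose proof (f_equal snd H) as Hs. simpl in Hc, Hs.
  assert (Hs2 : sin (PI * x) = 0%R).
  { replace (2 * PI * x)%R with (2 * (PI * x))%R in Hc by ring.
    rewrite cos_2a_sin in Hc.
    assert (sin (PI * x) * sin (PI * x) = 0)%R by lra.
    destruct (Rmult_integral _ _ H0); auto. }
  destruct (sin_eq_0_0 _ Hs2) as [k Hk]. exists k. f_equal.
  pose proof PI_RGT_0. apply Rmult_eq_reg_l with PI; lra.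
Qed.

Lemma e_pow (x : C) (n : nat) : e (INR n * x) = (e x ^ n)%C.
Proof.
  induction n as [|n IH].
  - simpl. rewrite Cmult_0_l. apply e_0.
  - rewrite S_INR, RtoC_plus. replace ((INR n + 1) * x) with (x + INR n * x) by ring.
    rewrite e_plus, IH. reflexivity.
Qed.

Lemma Cmod_le_abs (c : C) : (Cmod c <= Rabs (Re c) + Rabs (Im c))%R.
Proof.
  destruct c as [x y]. unfold Cmod, Re, Im. simpl.
  pose proof (Rabs_pos x). pose proof (Rabs_pos y).
  apply Rsqr_incr_0_var; [ | lra]. rewrite Rsqr_sqrt by nra.
  unfold Rsqr. rewrite <- (Rabs_right (x * (x * 1))), <- (Rabs_right (y * (y * 1))) by nra.
  rewrite !Rabs_mult, Rabs_R1. nra.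
Qed.

Lemma Rabs_sin_le (x : R) : (Rabs (sin x) <= Rabs x)%R.
Proof.
  assert (P : forall y, (0 <= y)%R -> (Rabs (sin y) <= y)%R).
  { intros y Hy. destruct (Rle_lt_dec y 1) as [H1|H1].
    - pose proof PI2_1. pose proof (sin_ge_0 y Hy ltac:(pose proof PI_RGT_0; lra)).
      rewrite Rabs_pos_eq by lra. destruct Hy as [Hy|<-]; [ | rewrite sin_0; lra].
      left. now apply sin_lt_x.
    - apply Rle_trans with 1%R; [ | lra]. apply Rabs_le. apply SIN_bound. }
  destruct (Rle_lt_dec 0 x) as [H|H].
  - rewrite (Rabs_pos_eq x H). auto.
  - rewrite <- Rabs_Ropp, <- sin_neg, (Rabs_left x H). apply P. lra.
Qed.

Lemma cos_sub_1 (y : R) : (Rabs (cos y - 1) <= y * y / 2)%R /\ (Rabs (cos y - 1) <= Rabs y)%R.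
Proof.
  assert (E : (cos y - 1 = - (2 * (sin (y / 2) * sin (y / 2))))%R).
  { replace y with (2 * (y / 2))%R at 1 by field. rewrite cos_2a_sin. ring. }
  pose proof (Rabs_sin_le (y / 2)) as H. rewrite E, Rabs_Ropp.
  rewrite !Rabs_mult, (Rabs_right 2) by lra.
  assert (E2 : (Rabs (y / 2) = Rabs y / 2)%R).
  { unfold Rdiv. rewrite Rabs_mult, (Rabs_right (/ 2)); lra. }
  rewrite E2 in H. pose proof (Rabs_pos (sin (y / 2))).
  assert (Rabs (sin (y / 2)) <= 1)%R by (apply Rabs_le, SIN_bound).
  pose proof (Rabs_pos y).
  assert (y * y = Rabs y * Rabs y)%R as -> by (rewrite <- Rabs_mult, Rabs_right; nra).
  split; nra.
Qed.

Lemma sin_sub_id (y : R) : (Rabs (sin y - y) <= y * y)%R.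
Proof.
  destruct (MVT_gen (fun t => sin t - t)%R 0 y (fun t => cos t - 1)%R) as [c [Hc Hm]].
  - intros t _. auto_derive; [auto | ring].
  - intros t _. apply continuity_pt_minus; [apply continuity_sin | apply derivable_continuous, derivable_id].
  - rewrite sin_0 in Hm. replace (sin y - y)%R with ((cos c - 1) * (y - 0))%R by lra.
    rewrite Rminus_0_r, Rabs_mult. destruct (cos_sub_1 c) as [_ H].
    assert (Rabs c <= Rabs y)%R.
    { unfold Rmin, Rmax in Hc. destruct (Rle_dec 0 y) as [Hy|Hy].
      - rewrite !Rabs_pos_eq; lra.
      - rewrite !Rabs_left1; lra. }
    pose proof (Rabs_pos y).
    assert (y * y = Rabs y * Rabs y)%R as -> by (rewrite <- Rabs_mult, Rabs_right; nra).
    nra.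
Qed.

Lemma exp_sub_1 (x : R) : (Rabs (exp x - 1) <= Rabs x * exp (Rabs x))%R.
Proof.
  pose proof (exp_ineq1_le x) as H1. pose proof (exp_ineq1_le (- x)) as H2.
  pose proof (exp_pos x) as P. rewrite exp_Ropp in H2.
  assert (H3 : (exp x * / exp x = 1)%R) by (apply Rinv_r; lra).
  assert (H4 : (exp x - 1 <= x * exp x)%R).
  { assert ((1 - x) * exp x <= / exp x * exp x)%R by (apply Rmult_le_compat_r; lra). lra. }
  destruct (Rle_lt_dec 0 x) as [Hx|Hx].
  - rewrite (Rabs_pos_eq x Hx). rewrite Rabs_pos_eq; lra.
  - assert (exp x < 1)%R by (rewrite <- exp_0; apply exp_increasing; lra).
    rewrite (Rabs_left (exp x - 1)), (Rabs_left x) by lra.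
    assert (1 <= exp (- x))%R by (rewrite <- exp_0; apply exp_le; lra). nra.
Qed.

Lemma exp_sub_1_id (x : R) : (Rabs (exp x - 1 - x) <= x * x * exp (Rabs x))%R.
Proof.
  pose proof (exp_ineq1_le x) as H1. pose proof (exp_ineq1_le (- x)) as H2.
  pose proof (exp_pos x) as P. rewrite exp_Ropp in H2.
  assert (H3 : (exp x * / exp x = 1)%R) by (apply Rinv_r; lra).
  assert (H4 : (exp x - 1 <= x * exp x)%R).
  { assert ((1 - x) * exp x <= / exp x * exp x)%R by (apply Rmult_le_compat_r; lra). lra. }
  rewrite Rabs_pos_eq by lra.
  destruct (Rle_lt_dec 0 x) as [Hx|Hx].
  - rewrite (Rabs_pos_eq x Hx). nra.
  - assert (1 <= exp (Rabs x))%R by (rewrite <- exp_0; apply exp_le, Rabs_pos). nra.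
Qed.

(** One explicit quadratic remainder serves both the continuity of [e] and the uniform Taylor
    estimate for Gaussians on a grid. *)
Lemma Cexp_taylor (w : C) :
  (Cmod (Cexp w - 1 - w) <= 3 * (Cmod w * Cmod w) * exp (Cmod w))%R.
Proof.
  destruct w as [x y].
  pose proof (re_le_Cmod (x, y)) as Hx. pose proof (im_le_Cmod (x, y)) as Hy. simpl in Hx, Hy.
  set (r := Cmod (x, y)) in *.
  eapply Rle_trans; [apply Cmod_le_abs | ].
  unfold Cexp, Re, Im. simpl.
  replace (exp x * cos y + - (1) + - x)%R with ((exp x - 1 - x) + exp x * (cos y - 1))%R by ring.
  replace (exp x * sin y + - 0 + - y)%R with ((exp x - 1) * sin y + (sin y - y))%R by ring.
  pose proof (exp_sub_1_id x) as B1. pose proof (exp_sub_1 x) as B2.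
  pose proof (Rabs_sin_le y) as B3. destruct (cos_sub_1 y) as [B4 _].
  pose proof (sin_sub_id y) as B5.
  pose proof (Rabs_triang (exp x - 1 - x) (exp x * (cos y - 1))) as T1.
  pose proof (Rabs_triang ((exp x - 1) * sin y) (sin y - y)) as T2.
  rewrite Rabs_mult in T1, T2. rewrite (Rabs_pos_eq (exp x)) in T1 by (left; apply exp_pos).
  pose proof (Rabs_pos x) as Px. pose proof (Rabs_pos y) as Py.
  assert (X : (exp x <= exp r)%R) by (apply exp_le; pose proof (Rle_abs x); lra).
  assert (X' : (exp (Rabs x) <= exp r)%R) by (apply exp_le; lra).
  assert (X1 : (1 <= exp r)%R) by (rewrite <- exp_0; apply exp_le; lra).
  assert (Ex : (x * x = Rabs x * Rabs x)%R) by (rewrite <- Rabs_mult, Rabs_right; nra).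
  assert (Ey : (y * y = Rabs y * Rabs y)%R) by (rewrite <- Rabs_mult, Rabs_right; nra).
  rewrite Ex in B1. rewrite Ey in B4, B5.
  assert (R2 : (Rabs x * Rabs x + Rabs y * Rabs y = r * r)%R).
  { rewrite <- Ex, <- Ey. unfold r, Cmod. rewrite sqrt_sqrt; simpl; nra. }
  set (a := Rabs x) in *. set (b := Rabs y) in *. set (E := exp r) in *.
  assert (C1 : (a * a * exp a <= a * a * E)%R) by (apply Rmult_le_compat_l; nra).
  assert (C2 : (exp x * Rabs (cos y - 1) <= E * (b * b / 2))%R).
  { apply Rmult_le_compat; auto; [left; apply exp_pos | apply Rabs_pos]. }
  assert (C3 : (Rabs (exp x - 1) * Rabs (sin y) <= (a * E) * b)%R).
  { apply Rmult_le_compat; auto using Rabs_pos.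
    apply Rle_trans with (1 := B2). apply Rmult_le_compat_l; lra. }
  assert (C4 : (a * b * E <= (a * a + b * b) / 2 * E)%R).
  { apply Rmult_le_compat_r; [lra | ]. pose proof (pow2_ge_0 (a - b)). nra. }
  assert (C6 : (b * b * 1 <= b * b * E)%R) by (apply Rmult_le_compat_l; [apply Rmult_le_pos | ]; lra).
  rewrite <- R2. nra.
Qed.

Lemma cvg_e (u : nat -> C) (l : C) : cvg u l -> cvg (fun n => e (u n)) (e l).
Proof.
  intros H.
  assert (K : cvg (fun n => e (u n - l)) 1).
  { intros eps He. pose proof PI_RGT_0 as Ppi.
    (* With w = 2 pi i (u n - l), the first bound gives |w| < 1, where the Taylor remainder is at
       most 9|w|; the second gives 10|w| < eps. *)
    set (d := Rmin (1 / (2 * PI)) (eps / (20 * PI))).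
    assert (Hd : (0 < d)%R) by (apply Rmin_pos; apply Rdiv_lt_0_compat; lra).
    destruct (H d Hd) as [N HN]. exists N. intros n Hn. specialize (HN n Hn).
    set (w := 2 * PI * Ci * (u n - l)).
    assert (Hw : Cmod w = (2 * PI * Cmod (u n - l))%R).
    { unfold w. rewrite !Cmod_mult, Cmod_Ci, !Cmod_R, !Rabs_right by lra. ring. }
    pose proof (Rmin_l (1 / (2 * PI)) (eps / (20 * PI))) as M1.
    pose proof (Rmin_r (1 / (2 * PI)) (eps / (20 * PI))) as M2. fold d in M1, M2.
    assert (W1 : (Cmod w < 1)%R).
    { rewrite Hw. apply Rlt_le_trans with (2 * PI * (1 / (2 * PI)))%R.
      - apply Rmult_lt_compat_l; lra.
      - right. field. lra. }
    assert (W2 : (10 * Cmod w < eps)%R).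
    { rewrite Hw. apply Rlt_le_trans with (10 * (2 * PI * (eps / (20 * PI))))%R.
      - apply Rmult_lt_compat_l; [lra | ]. apply Rmult_lt_compat_l; lra.
      - right. field. lra. }
    unfold e. fold w. pose proof (Cexp_taylor w) as T. pose proof (Cmod_ge_0 w).
    assert (exp (Cmod w) <= 3)%R by (apply Rle_trans with (exp 1); [apply exp_le; lra | apply exp_le_3]).
    replace (Cexp w - 1) with ((Cexp w - 1 - w) + w) by ring.
    pose proof (Cmod_triangle (Cexp w - 1 - w) w).
    assert (3 * (Cmod w * Cmod w) * exp (Cmod w) <= 3 * (Cmod w * 1) * 3)%R.
    { apply Rmult_le_compat; try nra. left; apply exp_pos. }
    lra. }
  apply cvg_ext with (fun n => e l * e (u n - l)).
  - intros n. rewrite <- e_plus. f_equal. ring.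
  - replace (e l) with (e l * 1) at 1 by ring. apply cvg_scal, K.
Qed.

(** * Infinite products *)

Definition geo (a : nat -> C) : Prop :=
  exists K r : R, (0 <= K)%R /\ (0 <= r < 1)%R /\ forall n, (Cmod (a n) <= K * r ^ n)%R.

Lemma Cprod_bound (a : nat -> C) K r : (0 <= K)%R -> (0 <= r < 1)%R ->
  (forall n, (Cmod (a n) <= K * r ^ n)%R) ->
  forall N, (Cmod (Cprod (fun n => 1 + a n)%C N) <= exp (K / (1 - r)))%R.
Proof.
  intros HK Hr Ha N.
  assert (H : (Cmod (Cprod (fun n => 1 + a n)%C N) <= exp (K * lsumR (fun n => r ^ n)%R (seq 0 N)))%R).
  { induction N as [|N IH].
    - simpl. rewrite Cmod_1, Rmult_0_r, exp_0. lra.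
    - rewrite lsumR_seq_S. simpl. rewrite Cmod_mult, Rmult_plus_distr_l, exp_plus.
      apply Rmult_le_compat; auto using Cmod_ge_0.
      apply Rle_trans with (1 + K * r ^ N)%R.
      + pose proof (Cmod_triangle 1 (a N)) as T. rewrite Cmod_1 in T. specialize (Ha N). lra.
      + apply exp_ineq1_le. }
  apply Rle_trans with (1 := H). apply exp_le. unfold Rdiv.
  apply Rmult_le_compat_l; auto. now apply geom_partial.
Qed.

Lemma summ_geo (a : nat -> C) : geo a -> summ a.
Proof.
  intros [K [r [HK [Hr Ha]]]]. apply summ_dom with (1 := Ha).
  apply summR_scal; auto. eexists. now apply bndR_geom.
Qed.

(** Consecutive partial products differ by p n * a n. The p n are bounded, so the differences are
    dominated by a geometric sequence and telescope to a limit. *)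
Lemma Cprod_cvg (a : nat -> C) : geo a -> exists l, cvg (Cprod (fun n => 1 + a n)) l.
Proof.
  intros [K [r [HK [Hr Ha]]]].
  set (p := Cprod (fun n => 1 + a n)).
  set (d := fun n => p n * a n).
  assert (Hd : summ d).
  { apply summ_geo. exists (exp (K / (1 - r)) * K)%R, r. split; [ | split; auto].
    - apply Rmult_le_pos; auto. left; apply exp_pos.
    - intros n. unfold d. rewrite Cmod_mult, Rmult_assoc.
      apply Rmult_le_compat; auto using Cmod_ge_0. now apply Cprod_bound. }
  exists (1 + tsum d). apply cvg_ext with (fun N => 1 + lsum d (seq 0 N)).
  - induction n as [|n IH]; [unfold p; simpl; ring | ].
    rewrite lsum_seq_S, Cplus_assoc, IH. unfold d. change (p (S n)) with (p n * (1 + a n)). ring.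
  - apply cvg_plus; [apply cvg_const | now apply cvg_partial_sums].
Qed.

Lemma CProdInf_cvg (f : nat -> C) l : cvg (Cprod f) l -> CProdInf f = l.
Proof.
  intros H. destruct (cvg_Re_Im _ _ H) as [Hr Hi].
  unfold CProdInf. rewrite (is_lim_seq_unique _ _ Hr), (is_lim_seq_unique _ _ Hi).
  now destruct l.
Qed.

Lemma CProdInf_spec (a : nat -> C) : geo a ->
  cvg (Cprod (fun n => 1 + a n)) (CProdInf (fun n => 1 + a n)).
Proof.
  intros H. destruct (Cprod_cvg a H) as [l Hl]. now rewrite (CProdInf_cvg _ _ Hl).
Qed.

Lemma Cprod_mult (f g : nat -> C) N : Cprod (fun n => f n * g n) N = Cprod f N * Cprod g N.
Proof. induction N as [|N IH]; simpl; [ring | rewrite IH; ring]. Qed.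

Lemma Cprod_ext (f g : nat -> C) N : (forall n, f n = g n) -> Cprod f N = Cprod g N.
Proof. intros H. induction N as [|N IH]; simpl; [ | rewrite IH, H]; reflexivity. Qed.

Lemma Cprod_neq0 (f : nat -> C) N : (forall n, f n <> 0) -> Cprod f N <> 0.
Proof.
  intros H. induction N as [|N IH]; simpl; [ | now apply Cmult_neq_0].
  intros E. apply RtoC_inj in E. lra.
Qed.

Lemma pow_lim0 (r K eps : R) : (0 <= r < 1)%R -> (0 <= K)%R -> (0 < eps)%R ->
  exists N, forall n, (N <= n)%nat -> (K * r ^ n < eps)%R.
Proof.
  intros Hr HK He.
  assert (L : is_lim_seq (fun n => K * r ^ n)%R 0%R).
  { evar_last; [apply is_lim_seq_scal_l, is_lim_seq_geom; rewrite Rabs_pos_eq; lra | ].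
    simpl. f_equal. ring. }
  apply is_lim_seq_spec in L. destruct (L (mkposreal eps He)) as [N HN]. exists N.
  intros n Hn. specialize (HN n Hn). simpl in HN. rewrite Rminus_0_r in HN.
  apply Rabs_def2 in HN. lra.
Qed.

Lemma geo_bounded_below (a : nat -> C) : geo a -> (forall n, 1 + a n <> 0) ->
  exists c : R, (0 < c)%R /\ forall n, (c <= Cmod (1 + a n))%R.
Proof.
  intros [K [r [HK [Hr Ha]]]] Hn.
  destruct (pow_lim0 r K (1 / 2) Hr HK ltac:(lra)) as [N HN].
  assert (H : forall M, exists c : R, (0 < c)%R /\ forall n, (n < M)%nat -> (c <= Cmod (1 + a n))%R).
  { induction M as [|M [c [Hc IH]]].
    - exists 1%R. split; [lra | intros; lia].
    - exists (Rmin c (Cmod (1 + a M))). split.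
      + apply Rmin_pos; auto. now apply Cmod_gt_0.
      + intros n Hlt. destruct (Nat.eq_dec n M) as [->|Hne]; [apply Rmin_r | ].
        apply Rle_trans with c; [apply Rmin_l | apply IH; lia]. }
  destruct (H N) as [c [Hc Hc']]. exists (Rmin c (1 / 2)). split; [apply Rmin_pos; lra | ].
  intros n. destruct (le_lt_dec N n) as [Hle|Hlt].
  - apply Rle_trans with (1 / 2)%R; [apply Rmin_r | ].
    specialize (HN n Hle). specialize (Ha n).
    pose proof (Cmod_rev_triangle 1 (- a n)%C) as T. rewrite Cmod_1, Cmod_opp in T.
    replace (1 - - a n) with (1 + a n) in T by ring. lra.
  - apply Rle_trans with c; [apply Rmin_l | auto].
Qed.

(** The inverse factors have the same shape 1 + b n with b geometric, so their product converges as
    well. Since the two products multiply to 1, neither limit can vanish. *)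
Lemma geo_inv (a : nat -> C) : geo a -> (forall n, 1 + a n <> 0) ->
  exists b, geo b /\ forall n, 1 + b n = / (1 + a n).
Proof.
  intros Hg Hn. destruct (geo_bounded_below a Hg Hn) as [c [Hc Hb]].
  destruct Hg as [K [r [HK [Hr Ha]]]].
  exists (fun n => - a n / (1 + a n)). split.
  - exists (K / c)%R, r. split; [ | split; auto].
    + apply Rmult_le_pos; auto. left. now apply Rinv_0_lt_compat.
    + intros n. rewrite Cmod_div by auto. rewrite Cmod_opp.
      replace (K / c * r ^ n)%R with ((K * r ^ n) * / c)%R by (field; lra).
      apply Rmult_le_compat; auto using Cmod_ge_0.
      * left. apply Rinv_0_lt_compat. apply Rlt_le_trans with (1 := Hc); auto.
      * apply Rinv_le_contravar; auto.
  - intros n. field. auto.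
Qed.

Lemma Cprod_inv (f g : nat -> C) N : (forall n, f n <> 0) -> (forall n, g n = / f n) ->
  Cprod g N = / Cprod f N.
Proof.
  intros Hf Hg. induction N as [|N IH]; simpl; [field; intros E; apply RtoC_inj in E; lra | ].
  rewrite IH, Hg. field. split; auto. now apply Cprod_neq0.
Qed.

Lemma CProdInf_neq0 (a : nat -> C) : geo a -> (forall n, 1 + a n <> 0) ->
  CProdInf (fun n => 1 + a n) <> 0.
Proof.
  intros Hg Hn E. destruct (geo_inv a Hg Hn) as [b [Hb Hab]].
  pose proof (CProdInf_spec a Hg) as Ha. pose proof (CProdInf_spec b Hb) as Hb'.
  pose proof (cvg_mult _ _ _ _ Ha Hb') as H. rewrite E, Cmult_0_l in H.
  assert (H1 : cvg (fun _ => RtoC 1) 0).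
  { apply cvg_ext with (2 := H). intros n.
    rewrite (Cprod_inv (fun n => 1 + a n) (fun n => 1 + b n)) by auto.
    field. now apply Cprod_neq0. }
  pose proof (cvg_unique _ _ _ H1 (cvg_const 1)) as K. apply RtoC_inj in K. lra.
Qed.

Lemma one_le_exp (x : R) : (0 <= x)%R -> (1 <= exp x)%R.
Proof. intros H. rewrite <- exp_0. now apply exp_le. Qed.

(** A Lipschitz estimate with a constant independent of N; it passes to the infinite product and
    yields [pp_continuous]. *)
Lemma Cprod_diff (a b : nat -> C) K r : (0 <= K)%R -> (0 <= r < 1)%R ->
  (forall n, (Cmod (a n) <= K * r ^ n)%R) -> (forall n, (Cmod (b n) <= K * r ^ n)%R) ->
  forall d, (0 <= d)%R -> (forall n, (Cmod (a n - b n) <= d * r ^ n)%R) ->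
  forall N, (Cmod (Cprod (fun n => 1 + a n)%C N - Cprod (fun n => 1 + b n)%C N)
    <= exp (K / (1 - r)) * exp (K / (1 - r)) * d * / (1 - r))%R.
Proof.
  intros HK Hr Ha Hb d Hd Hab N.
  set (E := exp (K / (1 - r))).
  assert (HE : (1 <= E)%R).
  { unfold E. apply one_le_exp. apply Rmult_le_pos; [exact HK | ].
    left. apply Rinv_0_lt_compat. lra. }
  set (P := Cprod (fun n => 1 + a n)%C). set (Q := Cprod (fun n => 1 + b n)%C).
  assert (H : (Cmod (P N - Q N) <=
    exp (K * lsumR (fun n => r ^ n)%R (seq 0 N)) * E * d * lsumR (fun n => r ^ n)%R (seq 0 N))%R).
  { induction N as [|N IH].
    - replace (P 0%nat - Q 0%nat) with (RtoC 0) by (unfold P, Q; simpl; ring).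
      rewrite Cmod_0. simpl. lra.
    - rewrite lsumR_seq_S.
      change (P (S N)) with (P N * (1 + a N)). change (Q (S N)) with (Q N * (1 + b N)).
      replace (P N * (1 + a N) - Q N * (1 + b N))
        with ((P N - Q N) * (1 + a N) + Q N * (a N - b N)) by ring.
      eapply Rle_trans; [apply Cmod_triangle | ]. rewrite !Cmod_mult.
      set (s := lsumR (fun n => r ^ n)%R (seq 0 N)) in *.
      assert (Hs : (0 <= s)%R) by (apply lsumR_nonneg; intros; apply pow_le; lra).
      pose proof (pow_le r N (proj1 Hr)) as Hp.
      assert (B1 : (Cmod (1 + a N) <= exp (K * r ^ N))%R).
      { apply Rle_trans with (1 + K * r ^ N)%R.
        - pose proof (Cmod_triangle 1 (a N)) as T. rewrite Cmod_1 in T. specialize (Ha N). lra.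
        - apply exp_ineq1_le. }
      assert (B2 : (Cmod (Q N) <= E)%R) by now apply Cprod_bound.
      replace (exp (K * (s + r ^ N))) with (exp (K * s) * exp (K * r ^ N))%R
        by (rewrite <- exp_plus; f_equal; ring).
      set (x := exp (K * s)) in *. set (y := exp (K * r ^ N)) in *.
      assert (Hx : (1 <= x)%R) by (apply one_le_exp, Rmult_le_pos; lra).
      assert (Hy : (1 <= y)%R) by (apply one_le_exp, Rmult_le_pos; lra).
      assert (T1 : (Cmod (P N - Q N) * Cmod (1 + a N) <= (x * E * d * s) * y)%R)
        by (apply Rmult_le_compat; auto using Cmod_ge_0).
      assert (T2 : (Cmod (Q N) * Cmod (a N - b N) <= E * (d * r ^ N))%R)
        by (apply Rmult_le_compat; auto using Cmod_ge_0).
      assert (T3 : (1 * (E * (d * r ^ N)) <= (x * y) * (E * (d * r ^ N)))%R).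
      { apply Rmult_le_compat_r; [ | nra]. apply Rmult_le_pos; [lra | nra]. }
      replace (x * y * E * d * (s + r ^ N))%R
        with (x * E * d * s * y + x * y * (E * (d * r ^ N)))%R by ring.
      lra. }
  apply Rle_trans with (1 := H).
  pose proof (geom_partial r N Hr) as G.
  assert (Hs : (0 <= lsumR (fun n => r ^ n)%R (seq 0 N))%R)
    by (apply lsumR_nonneg; intros; apply pow_le; lra).
  apply Rmult_le_compat; auto.
  - repeat apply Rmult_le_pos; auto; try lra. left; apply exp_pos.
  - apply Rmult_le_compat_r; auto. apply Rmult_le_compat_r; [lra | ].
    apply exp_le. unfold Rdiv. now apply Rmult_le_compat_l.
Qed.

Lemma cvg_Cmod_le (u : nat -> C) l B : (forall n, (Cmod (u n) <= B)%R) -> cvg u l -> (Cmod l <= B)%R.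
Proof.
  intros Hu H. apply Rnot_lt_le. intros Hlt.
  destruct (H (Cmod l - B)%R ltac:(lra)) as [N HN]. specialize (HN N (le_n _)).
  specialize (Hu N). rewrite Cmod_minus_sym in HN.
  pose proof (Cmod_rev_triangle l (u N)). lra.
Qed.

(** The infinite q-Pochhammer symbol (-x; q) with x = e(z) and q = e(tau). *)
Definition pp (tau z : C) : C := CProdInf (fun n => 1 + e (z + INR n * tau)).

Lemma im_affine (z tau : C) (x : R) : Im (z + x * tau) = (Im z + x * Im tau)%R.
Proof. rewrite im_plus, im_scal_l. reflexivity. Qed.

Section Product.
Variable tau : C.
Hypothesis Htau : (0 < Im tau)%R.

Definition qabs : R := exp (- (2 * PI * Im tau)).

Lemma qabs_range : (0 <= qabs < 1)%R.
Proof.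
  unfold qabs. split; [left; apply exp_pos | ]. rewrite <- exp_0.
  apply exp_increasing. pose proof PI_RGT_0. nra.
Qed.

Lemma Cmod_e_affine z n : (Cmod (e (z + INR n * tau)) = Cmod (e z) * qabs ^ n)%R.
Proof.
  rewrite !Cmod_e, im_affine. unfold qabs. rewrite <- exp_INR_pow, <- exp_plus. f_equal. ring.
Qed.

Lemma geo_e z : geo (fun n => e (z + INR n * tau)).
Proof.
  exists (Cmod (e z)), qabs. split; [apply Cmod_ge_0 | split; [apply qabs_range | ]].
  intros n. rewrite Cmod_e_affine. lra.
Qed.

Lemma pp_spec z : cvg (Cprod (fun n => 1 + e (z + INR n * tau))) (pp tau z).
Proof. apply (CProdInf_spec (fun n => e (z + INR n * tau))), geo_e. Qed.

Lemma pp_neq0 z : (forall n, 1 + e (z + INR n * tau) <> 0) -> pp tau z <> 0.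
Proof. apply (CProdInf_neq0 (fun n => e (z + INR n * tau))), geo_e. Qed.

Lemma pp_step z : pp tau z = (1 + e z) * pp tau (z + tau).
Proof.
  eapply cvg_unique; [ | apply cvg_scal, pp_spec].
  apply cvg_ext with (fun N => Cprod (fun n => 1 + e (z + INR n * tau)) (S N)).
  - induction n as [|n IH].
    + simpl. rewrite Cmult_0_l, Cplus_0_r. ring.
    + cbn [Cprod] in *. rewrite IH, <- Cmult_assoc. f_equal. f_equal. f_equal. f_equal.
      rewrite S_INR, RtoC_plus. ring.
  - apply (cvg_subseq _ _ S); [intros; lia | apply pp_spec].
Qed.

Lemma pp_continuous (u : nat -> C) z : cvg u z -> cvg (fun k => pp tau (u k)) (pp tau z).
Proof.
  intros H. pose proof (cvg_e u z H) as He.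
  destruct (cvg_bounded _ _ He) as [N0 HN0].
  set (K := (Cmod (e z) + 1)%R) in *.
  assert (HK : (0 <= K)%R) by (pose proof (Cmod_ge_0 (e z)); unfold K; lra).
  pose proof qabs_range as Hr.
  set (X := (exp (K / (1 - qabs)) * exp (K / (1 - qabs)))%R).
  assert (HX : (0 < X)%R) by (apply Rmult_lt_0_compat; apply exp_pos).
  assert (Hi : (0 < / (1 - qabs))%R) by (apply Rinv_0_lt_compat; lra).
  assert (B : forall k, (N0 <= k)%nat ->
    (Cmod (pp tau (u k) - pp tau z) <= X * Cmod (e (u k) - e z) * / (1 - qabs))%R).
  { intros k Hk.
    apply cvg_Cmod_le with (fun N => Cprod (fun n => 1 + e (u k + INR n * tau)) N
                                   - Cprod (fun n => 1 + e (z + INR n * tau)) N).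
    2: { apply cvg_minus; apply pp_spec. }
    apply Cprod_diff; auto using Cmod_ge_0.
    - intros n. rewrite Cmod_e_affine. apply Rmult_le_compat_r; [apply pow_le; lra | auto].
    - intros n. rewrite Cmod_e_affine. apply Rmult_le_compat_r; [apply pow_le; lra | ].
      unfold K. lra.
    - intros n. rewrite !e_plus.
      replace (e (u k) * e (INR n * tau) - e z * e (INR n * tau))
        with ((e (u k) - e z) * e (INR n * tau)) by ring.
      rewrite Cmod_mult. replace (INR n * tau) with (0 + INR n * tau) by ring.
      rewrite Cmod_e_affine, e_0, Cmod_1, Rmult_1_l. lra. }
  intros eps Heps.
  destruct (He (eps * (1 - qabs) / X)%R) as [N HN].
  { apply Rdiv_lt_0_compat; [ | lra]. apply Rmult_lt_0_compat; lra. }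
  exists (max N0 N). intros k Hk. specialize (B k ltac:(lia)). specialize (HN k ltac:(lia)).
  apply Rle_lt_trans with (1 := B).
  apply Rlt_le_trans with (X * (eps * (1 - qabs) / X) * / (1 - qabs))%R.
  - apply Rmult_lt_compat_r; auto. apply Rmult_lt_compat_l; auto.
  - right. field. lra.
Qed.

End Product.

Lemma pp_shift tau z n : pp tau (z + IZR n) = pp tau z.
Proof.
  unfold pp. f_equal. apply functional_extensionality. intros k. f_equal.
  apply e_shift with n. ring.
Qed.

Lemma pp_tau_shift tau z n : pp (tau + IZR n) z = pp tau z.
Proof.
  unfold pp. f_equal. apply functional_extensionality. intros k. f_equal.
  apply e_shift with (Z.of_nat k * n)%Z.
  rewrite mult_IZR, <- INR_IZR_INZ, RtoC_mult. ring.
Qed.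

Lemma Im_scal_pos (tau : C) (k : R) : (0 < k)%R -> (0 < Im tau)%R -> (0 < Im (k * tau))%R.
Proof. intros. rewrite im_scal_l. now apply Rmult_lt_0_compat. Qed.

Lemma Cprod_block (f : nat -> C) k N :
  Cprod f (k * N) = Cprod (fun n => Cprod (fun i => f (k * n + i)%nat) k) N.
Proof.
  assert (H : forall m j, Cprod f (m + j) = Cprod f m * Cprod (fun i => f (m + i)%nat) j).
  { intros m. induction j as [|j IH]; simpl; [rewrite Nat.add_0_r; ring | ].
    rewrite Nat.add_succ_r. simpl. rewrite IH. ring. }
  induction N as [|N IH]; [rewrite Nat.mul_0_r; reflexivity | ].
  replace (k * S N)%nat with (k * N + k)%nat by lia. rewrite H, IH. reflexivity.
Qed.

Lemma pp_double tau z : (0 < Im tau)%R ->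
  pp tau z = pp (2 * tau) z * pp (2 * tau) (z + tau).
Proof.
  intros H. assert (H2 := Im_scal_pos tau 2 ltac:(lra) H).
  apply cvg_unique with (fun N => Cprod (fun n => 1 + e (z + INR n * tau)) (2 * N)).
  - apply (cvg_subseq _ _ (fun N => 2 * N)%nat); [intros; lia | now apply pp_spec].
  - apply cvg_ext with (2 := cvg_mult _ _ _ _ (pp_spec _ H2 z) (pp_spec _ H2 (z + tau))).
    intros N. rewrite Cprod_block, <- Cprod_mult. apply Cprod_ext. intros n. cbn [Cprod].
    rewrite Cmult_1_l. rewrite !plus_INR, mult_INR, !RtoC_plus, RtoC_mult. simpl (INR 2).
    f_equal; f_equal; f_equal; simpl; rewrite ?RtoC_plus; ring.
Qed.

Lemma pp_triple tau z : (0 < Im tau)%R ->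
  pp tau z = pp (3 * tau) z * pp (3 * tau) (z + tau) * pp (3 * tau) (z + 2 * tau).
Proof.
  intros H. assert (H3 := Im_scal_pos tau 3 ltac:(lra) H).
  apply cvg_unique with (fun N => Cprod (fun n => 1 + e (z + INR n * tau)) (3 * N)).
  - apply (cvg_subseq _ _ (fun N => 3 * N)%nat); [intros; lia | now apply pp_spec].
  - apply cvg_ext with (2 := cvg_mult _ _ _ _ (cvg_mult _ _ _ _ (pp_spec _ H3 z)
      (pp_spec _ H3 (z + tau))) (pp_spec _ H3 (z + 2 * tau))).
    intros N. rewrite Cprod_block, <- !Cprod_mult. apply Cprod_ext. intros n. cbn [Cprod].
    rewrite Cmult_1_l. rewrite !plus_INR, mult_INR, !RtoC_plus, RtoC_mult.
    f_equal; [f_equal | ]; f_equal; f_equal; simpl; rewrite ?RtoC_plus; ring.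
Qed.

(** Factorwise this is (1 + X)(1 - X) = 1 - X^2. *)
Lemma pp_half tau z : (0 < Im tau)%R ->
  pp tau z * pp tau (z + / 2) = pp (2 * tau) (2 * z + / 2).
Proof.
  intros H. assert (H2 := Im_scal_pos tau 2 ltac:(lra) H).
  eapply cvg_unique; [apply cvg_mult; now apply pp_spec | ].
  apply cvg_ext with (2 := pp_spec _ H2 (2 * z + / 2)).
  intros N. rewrite <- Cprod_mult. apply Cprod_ext. intros n.
  replace (2 * z + / 2 + INR n * (2 * tau)) with ((z + INR n * tau) + (z + INR n * tau) + / 2) by ring.
  replace (z + / 2 + INR n * tau) with ((z + INR n * tau) + / 2) by ring.
  rewrite !e_plus, e_half. ring.
Qed.

Definition phi (tau : C) : C := CProdInf (fun n => 1 - e (INR (S n) * tau)).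

Lemma eta_phi tau : eta tau = e (tau / 24) * phi tau.
Proof. reflexivity. Qed.

Lemma phi_pp tau : phi tau = pp tau (tau + / 2).
Proof.
  unfold phi, pp. f_equal. apply functional_extensionality. intros n.
  rewrite S_INR, RtoC_plus.
  replace (tau + / 2 + INR n * tau) with ((INR n + 1) * tau + / 2) by ring.
  rewrite (e_plus _ (/ 2)), e_half. ring.
Qed.

Lemma one_plus_e_neq0 (w : C) : (0 < Im w)%R -> 1 + e w <> 0.
Proof.
  intros H E. assert (Hm : Cmod (e w) = 1%R).
  { replace (e w) with (- (1)) by (rewrite <- (Cplus_0_l (- (1))), <- E; ring).
    rewrite Cmod_opp. apply Cmod_1. }
  rewrite Cmod_e, <- exp_0 in Hm. apply exp_inv in Hm. pose proof PI_RGT_0. nra.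
Qed.

Lemma im_plus_half (z : C) : Im (z + / 2) = Im z.
Proof. rewrite <- RtoC_inv by lra. rewrite im_plus, im_RtoC. ring. Qed.

Lemma pp_neq0_im tau z : (0 < Im tau)%R -> (0 < Im z)%R -> pp tau z <> 0.
Proof.
  intros H Hz. apply pp_neq0; auto. intros n. apply one_plus_e_neq0.
  rewrite im_affine. pose proof (pos_INR n). nra.
Qed.

Lemma phi_neq0 tau : (0 < Im tau)%R -> phi tau <> 0.
Proof.
  intros H. rewrite phi_pp. apply pp_neq0_im; auto. now rewrite im_plus_half.
Qed.

(** * The theta function and the Jacobi triple product *)

(** Normalized so that it is theta_00. The other Mumford functions are its translates by half
    periods times exponentials, so one function carries all the transformation laws. *)
Definition th (tau z : C) : C :=
  tsum (fun n : Z => e (tau * (IZR n * IZR n) / 2 + IZR n * z)).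

Ltac zpush := repeat first [rewrite plus_IZR | rewrite minus_IZR | rewrite opp_IZR
  | rewrite mult_IZR | rewrite RtoC_plus | rewrite RtoC_minus | rewrite RtoC_opp
  | rewrite RtoC_mult].

Lemma tsum_shift (f : Z -> C) (k : Z) : summ f -> tsum f = tsum (fun n => f (n + k)%Z).
Proof.
  intros H. apply (tsum_bij f (fun n => n + k)%Z (fun n => n - k)%Z); auto; intros; lia.
Qed.

Lemma summ_shift (f : Z -> C) (k : Z) : summ f -> summ (fun n => f (n + k)%Z).
Proof. intros H. apply (summ_inj f (fun n => n + k)%Z); auto. intros; lia. Qed.

Lemma tsum_neg (f : Z -> C) : summ f -> tsum f = tsum (fun n => f (- n)%Z).
Proof.
  intros H. apply (tsum_bij f Z.opp Z.opp); auto; intros; lia.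
Qed.

Lemma Cmod_e_quad (tau z : C) (n : R) :
  Cmod (e (tau * (n * n) / 2 + n * z)) = exp (- (PI * Im tau) * (n * n) - 2 * PI * Im z * n).
Proof.
  rewrite Cmod_e. f_equal. destruct tau as [a b], z as [c d].
  unfold Im, Cdiv, Cinv, Cmult, Cplus, RtoC. simpl. field.
Qed.

Lemma quad_dom (tau z : C) (n B : R) : (Rabs (Im z) <= B)%R ->
  (Cmod (e (tau * (n * n) / 2 + n * z)) <=
   exp (- (PI * Im tau) * (n * n) + 2 * PI * B * Rabs n + 0))%R.
Proof.
  intros HB. rewrite Cmod_e_quad. apply exp_le. pose proof PI_RGT_0.
  pose proof (Rle_abs (- (Im z * n))) as H1. rewrite Rabs_Ropp, Rabs_mult in H1.
  pose proof (Rabs_pos n).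
  assert (H2 : (Rabs (Im z) * Rabs n <= B * Rabs n)%R) by (apply Rmult_le_compat_r; lra).
  assert (H3 : (PI * (- (Im z * n)) <= PI * (B * Rabs n))%R) by (apply Rmult_le_compat_l; lra).
  lra.
Qed.

Lemma summ_th (tau z : C) : (0 < Im tau)%R ->
  summ (fun n : Z => e (tau * (IZR n * IZR n) / 2 + IZR n * z)).
Proof.
  intros H.
  apply summ_dom with (fun n : Z => exp (- (PI * Im tau) * (IZR n * IZR n)
    + 2 * PI * Rabs (Im z) * Rabs (IZR n) + 0)).
  - intros n. apply quad_dom. lra.
  - apply summR_gauss. pose proof PI_RGT_0. nra.
Qed.

Ltac cfield := field; repeat split; try apply C2_neq0; try apply e_neq0; auto.

Lemma th_shift tau z n : th tau (z + IZR n) = th tau z.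
Proof.
  apply tsum_ext. intros k. apply e_shift with (k * n)%Z. rewrite mult_IZR, RtoC_mult. ring.
Qed.

Lemma th_1 tau z : th tau (z + 1) = th tau z.
Proof. exact (th_shift tau z 1). Qed.

Lemma th_neg tau z : (0 < Im tau)%R -> th tau (- z) = th tau z.
Proof.
  intros H. unfold th. rewrite (tsum_neg _ (summ_th tau z H)). apply tsum_ext. intros n.
  f_equal. rewrite opp_IZR, RtoC_opp. cfield.
Qed.

Lemma th_quasi tau z (k : Z) : (0 < Im tau)%R ->
  th tau z = e (tau * (IZR k * IZR k) / 2 + IZR k * z) * th tau (z + IZR k * tau).
Proof.
  intros H. unfold th. rewrite (tsum_shift _ k (summ_th tau z H)).
  rewrite <- tsum_scal by now apply summ_th. apply tsum_ext. intros n.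
  rewrite <- e_plus. f_equal. zpush. cfield.
Qed.

Lemma th_tau tau z : (0 < Im tau)%R -> th tau (z + tau) = e (- z - tau / 2) * th tau z.
Proof.
  intros H. rewrite (th_quasi tau z 1 H). rewrite Cmult_assoc, <- e_plus.
  replace (- z - tau / 2 + (tau * (IZR 1 * IZR 1) / 2 + IZR 1 * z)) with (RtoC 0) by cfield.
  rewrite e_0, Cmult_1_l. f_equal. ring.
Qed.

(** * The Jacobi triple product from its finite form *)

Section JTP.
Variable tau : C.
Hypothesis Htau : (0 < Im tau)%R.

Definition qp (n : nat) : C := Cprod (fun k => 1 - e (INR (S k) * tau)) n.
(** The reciprocal of (q; q)_n, with the usual convention that it is 0 for negative n. With it
    [iq_step] holds for every integer (at n = 0 both sides are 0), and sums over m may run over all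
    of Z. *)
Definition iq (n : Z) : C := if Z_lt_dec n 0 then 0 else / qp (Z.to_nat n).

Lemma one_minus_e_neq0 (n : nat) : 1 - e (INR (S n) * tau) <> 0.
Proof.
  replace (1 - e (INR (S n) * tau)) with (1 + e (INR (S n) * tau + / 2)).
  - apply one_plus_e_neq0. rewrite im_plus_half, im_scal_l.
    apply Rmult_lt_0_compat; [apply lt_0_INR; lia | exact Htau].
  - rewrite e_plus, e_half. ring.
Qed.

Lemma qp_neq0 n : qp n <> 0.
Proof. apply Cprod_neq0. intros. apply one_minus_e_neq0. Qed.

Lemma iq_step (n : Z) : (1 - e (IZR n * tau)) * iq n = iq (n - 1).
Proof.
  unfold iq. destruct (Z_lt_dec n 0) as [Hn|Hn].
  - destruct (Z_lt_dec (n - 1) 0); [ring | lia].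
  - destruct (Z.eq_dec n 0) as [->|H0].
    + simpl. rewrite Cmult_0_l, e_0. ring.
    + destruct (Z_lt_dec (n - 1) 0) as [?|_]; [lia | ].
      replace (Z.to_nat n) with (S (Z.to_nat (n - 1))) by lia. unfold qp. cbn [Cprod].
      replace (IZR n) with (INR (S (Z.to_nat (n - 1)))) by (rewrite INR_IZR_INZ; f_equal; lia).
      field. split; first [apply one_minus_e_neq0 | apply qp_neq0].
Qed.

Lemma geo_qp : geo (fun k => - e (INR (S k) * tau)).
Proof.
  destruct (geo_e tau Htau (tau + / 2)) as [K [r [HK [Hr H]]]]. exists K, r. repeat split; try tauto.
  intros n. replace (- e (INR (S n) * tau)) with (e (tau + / 2 + INR n * tau)); auto.
  rewrite S_INR, RtoC_plus.
  replace (tau + / 2 + INR n * tau) with ((INR n + 1) * tau + / 2) by ring.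
  rewrite (e_plus _ (/ 2)), e_half. ring.
Qed.

Lemma qp_cvg : cvg qp (phi tau).
Proof. exact (CProdInf_spec _ geo_qp). Qed.

Lemma qp_bounded : exists K : R, (0 <= K)%R /\ forall n, (Cmod (qp n) <= K)%R.
Proof.
  destruct geo_qp as [K [r [HK [Hr H]]]]. exists (exp (K / (1 - r))).
  split; [left; apply exp_pos | ]. intros n.
  apply (Cprod_bound (fun k => - e (INR (S k) * tau))); auto.
Qed.

Lemma iq_bounded : exists K : R, (0 <= K)%R /\ forall n, (Cmod (iq n) <= K)%R.
Proof.
  destruct (geo_inv _ geo_qp one_minus_e_neq0) as [b [[K [r [HK [Hr H]]]] Hb]].
  exists (exp (K / (1 - r))). split; [left; apply exp_pos | ]. intros n. unfold iq.
  destruct (Z_lt_dec n 0); [rewrite Cmod_0; left; apply exp_pos | ].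
  unfold qp. rewrite <- (Cprod_inv _ (fun n => 1 + b n) _ one_minus_e_neq0 Hb).
  now apply Cprod_bound.
Qed.

(** The q-binomial coefficient of 2N over N + m, divided by (q; q)_(2N) and multiplied by q^(m^2/2).
    It vanishes for |m| > N. *)
Definition dcoef (N : nat) (m : Z) : C :=
  iq (Z.of_nat N - m) * iq (Z.of_nat N + m) * e (tau * (IZR m * IZR m) / 2).

(** A double step of the q-Pascal rule. Up to Gaussian factors, each coefficient at level N is a
    polynomial multiple of the common product A * B from level N + 1, so the claim becomes a
    rational identity in [aq], [bq], [q] and [g]. *)
Lemma dcoef_step (N : nat) (m : Z) :
  (1 - e (tau * (2 * INR N + 1))) * (1 - e (tau * (2 * INR N + 2))) * dcoef (S N) m =
  (1 + e (tau * (2 * INR N + 1))) * dcoef N m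
  + e (tau * (INR N + / 2)) * (dcoef N (m - 1) + dcoef N (m + 1)).
Proof.
  unfold dcoef.
  set (A := iq (Z.of_nat (S N) - m)). set (B := iq (Z.of_nat (S N) + m)).
  set (aq := e (tau * (INR N - IZR m))). set (bq := e (tau * (INR N + IZR m))).
  set (q := e tau).
  assert (E1 : iq (Z.of_nat N - m) = (1 - aq * q) * A).
  { replace (Z.of_nat N - m)%Z with (Z.of_nat (S N) - m - 1)%Z by lia. rewrite <- iq_step.
    unfold A, aq, q. rewrite <- e_plus. f_equal. f_equal. f_equal.
    rewrite Nat2Z.inj_succ. unfold Z.succ. zpush. rewrite <- INR_IZR_INZ. ring. }
  assert (E2 : iq (Z.of_nat N + m) = (1 - bq * q) * B).
  { replace (Z.of_nat N + m)%Z with (Z.of_nat (S N) + m - 1)%Z by lia. rewrite <- iq_step.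
    unfold B, bq, q. rewrite <- e_plus. f_equal. f_equal. f_equal.
    rewrite Nat2Z.inj_succ. unfold Z.succ. zpush. rewrite <- INR_IZR_INZ. ring. }
  replace (Z.of_nat N - (m - 1))%Z with (Z.of_nat (S N) - m)%Z by lia. fold A.
  replace (Z.of_nat N + (m + 1))%Z with (Z.of_nat (S N) + m)%Z by lia. fold B.
  assert (E3 : iq (Z.of_nat N + (m - 1)) = (1 - bq) * ((1 - bq * q) * B)).
  { rewrite <- E2. replace (Z.of_nat N + (m - 1))%Z with (Z.of_nat N + m - 1)%Z by lia.
    rewrite <- iq_step. unfold bq. f_equal. f_equal. f_equal. zpush.
    rewrite <- INR_IZR_INZ. ring. }
  assert (E4 : iq (Z.of_nat N - (m + 1)) = (1 - aq) * ((1 - aq * q) * A)).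
  { rewrite <- E1. replace (Z.of_nat N - (m + 1))%Z with (Z.of_nat N - m - 1)%Z by lia.
    rewrite <- iq_step. unfold aq. f_equal. f_equal. f_equal. zpush.
    rewrite <- INR_IZR_INZ. ring. }
  rewrite E1, E2, E3, E4.
  set (T := e (tau * (IZR m * IZR m) / 2)). set (g := e (tau * (INR N + / 2))).
  assert (F1 : e (tau * (IZR (m - 1) * IZR (m - 1)) / 2) = T * (aq * q) / g).
  { unfold T, aq, q, g. unfold Cdiv. rewrite <- e_opp, <- !e_plus. f_equal. zpush. cfield. }
  assert (F2 : e (tau * (IZR (m + 1) * IZR (m + 1)) / 2) = T * (bq * q) / g).
  { unfold T, bq, q, g. unfold Cdiv. rewrite <- e_opp, <- !e_plus. f_equal. zpush. cfield. }
  rewrite F1, F2.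
  assert (G1 : e (tau * (2 * INR N + 1)) = aq * bq * q).
  { unfold aq, bq, q. rewrite <- !e_plus. f_equal. ring. }
  assert (G2 : e (tau * (2 * INR N + 2)) = aq * q * (bq * q)).
  { unfold aq, bq, q. rewrite <- !e_plus. f_equal. ring. }
  rewrite G1, G2. field. apply e_neq0.
Qed.

Lemma dcoef_bounded : exists K : R, (0 <= K)%R /\
  forall N m, (Cmod (dcoef N m) <= K * Cmod (e (tau * (IZR m * IZR m) / 2)))%R.
Proof.
  destruct iq_bounded as [K [HK Hb]]. exists (K * K)%R. split; [nra | ].
  intros N m. unfold dcoef. rewrite !Cmod_mult. apply Rmult_le_compat_r; [apply Cmod_ge_0 | ].
  apply Rmult_le_compat; auto using Cmod_ge_0.
Qed.

Lemma summ_dcoef_aux (z : C) (k : Z) N :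
  summ (fun m : Z => dcoef N (m + k) * e (IZR (m + k) * z)).
Proof.
  destruct dcoef_bounded as [K [HK Hb]].
  apply (summ_shift (fun m => dcoef N m * e (IZR m * z))).
  apply summ_dom with
    (fun m : Z => K * Cmod (e (tau * (IZR m * IZR m) / 2 + IZR m * z)))%R.
  - intros m. rewrite e_plus, !Cmod_mult, <- Rmult_assoc.
    apply Rmult_le_compat_r; [apply Cmod_ge_0 | auto].
  - apply summR_scal; auto. now apply summ_th.
Qed.

Lemma summ_dcoef (z : C) N : summ (fun m : Z => dcoef N m * e (IZR m * z)).
Proof.
  apply summ_ext with (2 := summ_dcoef_aux z 0 N). intros m. now rewrite Z.add_0_r.
Qed.

(** Multiplication by the two new factors shifts m by -1, 0 or 1, and [dcoef_step] is the resulting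
    recursion between coefficients. For N = 0 only m = 0 survives. *)
Lemma finite_jtp (z : C) (N : nat) :
  Cprod (fun n => (1 + e (z + tau / 2 + INR n * tau)) * (1 + e (- z + tau / 2 + INR n * tau))) N
  = qp (2 * N) * tsum (fun m => dcoef N m * e (IZR m * z)).
Proof.
  induction N as [|N IH].
  - simpl Cprod. rewrite (tsum_single _ 0%Z).
    + unfold dcoef, iq, qp. simpl.
      replace (tau * (0 * 0) / 2) with (RtoC 0) by cfield.
      rewrite Cmult_0_l, !e_0. field.
    + intros m Hm. unfold dcoef, iq.
      destruct (Z_lt_dec (Z.of_nat 0 - m) 0); [ring | ].
      destruct (Z_lt_dec (Z.of_nat 0 + m) 0); [ring | lia].
  - cbn [Cprod]. rewrite IH. clear IH.
    replace (2 * S N)%nat with (S (S (2 * N))) by lia.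
    unfold qp at 2. cbn [Cprod]. fold (qp (2 * N)).
    rewrite <- !Cmult_assoc. f_equal.
    replace (INR (S (2 * N)) * tau) with (tau * (2 * INR N + 1)).
    2: { rewrite S_INR, mult_INR. change (INR 2) with (1 + 1)%R; replace (1 + 1)%R with 2%R by ring. rewrite RtoC_plus, RtoC_mult. ring. }
    replace (INR (S (S (2 * N))) * tau) with (tau * (2 * INR N + 2)).
    2: { rewrite !S_INR, mult_INR. change (INR 2) with (1 + 1)%R; replace (1 + 1)%R with 2%R by ring.
         rewrite !RtoC_plus, RtoC_mult. ring. }
    set (S1 := tsum (fun m => dcoef N m * e (IZR m * z))).
    rewrite <- tsum_scal by apply summ_dcoef.
    rewrite <- tsum_scal by apply summ_scal, summ_dcoef.
    set (y := e (tau * (INR N + / 2))).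
    rewrite (tsum_ext _ (fun m => (1 + e (tau * (2 * INR N + 1))) * (dcoef N m * e (IZR m * z))
      + (y * e z * (dcoef N (m + -1) * e (IZR (m + -1) * z))
      + y * e (- z) * (dcoef N (m + 1) * e (IZR (m + 1) * z))))).
    2: { intros m.
         transitivity ((1 - e (tau * (2 * INR N + 1))) * (1 - e (tau * (2 * INR N + 2)))
                        * dcoef (S N) m * e (IZR m * z)); [ring | ].
         rewrite dcoef_step. fold y. replace (m + -1)%Z with (m - 1)%Z by lia.
         replace (e (IZR m * z)) with (e z * e (IZR (m - 1) * z)) at 1.
         2: { rewrite <- e_plus. f_equal. zpush. ring. }
         replace (e (IZR (m + 1) * z)) with (e z * e z * e (IZR (m - 1) * z)).
         2: { rewrite <- !e_plus. f_equal. zpush. ring. }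
         replace (e (IZR m * z)) with (e z * e (IZR (m - 1) * z)).
         2: { rewrite <- e_plus. f_equal. zpush. ring. }
         rewrite e_opp. field. apply e_neq0. }
    pose proof (summ_scal (1 + e (tau * (2 * INR N + 1))) _ (summ_dcoef z N)) as Sa.
    pose proof (summ_scal (y * e z) _ (summ_dcoef_aux z (-1) N)) as Sb.
    pose proof (summ_scal (y * e (- z)) _ (summ_dcoef_aux z 1 N)) as Sc.
    rewrite (tsum_plus _ _ Sa (summ_plus _ _ Sb Sc)), (tsum_plus _ _ Sb Sc).
    rewrite (tsum_scal _ _ (summ_dcoef z N)), (tsum_scal _ _ (summ_dcoef_aux z (-1) N)),
      (tsum_scal _ _ (summ_dcoef_aux z 1 N)).
    rewrite <- (tsum_shift (fun m => dcoef N m * e (IZR m * z)) (-1) (summ_dcoef z N)).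
    rewrite <- (tsum_shift (fun m => dcoef N m * e (IZR m * z)) 1 (summ_dcoef z N)).
    fold S1.
    replace (e (z + tau / 2 + INR N * tau)) with (y * e z).
    2: { unfold y. rewrite <- e_plus. f_equal. cfield. }
    replace (e (- z + tau / 2 + INR N * tau)) with (y * e (- z)).
    2: { unfold y. rewrite <- e_plus. f_equal. cfield. }
    replace (e (tau * (2 * INR N + 1))) with (y * y).
    2: { unfold y. rewrite <- e_plus. f_equal. cfield. }
    rewrite e_opp. field. apply e_neq0.
Qed.

(** The limit of [finite_jtp]: for fixed m the factor qp(2N) iq(N - m) iq(N + m) tends to 1 / phi,
    and it is bounded uniformly in N and m. *)
Lemma jtp (z : C) : th tau z = phi tau * (pp tau (z + tau / 2) * pp tau (- z + tau / 2)).
Proof.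
  assert (Hphi := phi_neq0 tau Htau).
  destruct qp_bounded as [K1 [HK1 Hb1]]. destruct dcoef_bounded as [K2 [HK2 Hb2]].
  assert (H : cvg (fun N => tsum (fun m => qp (2 * N) * (dcoef N m * e (IZR m * z))))
                  (tsum (fun m : Z => / phi tau * e (tau * (IZR m * IZR m) / 2 + IZR m * z)))).
  { apply tannery with
      (fun m : Z => K1 * (K2 * Cmod (e (tau * (IZR m * IZR m) / 2 + IZR m * z))))%R.
    - apply summR_scal; auto. apply summR_scal; auto. now apply summ_th.
    - intros N m. rewrite e_plus, !Cmod_mult.
      apply Rmult_le_compat; auto using Cmod_ge_0.
      { apply Rmult_le_pos; apply Cmod_ge_0. }
      rewrite <- Rmult_assoc. apply Rmult_le_compat_r; [apply Cmod_ge_0 | auto].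
    - intros m. rewrite e_plus, Cmult_assoc.
      apply cvg_ext with (fun N => (qp (2 * N) * (iq (Z.of_nat N - m) * iq (Z.of_nat N + m)))
        * e (tau * (IZR m * IZR m) / 2) * e (IZR m * z)).
      { intros N. unfold dcoef. ring. }
      apply cvg_mult; [ | apply cvg_const]. apply cvg_mult; [ | apply cvg_const].
      replace (/ phi tau) with (phi tau * (/ phi tau * / phi tau)) by (field; auto).
      assert (L : forall k : Z, cvg (fun N => iq (Z.of_nat N + k)) (/ phi tau)).
      { intros k. intros eps He.
        destruct (cvg_inv _ _ Hphi qp_cvg eps He) as [N0 HN0].
        exists (N0 + Z.abs_nat k)%nat. intros n Hn. unfold iq.
        destruct (Z_lt_dec (Z.of_nat n + k) 0); [lia | ]. apply HN0. lia. }
      apply cvg_mult.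
      + apply (cvg_subseq qp _ (fun N => 2 * N)%nat); [intros; lia | apply qp_cvg].
      + apply cvg_mult; [exact (L (- m)%Z) | exact (L m)]. }
  rewrite tsum_scal in H by now apply summ_th. fold (th tau z) in H.
  assert (H' : cvg (fun N => tsum (fun m => qp (2 * N) * (dcoef N m * e (IZR m * z))))
                   (pp tau (z + tau / 2) * pp tau (- z + tau / 2))).
  { apply cvg_ext with (2 := cvg_mult _ _ _ _ (pp_spec tau Htau (z + tau / 2))
                                         (pp_spec tau Htau (- z + tau / 2))).
    intros N. rewrite <- Cprod_mult, finite_jtp, tsum_scal by apply summ_dcoef. reflexivity. }
  rewrite (cvg_unique _ _ _ H' H). field. exact Hphi.
Qed.

Lemma th_neq0 (z : C) :
  (forall n : Z, 1 + e (z + tau / 2 + IZR n * tau) <> 0) -> th tau z <> 0.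
Proof.
  intros H. rewrite jtp. apply Cmult_neq_0; [now apply phi_neq0 | ].
  apply Cmult_neq_0; apply pp_neq0; auto.
  - intros n. rewrite INR_IZR_INZ. apply H.
  (* The n-th factor of the second product vanishes exactly when the factor of index -n - 1 does,
     since their exponentials are inverse to each other. *)
  - intros n E. apply (H (- Z.of_nat n - 1)%Z).
    replace (z + tau / 2 + IZR (- Z.of_nat n - 1) * tau)
      with (- (- z + tau / 2 + INR n * tau)).
    2: { rewrite INR_IZR_INZ. zpush. cfield. }
    rewrite e_opp. replace (e (- z + tau / 2 + INR n * tau)) with (- (1)).
    + field.
    + rewrite <- (Cplus_0_l (- (1))), <- E. ring.
Qed.

Lemma th_zero : th tau (/ 2 + tau / 2) = 0.
Proof.
  rewrite jtp. replace (- (/ 2 + tau / 2) + tau / 2) with (/ 2 + (- (1))) by cfield.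
  change (- (1)) with (- RtoC (IZR 1)). rewrite <- RtoC_opp, <- opp_IZR, pp_shift, (pp_step tau Htau (/ 2)).
  rewrite e_half. ring.
Qed.

(** Jacobi's theta_2 theta_3 theta_4 = 2 eta^3. It fixes the constants of the Appell sums later: a
    cube of [phi] comes out of the pole and has to be expressed by theta constants. *)
Lemma th_triple : th tau 0 * th tau (/ 2) * th tau (tau / 2) = 2 * (phi tau * phi tau * phi tau).
Proof.
  rewrite !jtp.
  replace (- 0 + tau / 2) with (tau / 2) by ring.
  replace (0 + tau / 2) with (tau / 2) by ring.
  replace (- / 2 + tau / 2) with (/ 2 + tau / 2 + IZR (-1)) by cfield.
  replace (tau / 2 + tau / 2) with tau by cfield.
  replace (- (tau / 2) + tau / 2) with (RtoC 0) by cfield.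
  rewrite pp_shift, (pp_step tau Htau 0), e_0. rewrite Cplus_0_l.
  replace (/ 2 + tau / 2) with (tau / 2 + / 2) by ring.
  (* Euler's identity: the product of (1 - q^(2n-1))(1 + q^n) over n >= 1 equals 1. *)
  assert (K : pp tau (tau / 2) * pp tau (tau / 2 + / 2) * pp tau tau = 1).
  { assert (H2 := Im_scal_pos tau 2 ltac:(lra) Htau).
    rewrite pp_half by auto. replace (2 * (tau / 2) + / 2) with (tau + / 2) by cfield.
    pose proof (pp_half tau tau Htau) as E1. rewrite (pp_double tau (tau + / 2) Htau) in E1.
    replace (tau + / 2 + tau) with (2 * tau + / 2) in E1 by ring.
    assert (N : pp (2 * tau) (2 * tau + / 2) <> 0).
    { apply pp_neq0_im; auto. now rewrite im_plus_half. }
    transitivity (pp tau tau * (pp (2 * tau) (tau + / 2) * pp (2 * tau) (2 * tau + / 2))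
                  / pp (2 * tau) (2 * tau + / 2)); [field; exact N | ].
    rewrite E1. field. exact N. }
  transitivity (2 * (phi tau * phi tau * phi tau) *
    ((pp tau (tau / 2) * pp tau (tau / 2 + / 2) * pp tau tau) *
     (pp tau (tau / 2) * pp tau (tau / 2 + / 2) * pp tau tau))); [ring | ].
  rewrite K. ring.
Qed.

(** It supplies [eta] at (tau + 1)/2, the only argument produced by tau -> tau + 1 that does not
    reduce to tau/2, tau or 2 tau by periodicity. *)
Lemma phi_triple : phi (tau / 2) * phi (2 * tau) * phi ((tau + 1) / 2) =
  phi tau * phi tau * phi tau.
Proof.
  assert (H2 := Im_scal_pos tau 2 ltac:(lra) Htau).
  assert (Hh : (0 < Im (tau / 2))%R).
  { unfold Cdiv. rewrite <- RtoC_inv by lra. rewrite im_scal_r. lra. }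
  assert (Hh' : (0 < Im ((tau + 1) / 2))%R).
  { unfold Cdiv. rewrite <- RtoC_inv by lra. rewrite im_scal_r, im_plus, im_RtoC. lra. }
  rewrite !phi_pp.
  rewrite (pp_double (tau / 2)), (pp_double ((tau + 1) / 2)) by auto.
  replace (2 * (tau / 2)) with tau by cfield.
  replace (2 * ((tau + 1) / 2)) with (tau + IZR 1) by cfield.
  rewrite !pp_tau_shift.
  replace (tau / 2 + / 2 + tau / 2) with (tau + / 2) by cfield.
  replace ((tau + 1) / 2 + / 2) with (tau / 2 + IZR 1) by cfield.
  replace (tau / 2 + IZR 1 + (tau + 1) / 2) with (tau + / 2 + IZR 1) by cfield.
  rewrite !pp_shift.
  transitivity (pp tau (tau + / 2) * pp tau (tau + / 2) *
    ((pp tau (tau / 2) * pp tau (tau / 2 + / 2)) * pp (2 * tau) (2 * tau + / 2))); [ring | ].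
  rewrite pp_half by auto. replace (2 * (tau / 2) + / 2) with (tau + / 2) by cfield.
  pose proof (pp_double tau (tau + / 2) Htau) as E.
  replace (tau + / 2 + tau) with (2 * tau + / 2) in E by ring.
  rewrite <- E. ring.
Qed.

End JTP.

(** Sorting the factors of Euler's product by the residue of n modulo 3 gives the three products of
    [jtp] at 3 tau. *)
Lemma phi_pentagonal tau : (0 < Im tau)%R -> phi tau = th (3 * tau) (/ 2 - tau / 2).
Proof.
  intros H. assert (H3 := Im_scal_pos tau 3 ltac:(lra) H).
  rewrite jtp, !phi_pp by auto. rewrite (pp_triple tau) by auto.
  replace (/ 2 - tau / 2 + 3 * tau / 2) with (tau + / 2) by cfield.
  replace (- (/ 2 - tau / 2) + 3 * tau / 2) with (tau + / 2 + tau + IZR (-1)) by cfield.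
  rewrite pp_shift.
  replace (3 * tau + / 2) with (tau + / 2 + 2 * tau) by ring.
  ring.
Qed.

Lemma th_continuous (t z : nat -> C) (tau w : C) : (0 < Im tau)%R ->
  cvg t tau -> cvg z w -> cvg (fun n => th (t n) (z n)) (th tau w).
Proof.
  intros H Ht Hz.
  destruct (Ht (Im tau / 2)%R ltac:(lra)) as [N1 HN1].
  destruct (Hz 1%R ltac:(lra)) as [N2 HN2].
  (* [tannery] asks for a majorant from index 0 on, so the sequences are shifted by N, beyond which
     Im (t n) exceeds Im tau / 2 and z n is within 1 of w. *)
  set (N := max N1 N2). intros eps He.
  assert (K : cvg (fun n => th (t (n + N)%nat) (z (n + N)%nat)) (th tau w)).
  { unfold th. apply tannery with (fun k : Z => exp (- (PI * (Im tau / 2)) * (IZR k * IZR k)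
      + 2 * PI * (Rabs (Im w) + 1) * Rabs (IZR k) + 0)).
    - apply summR_gauss. pose proof PI_RGT_0. nra.
    - intros n k. specialize (HN1 (n + N)%nat ltac:(lia)). specialize (HN2 (n + N)%nat ltac:(lia)).
      eapply Rle_trans; [apply (quad_dom _ _ _ (Rabs (Im w) + 1)) | ].
      + pose proof (im_le_Cmod (z (n + N)%nat - w)) as B.
        pose proof (Rabs_triang (Im w) (Im (z (n + N)%nat - w))) as T.
        replace (Im w + Im (z (n + N)%nat - w))%R with (Im (z (n + N)%nat)) in T
          by (unfold Im, Cminus, Cplus, Copp; simpl; ring). lra.
      + apply exp_le. pose proof (im_le_Cmod (t (n + N)%nat - tau)) as B.
        apply Rle_lt_trans with (2 := HN1) in B. apply Rabs_def2 in B.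
        unfold Im, Cminus, Cplus, Copp in B. simpl in B. fold (Im tau) in *.
        unfold Im in *. pose proof PI_RGT_0.
        assert (0 <= IZR k * IZR k)%R by nra.
        assert (PI * (snd tau / 2) <= PI * snd (t (n + N)%nat))%R by nra. nra.
    - intros k. apply cvg_e. apply cvg_plus.
      + unfold Cdiv. apply cvg_mult; [ | apply cvg_const]. apply cvg_mult; [ | apply cvg_const].
        apply (cvg_subseq t _ (fun n => n + N)%nat); [intros; lia | exact Ht].
      + apply cvg_scal. apply (cvg_subseq z _ (fun n => n + N)%nat); [intros; lia | exact Hz]. }
  destruct (K eps He) as [M HM]. exists (M + N)%nat. intros n Hn.
  specialize (HM (n - N)%nat ltac:(lia)). replace (n - N + N)%nat with n in HM by lia. exact HM.
Qed.

(** * Theta inversion *)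

Ltac rpos := repeat match goal with |- (0 <= _ * _)%R => apply Rmult_le_pos end.

Lemma lsum_tsum {A B} (F : A -> B -> C) (l : list A) : (forall a, summ (F a)) ->
  summ (fun b => lsum (fun a => F a b) l) /\
  lsum (fun a => tsum (F a)) l = tsum (fun b => lsum (fun a => F a b) l).
Proof.
  intros H. induction l as [|a l [IH1 IH2]]; simpl.
  - split.
    + apply summ_dom with (fun _ => 0%R); [intros; rewrite Cmod_0; apply Rle_refl | ].
      exists 0%R. intros l _. induction l as [|b l IH]; simpl in *; lra.
    + symmetry. apply has_sum_tsum. intros eps He. exists nil. split; [constructor | ].
      intros l _ _. replace (lsum (fun _ : B => RtoC 0) l - 0) with (RtoC 0).
      * now rewrite Cmod_0.
      * induction l as [|b l IH]; simpl; [ring | ]. rewrite IH at 1. ring.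
  - split; [now apply summ_plus | ]. rewrite IH2, tsum_plus; auto.
Qed.

Lemma tsum_finite {A} (f : A -> C) (l : list A) : NoDup l ->
  (forall a, ~ In a l -> f a = 0) -> tsum f = lsum f l.
Proof.
  intros Hl H0. apply has_sum_tsum. intros eps He. exists l. split; auto.
  intros m Hm Hi. destruct (incl_perm l m Hl Hm Hi) as [k Hk].
  rewrite (lsum_perm f _ _ Hk), lsum_app.
  assert (E : lsum f k = 0).
  { assert (Hn : forall a, In a k -> ~ In a l).
    { apply (Permutation_NoDup Hk) in Hm. clear - Hm.
      induction l as [|b l IH]; simpl in *; [tauto | ]. inversion Hm; subst.
      intros a Ha [->|Hl]; [apply H1, in_or_app; auto | now apply (IH H2 a)]. }
    clear Hk. induction k as [|b k IH]; simpl; [reflexivity | ].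
    rewrite IH by (intros a Ha; apply Hn; right; exact Ha).
    rewrite H0 by (apply Hn; left; reflexivity). ring. }
  rewrite E. replace (lsum f l + 0 - lsum f l) with (RtoC 0) by ring. now rewrite Cmod_0.
Qed.

(** A Riemann sum of exp(-|x|) without its factor eps, hence of order 1 / eps. Second-order Taylor
    remainders of size eps^2 thus add up to order eps. *)
Lemma grid_bnd (eps : R) : (0 < eps <= 1)%R ->
  bndR (fun l : Z => exp (- Rabs (eps * IZR l))) (4 / eps).
Proof.
  intros He l Hl.
  apply Rle_trans with (2 / (1 - exp (- eps)))%R.
  - apply (bndR_le _ (fun n : Z => exp (- (eps * Rabs (IZR n))))); auto.
    + intros n. rewrite Rabs_mult, (Rabs_pos_eq eps) by lra. apply Rle_refl.
    + apply bndR_exp_abs. lra.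
  - assert (H : (exp (- eps) <= 1 - eps / 2)%R).
    { rewrite exp_Ropp. pose proof (exp_ineq1_le eps).
      apply Rle_trans with (/ (1 + eps))%R; [apply Rinv_le_contravar; lra | ].
      apply Rmult_le_reg_r with (1 + eps)%R; [lra | ]. rewrite Rinv_l by lra. nra. }
    replace (4 / eps)%R with (2 * / (eps / 2))%R by (field; lra).
    unfold Rdiv at 1. apply Rmult_le_compat_l; [lra | ]. apply Rinv_le_contravar; lra.
Qed.

(** * Gaussian sums on a grid of mesh eps *)

Section Gauss.
Variable c : C.
Hypothesis Hc : (0 < Im c)%R.

Definition G (u : C) : C := e (c * (u * u)).

Lemma im_mult_abs (a b : C) : (Rabs (Im (a * b)) <= Cmod a * Cmod b)%R.
Proof. rewrite <- Cmod_mult. apply im_le_Cmod. Qed.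

Lemma G_mod (Rd : R) (u : C) (x : R) : (Cmod u <= Rd)%R ->
  (Cmod (G (u + x)) <= exp (- (2 * PI * Im c) * (x * x) + 4 * PI * Cmod c * Rd * Rabs x
                            + 2 * PI * Cmod c * (Rd * Rd)))%R.
Proof.
  intros Hu. unfold G. rewrite Cmod_e. apply exp_le.
  replace (c * ((u + x) * (u + x))) with (c * RtoC (x * x) + (RtoC (2 * x) * (c * u) + c * (u * u)))
    by (rewrite !RtoC_mult; ring).
  rewrite !im_plus, im_scal_r, im_scal_l.
  pose proof (im_mult_abs c u) as H1. pose proof (im_mult_abs c (u * u)) as H2.
  rewrite Cmod_mult in H2. pose proof (Cmod_ge_0 c) as Pc. pose proof (Cmod_ge_0 u) as Pu.
  pose proof PI_RGT_0 as Pp.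
  assert (B2 : (- Im (c * (u * u)) <= Cmod c * (Rd * Rd))%R).
  { pose proof (Rle_abs (- Im (c * (u * u)))) as T. rewrite Rabs_Ropp in T.
    assert (Cmod c * (Cmod u * Cmod u) <= Cmod c * (Rd * Rd))%R; [ | lra].
    apply Rmult_le_compat_l; auto. apply Rmult_le_compat; auto. }
  assert (B1 : (- (x * Im (c * u)) <= Cmod c * Rd * Rabs x)%R).
  { pose proof (Rle_abs (- (x * Im (c * u)))) as T. rewrite Rabs_Ropp, Rabs_mult in T.
    assert (Rabs x * Rabs (Im (c * u)) <= Rabs x * (Cmod c * Rd))%R; [ | lra].
    apply Rmult_le_compat_l; [apply Rabs_pos | ]. apply Rle_trans with (1 := H1).
    apply Rmult_le_compat_l; auto. }
  assert (B2' := Rmult_le_compat_l (2 * PI) _ _ ltac:(lra) B2).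
  assert (B1' := Rmult_le_compat_l (4 * PI) _ _ ltac:(lra) B1).
  lra.
Qed.

Lemma gauss_exp_bound (a b d : R) : (0 < a)%R -> exists K, (0 <= K)%R /\
  forall x, (exp (- a * (x * x) + b * Rabs x + d) <= K * exp (- Rabs x))%R.
Proof.
  intros Ha. exists (exp ((b + 1) ^ 2 / (4 * a) + d)). split; [left; apply exp_pos | ].
  intros x. rewrite <- exp_plus. apply exp_le. pose proof (gauss_le a b x Ha). lra.
Qed.

Lemma G_bound (Rd : R) : exists K, (0 <= K)%R /\ forall u (x : R), (Cmod u <= Rd)%R ->
  (Cmod (G (u + x)) <= K * exp (- Rabs x))%R.
Proof.
  pose proof PI_RGT_0.
  destruct (gauss_exp_bound (2 * PI * Im c) (4 * PI * Cmod c * Rd)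
    (2 * PI * Cmod c * (Rd * Rd)) ltac:(apply Rmult_lt_0_compat; lra)) as [K [HK HK']].
  exists K. split; auto. intros u x Hu. eapply Rle_trans; [now apply (G_mod Rd) | apply HK'].
Qed.

(** The derivative of [G] at v. *)
Definition G1 (v : C) : C := 2 * PI * Ci * (c * (2 * v)) * G v.

Lemma G_taylor (Rd : R) : exists K, (0 <= K)%R /\
  forall u h (x eps : R), (Cmod u <= Rd)%R -> (Cmod h <= Rd)%R -> (0 < eps <= 1)%R ->
  (Cmod (G (u + x + eps * h) - G (u + x) - eps * h * G1 (u + x))
    <= K * (eps * eps) * exp (- Rabs x))%R.
Proof.
  pose proof PI_RGT_0 as Pp. pose proof (Cmod_ge_0 c) as Pc.
  set (L := (2 * PI * Cmod c * Rd * (3 * Rd + 2))%R).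
  (* The increment w of the exponent is at most eps L (1 + |x|). The extra L absorbs exp |w|, and
     the extra 2 absorbs the factor (1 + |x|)^2 of the remainder, which is at most exp(2 (1 +
     |x|)). *)
  destruct (gauss_exp_bound (2 * PI * Im c) (4 * PI * Cmod c * Rd + (L + 2))
    (2 * PI * Cmod c * (Rd * Rd) + (L + 2)) ltac:(apply Rmult_lt_0_compat; lra)) as [K [HK HK']].
  exists (K * (3 * (L * L) + 2 * PI * Cmod c * (Rd * Rd)))%R. split.
  { apply Rmult_le_pos; auto. assert (0 <= L * L)%R by apply Rle_0_sqr.
    assert (0 <= PI * Cmod c * (Rd * Rd))%R
      by (apply Rmult_le_pos; [apply Rmult_le_pos; lra | apply Rle_0_sqr]). lra. }
  intros u h x eps Hu Hh He.
  assert (HR : (0 <= Rd)%R) by (apply Rle_trans with (2 := Hu); apply Cmod_ge_0).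
  assert (HL : (0 <= L)%R) by (unfold L; rpos; lra).
  set (v := u + x). set (eta := eps * h).
  set (w := 2 * PI * Ci * (c * (2 * v * eta + eta * eta))).
  assert (E1 : G (v + eta) = G v * Cexp w).
  { unfold G, e, w. rewrite <- Cexp_plus. f_equal. ring. }
  replace (G (v + eta) - G v - eta * G1 v)
    with (G v * ((Cexp w - 1 - w) + 2 * PI * Ci * (c * (eta * eta)))).
  2: { rewrite E1. unfold G1, w. ring. }
  rewrite Cmod_mult.
  assert (Heta : (Cmod eta <= eps * Rd)%R).
  { unfold eta. rewrite Cmod_mult, Cmod_R, Rabs_pos_eq by lra. apply Rmult_le_compat_l; lra. }
  pose proof (Cmod_ge_0 eta) as Peta. pose proof (Rabs_pos x) as Px.
  assert (Hv : (Cmod v <= Rd + Rabs x)%R).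
  { unfold v. eapply Rle_trans; [apply Cmod_triangle | ]. rewrite Cmod_R. lra. }
  assert (H2p : Cmod (2 * PI * Ci) = (2 * PI)%R).
  { rewrite !Cmod_mult, Cmod_Ci, !Cmod_R, !Rabs_right by lra. ring. }
  assert (Hw : (Cmod w <= eps * (L * (1 + Rabs x)))%R).
  { unfold w. rewrite Cmod_mult, H2p, Cmod_mult.
    replace (2 * v * eta + eta * eta) with (eta * (2 * v + eta)) by ring. rewrite Cmod_mult.
    assert (B : (Cmod (2 * v + eta) <= (3 * Rd + 2) * (1 + Rabs x))%R).
    { eapply Rle_trans; [apply Cmod_triangle | ]. rewrite Cmod_mult, Cmod_R, Rabs_right by lra.
      assert (eps * Rd <= 1 * Rd)%R by (apply Rmult_le_compat_r; lra). nra. }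
    replace (eps * (L * (1 + Rabs x)))%R
      with (2 * PI * (Cmod c * ((eps * Rd) * ((3 * Rd + 2) * (1 + Rabs x)))))%R by (unfold L; ring).
    apply Rmult_le_compat_l; [lra | ]. apply Rmult_le_compat_l; [lra | ].
    apply Rmult_le_compat; auto using Cmod_ge_0. }
  set (y := (L * (1 + Rabs x))%R) in *.
  assert (Hy : (0 <= y)%R) by (unfold y; apply Rmult_le_pos; lra).
  pose proof (Cexp_taylor w) as T. pose proof (Cmod_ge_0 w) as Pw.
  assert (Hw1 : (Cmod w <= y)%R) by nra.
  assert (HX : (1 <= exp (y + 2 * (1 + Rabs x)))%R) by (apply one_le_exp; lra).
  assert (T1 : (3 * (Cmod w * Cmod w) * exp (Cmod w)
    <= 3 * (L * L) * (eps * eps) * exp (y + 2 * (1 + Rabs x)))%R).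
  { apply Rle_trans with (3 * ((eps * y) * (eps * y)) * exp y)%R.
    - apply Rmult_le_compat; [nra | left; apply exp_pos | | now apply exp_le].
      apply Rmult_le_compat_l; [lra | ]. apply Rmult_le_compat; auto.
    - rewrite exp_plus. unfold y at 1 2.
      replace (3 * (eps * (L * (1 + Rabs x)) * (eps * (L * (1 + Rabs x)))) * exp y)%R
        with (3 * (L * L) * (eps * eps) * (exp y * ((1 + Rabs x) * (1 + Rabs x))))%R by ring.
      apply Rmult_le_compat_l; [nra | ]. apply Rmult_le_compat_l; [left; apply exp_pos | ].
      replace (2 * (1 + Rabs x))%R with ((1 + Rabs x) + (1 + Rabs x))%R by ring.
      rewrite exp_plus. pose proof (exp_ineq1_le (1 + Rabs x)).
      apply Rmult_le_compat; lra. }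
  assert (T2 : (Cmod (2 * PI * Ci * (c * (eta * eta))) <=
    2 * PI * Cmod c * (Rd * Rd) * (eps * eps) * exp (y + 2 * (1 + Rabs x)))%R).
  { rewrite Cmod_mult, H2p, !Cmod_mult.
    apply Rle_trans with (2 * PI * Cmod c * (Rd * Rd) * (eps * eps) * 1)%R.
    - assert (Cmod eta * Cmod eta <= (eps * Rd) * (eps * Rd))%R
        by (apply Rmult_le_compat; auto).
      replace (2 * PI * Cmod c * (Rd * Rd) * (eps * eps) * 1)%R
        with (2 * PI * (Cmod c * ((eps * Rd) * (eps * Rd))))%R by ring.
      apply Rmult_le_compat_l; [lra | ]. apply Rmult_le_compat_l; lra.
    - apply Rmult_le_compat_l; auto. rpos; lra. }
  pose proof (Cmod_triangle (Cexp w - 1 - w) (2 * PI * Ci * (c * (eta * eta)))) as TT.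
  set (X := exp (y + 2 * (1 + Rabs x))) in *.
  set (D := (3 * (L * L) + 2 * PI * Cmod c * (Rd * Rd))%R).
  assert (HD : (0 <= D)%R).
  { unfold D. assert (0 <= PI * Cmod c * (Rd * Rd))%R by (rpos; lra). nra. }
  apply Rle_trans with (Cmod (G v) * (D * (eps * eps) * X))%R.
  { apply Rmult_le_compat_l; [apply Cmod_ge_0 | ]. unfold D. lra. }
  assert (HG : (Cmod (G v) * X <= K * exp (- Rabs x))%R).
  { apply Rle_trans with (2 := HK' x).
    eapply Rle_trans; [apply Rmult_le_compat_r; [left; apply exp_pos | now apply (G_mod Rd)] | ].
    unfold X. rewrite <- exp_plus. apply exp_le. unfold y. lra. }
  replace (Cmod (G v) * (D * (eps * eps) * X))%R with (D * (eps * eps) * (Cmod (G v) * X))%R by ring.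
  replace (K * D * (eps * eps) * exp (- Rabs x))%R
    with (D * (eps * eps) * (K * exp (- Rabs x)))%R by ring.
  apply Rmult_le_compat_l; auto. apply Rmult_le_pos; nra.
Qed.

Definition grid (eps : R) (u : C) (l : Z) : C := u + RtoC (eps * IZR l).

Lemma summ_grid eps u : (0 < eps <= 1)%R -> summ (fun l => G (grid eps u l)).
Proof.
  intros He. destruct (G_bound (Cmod u)) as [K [HK H]].
  apply summ_dom with (fun l : Z => K * exp (- Rabs (eps * IZR l)))%R.
  - intros l. apply H. apply Rle_refl.
  - apply summR_scal; auto. eexists. now apply grid_bnd.
Qed.

Lemma grid_succ eps u l : grid eps u (l + 1) = grid eps u l + eps * 1.
Proof. unfold grid. zpush. ring. Qed.

(** The first order terms of [G (v + eps h) - G v] and of [h (G (v + eps) - G v)]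
    agree, and the latter differences telescope along the grid. *)
Lemma grid_sum_step (Rd : R) : (1 <= Rd)%R -> exists K, (0 <= K)%R /\
  forall u h (eps : R), (Cmod u <= Rd)%R -> (Cmod h <= Rd)%R -> (0 < eps <= 1)%R ->
  (Cmod (tsum (fun l => G (grid eps (u + eps * h) l)) - tsum (fun l => G (grid eps u l)))
    <= K * eps)%R.
Proof.
  intros HR1. destruct (G_taylor Rd) as [K [HK H]].
  exists ((1 + Rd) * K * 4)%R. split; [nra | ]. intros u h eps Hu Hh He.
  pose proof (summ_grid eps u He) as S0. pose proof (summ_grid eps (u + eps * h) He) as S1.
  assert (S2 : summ (fun l => G (grid eps u (l + 1)))).
  { apply (summ_shift (fun l => G (grid eps u l))). exact S0. }
  replace (tsum (fun l => G (grid eps (u + eps * h) l)) - tsum (fun l => G (grid eps u l)))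
    with (tsum (fun l => (G (grid eps (u + eps * h) l) - G (grid eps u l))
                         - h * (G (grid eps u (l + 1)) - G (grid eps u l)))).
  2: { rewrite tsum_minus, tsum_scal, !tsum_minus; auto using summ_scal, summ_minus.
       rewrite <- (tsum_shift (fun l => G (grid eps u l)) 1 S0). ring. }
  replace ((1 + Rd) * K * 4 * eps)%R with ((1 + Rd) * K * (eps * eps) * (4 / eps))%R by (field; lra).
  apply tsum_bound with (fun l : Z => (1 + Rd) * K * (eps * eps) * exp (- Rabs (eps * IZR l)))%R.
  - intros l. rewrite grid_succ.
    replace (grid eps (u + eps * h) l) with (grid eps u l + eps * h) by (unfold grid; ring).
    pose proof (H u h (eps * IZR l)%R eps Hu Hh He) as B1.
    pose proof (H u 1 (eps * IZR l)%R eps Hu ltac:(rewrite Cmod_1; lra) He) as B2.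
    fold (grid eps u l) in B1, B2. set (v := grid eps u l) in *.
    replace (G (v + eps * h) - G v - h * (G (v + eps * 1) - G v))
      with ((G (v + eps * h) - G v - eps * h * G1 v)
            - h * (G (v + eps * 1) - G v - eps * 1 * G1 v)) by ring.
    eapply Rle_trans; [apply Cmod_minus_le | ]. rewrite Cmod_mult.
    set (T := (K * (eps * eps) * exp (- Rabs (eps * IZR l)))%R) in *.
    assert (Cmod h * Cmod (G (v + eps * 1) - G v - eps * 1 * G1 v) <= Rd * T)%R
      by (apply Rmult_le_compat; auto using Cmod_ge_0).
    replace ((1 + Rd) * K * (eps * eps) * exp (- Rabs (eps * IZR l)))%R with (T + Rd * T)%R
      by (unfold T; ring). lra.
  - apply bndR_scal; [ | now apply grid_bnd]. rpos; lra.
Qed.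

(** The discrete form of moving the contour of a Gaussian integral by h. Each of N steps h / N costs
    at most K / N, so the two sums, themselves of order N, differ by a bounded amount and agree
    after division by N in the limit. *)
Lemma grid_sum_move (h : C) : exists K, (0 <= K)%R /\ forall N : nat, (1 <= N)%nat ->
  (Cmod (tsum (fun l => G (grid (/ INR N) h l)) - tsum (fun l => G (grid (/ INR N) 0 l))) <= K)%R.
Proof.
  set (Rd := (Cmod h + 1)%R). pose proof (Cmod_ge_0 h) as Ph.
  destruct (grid_sum_step Rd) as [K [HK H]]; [unfold Rd; lra | ].
  exists K. split; auto. intros N HN.
  assert (PN : (1 <= INR N)%R) by (apply (le_INR 1); exact HN).
  set (eps := (/ INR N)%R).
  assert (He : (0 < eps <= 1)%R).
  { unfold eps. split; [apply Rinv_0_lt_compat; lra | ].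
    rewrite <- Rinv_1. apply Rinv_le_contravar; lra. }
  assert (I : forall j : nat, (j <= N)%nat ->
    (Cmod (tsum (fun l => G (grid eps (RtoC (INR j * eps) * h) l)) - tsum (fun l => G (grid eps 0 l)))
      <= INR j * (K * eps))%R).
  { induction j as [|j IH]; intros Hj.
    - simpl. replace (RtoC (0 * eps) * h) with (RtoC 0) by (rewrite Rmult_0_l; ring).
      unfold Cminus. rewrite Cplus_opp_r, Cmod_0. lra.
    - specialize (IH ltac:(lia)). rewrite S_INR, (Rmult_plus_distr_r _ 1 (K * eps)).
      eapply Rle_trans; [apply (Cmod_minus_triangle _
        (tsum (fun l => G (grid eps (RtoC (INR j * eps) * h) l)))) | ].
      assert (B : (Cmod (tsum (fun l => G (grid eps (RtoC ((INR j + 1) * eps) * h) l)) -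
                   tsum (fun l => G (grid eps (RtoC (INR j * eps) * h) l))) <= K * eps)%R).
      { replace (RtoC ((INR j + 1) * eps) * h) with (RtoC (INR j * eps) * h + eps * h).
        2: { rewrite !RtoC_mult, RtoC_plus. ring. }
        apply H; auto; [ | unfold Rd; lra].
        assert (Hje : (0 <= INR j * eps <= 1)%R).
        { pose proof (pos_INR j). pose proof (le_INR _ _ Hj) as T. rewrite S_INR in T.
          split; [apply Rmult_le_pos; lra | ]. unfold eps.
          apply Rmult_le_reg_r with (INR N); [lra | ]. rewrite Rmult_assoc, Rinv_l; lra. }
        rewrite Cmod_mult, Cmod_R, Rabs_pos_eq by tauto. unfold Rd.
        assert (INR j * eps * Cmod h <= 1 * Cmod h)%R by (apply Rmult_le_compat_r; lra). lra. }
      lra. }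
  specialize (I N (le_n _)). unfold eps in I at 1. rewrite Rinv_r, Cmult_1_l in I by lra.
  replace K with (INR N * (K * eps))%R by (unfold eps; field; lra). exact I.
Qed.

Lemma summ_twist eps u t : (0 < eps <= 1)%R ->
  summ (fun l => G (grid eps u l) * e (- RtoC (IZR l * t))).
Proof.
  intros He. apply summ_dom with (2 := summ_grid eps u He). intros l.
  rewrite Cmod_mult, Cmod_e, im_opp, im_RtoC. rewrite Ropp_0, Rmult_0_r, Ropp_0, exp_0. lra.
Qed.

Lemma sin_lower (t : R) : (Rabs t <= 1 / 2)%R -> (t * t <= 4 * (sin (PI * t) * sin (PI * t)))%R.
Proof.
  assert (P : forall t, (0 <= t <= 1 / 2)%R -> (t * t <= 4 * (sin (PI * t) * sin (PI * t)))%R).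
  { clear. intros t Ht. pose proof PI2_3_2 as P2. pose proof PI_RGT_0 as Pp.
    (* Halving the angle keeps y below pi / 4. There both the cosine from the double-angle formula
       and the one from the mean value theorem are at least 1 / sqrt 2. *)
    set (y := (PI * t / 2)%R).
    assert (Hy : (0 <= y <= PI / 4)%R) by (unfold y; nra).
    assert (C : forall x, (0 <= x <= PI / 4)%R -> (1 / sqrt 2 <= cos x)%R).
    { intros x Hx. rewrite <- cos_PI4. apply cos_decr_1; lra. }
    destruct (MVT_gen sin 0 y cos) as [d [Hd Hm]].
    - intros; apply is_derive_Reals, derivable_pt_lim_sin.
    - intros; apply continuity_sin.
    - rewrite sin_0, !Rminus_0_r in Hm. rewrite Rmin_left, Rmax_right in Hd by lra.
      pose proof (C d ltac:(lra)) as C1. pose proof (C y Hy) as C2.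
      assert (Hs : (0 < 1 / sqrt 2)%R).
      { apply Rdiv_lt_0_compat; [lra | apply sqrt_lt_R0; lra]. }
      assert (Hq : (1 / sqrt 2 * (1 / sqrt 2) = 1 / 2)%R).
      { pose proof (sqrt_sqrt 2 ltac:(lra)). assert (sqrt 2 <> 0)%R by (intros E; rewrite E in *; lra).
        replace (1 / 2)%R with (1 / (sqrt 2 * sqrt 2))%R by (rewrite H; reflexivity). field. auto. }
      replace (PI * t)%R with (2 * y)%R by (unfold y; field).
      rewrite sin_2a, Hm.
      set (s := (1 / sqrt 2)%R) in *.
      assert (K1 : (s * s <= cos d * cos y)%R) by (apply Rmult_le_compat; lra).
      assert (K2 : (t / 2 <= y)%R) by (unfold y; nra).
      assert (K3 : (y <= 2 * (cos d * y) * cos y)%R) by nra.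
      assert (K4 : (t / 2 * (t / 2) <= (2 * (cos d * y) * cos y) * (2 * (cos d * y) * cos y))%R)
        by (apply Rmult_le_compat; lra).
      lra. }
  intros H. destruct (Rle_lt_dec 0 t) as [Ht|Ht].
  - rewrite Rabs_pos_eq in H by lra. apply P. lra.
  - rewrite Rabs_left in H by lra. specialize (P (- t)%R ltac:(lra)).
    replace (PI * - t)%R with (- (PI * t))%R in P by ring. rewrite sin_neg in P. lra.
Qed.

(** The expression is -4 sin(pi t)^2, the factor by which a second difference acts on frequency
    t. *)
Lemma twist_factor (t : R) : (Rabs t <= 1 / 2)%R ->
  (t * t <= Cmod (e t + e (- RtoC t) - 2))%R.
Proof.
  intros H. rewrite <- RtoC_opp, !e_real.
  replace (2 * PI * - t)%R with (- (2 * PI * t))%R by ring. rewrite cos_neg, sin_neg.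
  replace (2 * PI * t)%R with (2 * (PI * t))%R by ring. rewrite cos_2a_sin.
  pose proof (sin_lower t H) as S. set (s := sin (PI * t)) in *.
  eapply Rle_trans; [ | apply re_le_Cmod].
  unfold Re, Cminus, Cplus, Copp, RtoC. simpl.
  rewrite Rabs_left1; nra.
Qed.

(** Summation by parts twice gives quadratic decay in the frequency. *)
Lemma twist_decay (u : C) : exists K, (0 <= K)%R /\
  forall (eps t : R), (0 < eps <= 1)%R -> (Rabs t <= 1 / 2)%R ->
  (t * t * Cmod (tsum (fun l => G (grid eps u l) * e (- RtoC (IZR l * t)))%C) <= K * eps)%R.
Proof.
  set (Rd := (Cmod u + 1)%R). pose proof (Cmod_ge_0 u) as Pu.
  destruct (G_taylor Rd) as [K [HK H]]. exists (2 * K * 4)%R. split; [lra | ].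
  intros eps t He Ht.
  set (F := fun l => G (grid eps u l) * e (- RtoC (IZR l * t))).
  assert (SF : summ F) by exact (summ_twist eps u t He).
  pose proof (summ_shift F 1 SF) as S1. pose proof (summ_shift F (-1) SF) as S2.
  assert (E : tsum (fun l => (G (grid eps u l + eps * 1) + G (grid eps u l + eps * -1)
      - 2 * G (grid eps u l)) * e (- RtoC (IZR l * t))) = (e t + e (- RtoC t) - 2) * tsum F).
  { rewrite (tsum_ext _ (fun l => (e t * F (l + 1)%Z + e (- RtoC t) * F (l + -1)%Z) - 2 * F l)).
    - rewrite tsum_minus, tsum_plus, !tsum_scal; auto using summ_scal, summ_plus.
      rewrite <- (tsum_shift F 1 SF), <- (tsum_shift F (-1) SF). ring.
    - intros l. unfold F.
      replace (grid eps u (l + 1)) with (grid eps u l + eps * 1) by (unfold grid; zpush; ring).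
      replace (grid eps u (l + -1)) with (grid eps u l + eps * -1) by (unfold grid; zpush; ring).
      replace (e (- RtoC (IZR (l + 1) * t))) with (e (- RtoC (IZR l * t)) * e (- RtoC t)).
      2: { rewrite <- e_plus. f_equal. zpush. ring. }
      replace (e (- RtoC (IZR (l + -1) * t))) with (e (- RtoC (IZR l * t)) * e t).
      2: { rewrite <- e_plus. f_equal. zpush. ring. }
      rewrite (e_opp t). field. apply e_neq0. }
  apply Rle_trans with (Cmod ((e t + e (- RtoC t) - 2) * tsum F)).
  { rewrite Cmod_mult. apply Rmult_le_compat_r; [apply Cmod_ge_0 | now apply twist_factor]. }
  rewrite <- E.
  replace (2 * K * 4 * eps)%R with (2 * K * (eps * eps) * (4 / eps))%R by (field; lra).
  apply tsum_bound with (fun l : Z => 2 * K * (eps * eps) * exp (- Rabs (eps * IZR l)))%R.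
  - intros l. rewrite Cmod_mult, Cmod_e, im_opp, im_RtoC, Ropp_0, Rmult_0_r, Ropp_0, exp_0, Rmult_1_r.
    pose proof (H u 1 (eps * IZR l)%R eps ltac:(unfold Rd; lra)
      ltac:(rewrite Cmod_1; unfold Rd; lra) He) as B1.
    pose proof (H u (-1) (eps * IZR l)%R eps ltac:(unfold Rd; lra)
      ltac:(rewrite Cmod_R, Rabs_left by lra; unfold Rd; lra) He) as B2.
    fold (grid eps u l) in B1, B2. set (v := grid eps u l) in *.
    replace (G (v + eps * 1) + G (v + eps * -1) - 2 * G v)
      with ((G (v + eps * 1) - G v - eps * 1 * G1 v) + (G (v + eps * -1) - G v - eps * -1 * G1 v))
      by ring.
    eapply Rle_trans; [apply Cmod_triangle | ]. lra.
  - apply bndR_scal; [ | now apply grid_bnd]. rpos; lra.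
Qed.

(** Orthogonality of the N-th roots of unity. N is odd and the frequencies k - M run from -M to M,
    so that (k - M) / N stays within 1/2 in absolute value, as [twist_decay] requires. *)
Lemma root_sum (M : nat) (l : Z) (N := (2 * M + 1)%nat) :
  lsum (fun k : nat => e (- RtoC (IZR l * (IZR (Z.of_nat k - Z.of_nat M) * / INR N)))) (seq 0 N)
  = if Z.eq_dec (l mod Z.of_nat N) 0 then RtoC (INR N) else 0.
Proof.
  assert (PN : (INR N <> 0)%R) by (apply not_0_INR; unfold N; lia).
  assert (PN' : RtoC (INR N) <> 0) by (intros E; apply RtoC_inj in E; auto).
  set (om := e (- RtoC (IZR l * / INR N))).
  assert (E0 : forall k : nat, e (- RtoC (IZR l * (IZR (Z.of_nat k - Z.of_nat M) * / INR N)))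
    = e (RtoC (IZR l * INR M * / INR N)) * om ^ k).
  { intros k. unfold om. rewrite <- e_pow, <- e_plus. f_equal.
    rewrite minus_IZR, <- !INR_IZR_INZ. rewrite !RtoC_mult, RtoC_minus. ring. }
  rewrite (lsum_ext _ (fun k => e (RtoC (IZR l * INR M * / INR N)) * om ^ k)) by (intros; apply E0).
  rewrite lsum_scal.
  assert (G0 : forall n, (1 - om) * lsum (fun k => om ^ k) (seq 0 n) = 1 - om ^ n).
  { induction n as [|n IH]; [simpl; ring | ]. rewrite lsum_seq_S, Cmult_plus_distr_l, IH.
    rewrite Cpow_S. ring. }
  destruct (Z.eq_dec (l mod Z.of_nat N) 0) as [Hd|Hd].
  - apply Z_div_exact_full_2 in Hd; [ | unfold N; lia].
    set (j := (l / Z.of_nat N)%Z) in *.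
    assert (Hl : (IZR l = INR N * IZR j)%R) by (rewrite Hd, mult_IZR, <- INR_IZR_INZ; reflexivity).
    assert (Eom : om = 1).
    { unfold om. rewrite Hl. rewrite <- (e_Z (- j)). f_equal. rewrite opp_IZR, RtoC_opp.
      f_equal. f_equal. field. exact PN. }
    rewrite Eom.
    replace (e (RtoC (IZR l * INR M * / INR N))) with (RtoC 1).
    + rewrite Cmult_1_l. clear. induction N as [|n IH]; [reflexivity | ].
      rewrite lsum_seq_S, IH, Cpow_1_l, S_INR, RtoC_plus. reflexivity.
    + rewrite <- (e_Z (j * Z.of_nat M)). f_equal. f_equal.
      rewrite Hl, mult_IZR, <- INR_IZR_INZ. field. exact PN.
  - assert (Eom : om <> 1).
    { intros E. destruct (e_eq1 _ E) as [n Hn]. apply Hd.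
      rewrite <- RtoC_opp in Hn. apply RtoC_inj in Hn.
      assert (Hl : l = (Z.of_nat N * (- n))%Z).
      { apply eq_IZR. rewrite mult_IZR, opp_IZR, <- Hn, <- INR_IZR_INZ. field. exact PN. }
      rewrite Hl, Z.mul_comm. apply Z_mod_mult. }
    assert (EN : om ^ N = 1).
    { unfold om. rewrite <- e_pow, <- (e_Z (- l)). f_equal.
      rewrite opp_IZR, RtoC_opp, RtoC_mult, RtoC_inv by exact PN. field. exact PN'. }
    assert (Z0 : lsum (fun k => om ^ k) (seq 0 N) = 0).
    { assert (H1 : 1 - om <> 0).
      { intros E. apply Eom. replace om with (1 - (1 - om)) by ring. rewrite E. ring. }
      specialize (G0 N). rewrite EN in G0.
      transitivity ((1 - om) * lsum (fun k => om ^ k) (seq 0 N) / (1 - om)); [field; exact H1 | ].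
      rewrite G0. field. exact H1. }
    transitivity (e (RtoC (IZR l * INR M * / INR N)) * 0); [f_equal; exact Z0 | ring].
Qed.

(** An exact finite Poisson summation: averaging over all N frequencies keeps only the grid points z
    + l / N with N dividing l, which are the integer translates of z. *)
Lemma fourier_window (z : C) (M : nat) (N := (2 * M + 1)%nat) :
  lsum (fun k : nat => / INR N * tsum (fun l =>
      G (grid (/ INR N) z l) * e (- RtoC (IZR l * (IZR (Z.of_nat k - Z.of_nat M) * / INR N)))))
    (seq 0 N) = tsum (fun n : Z => G (z + IZR n)).
Proof.
  assert (P1 : (1 <= INR N)%R) by (apply (le_INR 1); unfold N; lia).
  assert (He : (0 < / INR N <= 1)%R).
  { split; [apply Rinv_0_lt_compat; lra | ]. rewrite <- Rinv_1. apply Rinv_le_contravar; lra. }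
  assert (PN' : RtoC (INR N) <> 0) by (intros E; apply RtoC_inj in E; lra).
  set (F := fun (k : nat) l => G (grid (/ INR N) z l)
              * e (- RtoC (IZR l * (IZR (Z.of_nat k - Z.of_nat M) * / INR N)))).
  assert (SF : forall k, summ (F k)) by (intros k; exact (summ_twist (/ INR N) z _ He)).
  destruct (lsum_tsum F (seq 0 N) SF) as [SL EL].
  transitivity (/ INR N * lsum (fun k => tsum (F k)) (seq 0 N)).
  { rewrite <- lsum_scal. reflexivity. }
  rewrite EL. clear EL.
  rewrite (tsum_ext _ (fun l => G (grid (/ INR N) z l) *
     (if Z.eq_dec (l mod Z.of_nat N) 0 then RtoC (INR N) else 0))).
  2: { intros l. unfold F. rewrite lsum_scal. f_equal. apply root_sum. }
  assert (SL' : summ (fun l => G (grid (/ INR N) z l) *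
     (if Z.eq_dec (l mod Z.of_nat N) 0 then RtoC (INR N) else 0))).
  { apply summ_ext with (2 := SL). intros l. unfold F. rewrite lsum_scal. f_equal. apply root_sum. }
  rewrite (tsum_supp _ (fun n => Z.of_nat N * n)%Z); auto.
  - rewrite <- tsum_scal.
    2: { apply (summ_inj _ (fun n => Z.of_nat N * n)%Z) in SL'; auto. unfold N; intros; nia. }
    apply tsum_ext. intros n.
    destruct (Z.eq_dec ((Z.of_nat N * n) mod Z.of_nat N) 0) as [_|E].
    + replace (grid (/ INR N) z (Z.of_nat N * n)) with (z + IZR n).
      * field. exact PN'.
      * unfold grid. f_equal. f_equal. rewrite mult_IZR, <- INR_IZR_INZ. field. lra.
    + exfalso. apply E. rewrite Z.mul_comm. apply Z_mod_mult.
  - unfold N; intros; nia.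
  - intros l Hl. destruct (Z.eq_dec (l mod Z.of_nat N) 0) as [E|_]; [ | ring].
    exfalso. apply (Hl (l / Z.of_nat N)%Z). symmetry. apply Z_div_exact_full_2; auto. unfold N; lia.
Qed.

End Gauss.

Lemma summR_inv_sq : summR (fun m : Z => / (1 + IZR m * IZR m))%R.
Proof.
  assert (Hp : forall m : Z, (0 < 1 + IZR m * IZR m)%R) by (intros; nra).
  exists 8%R. apply bndR_Z; [intros; left; now apply Rinv_0_lt_compat | ].
  assert (P : forall M, (lsumR (fun n => / (1 + INR n * INR n))%R (seq 0 M) <= 4 - 4 / (INR M + 1))%R).
  { induction M as [|M IH]; [simpl; lra | ].
    rewrite lsumR_seq_S, S_INR. pose proof (pos_INR M) as HM. set (x := INR M) in *.
    assert (/ (1 + x * x) <= 4 / (x + 1) - 4 / (x + 1 + 1))%R; [ | lra].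
    replace (4 / (x + 1) - 4 / (x + 1 + 1))%R with (/ ((x + 1) * (x + 2) / 4))%R by (field; lra).
    apply Rinv_le_contravar; [ | pose proof (pow2_ge_0 (x - 1)); nra]. nra. }
  intros M.
  assert (E1 : (lsumR (fun n => / (1 + IZR (Z.of_nat n) * IZR (Z.of_nat n))) (seq 0 M) <= 4)%R).
  { apply Rle_trans with (lsumR (fun n => / (1 + INR n * INR n))%R (seq 0 M)).
    - apply lsumR_le. intros n. rewrite <- INR_IZR_INZ. apply Rle_refl.
    - specialize (P M). pose proof (pos_INR M).
      assert (0 < 4 / (INR M + 1))%R by (apply Rdiv_lt_0_compat; lra). lra. }
  assert (E2 : (lsumR (fun n => / (1 + IZR (- Z.of_nat (S n)) * IZR (- Z.of_nat (S n)))) (seq 0 M) <= 4)%R).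
  { apply Rle_trans with (lsumR (fun n => / (1 + INR n * INR n))%R (seq 0 M)).
    - apply lsumR_le. intros n. rewrite opp_IZR, <- INR_IZR_INZ, S_INR. pose proof (pos_INR n).
      apply Rinv_le_contravar; nra.
    - specialize (P M). pose proof (pos_INR M).
      assert (0 < 4 / (INR M + 1))%R by (apply Rdiv_lt_0_compat; lra). lra. }
  lra.
Qed.

Lemma tsum_window (M : nat) (f : Z -> C) :
  tsum (fun m : Z => if Z_le_dec (Z.abs m) (Z.of_nat M) then f m else 0) =
  lsum (fun k : nat => f (Z.of_nat k - Z.of_nat M)%Z) (seq 0 (2 * M + 1)).
Proof.
  rewrite (tsum_finite _ (map (fun k => Z.of_nat k - Z.of_nat M)%Z (seq 0 (2 * M + 1)))).
  - rewrite lsum_map. apply lsum_ext. intros k Hk. apply in_seq in Hk.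
    destruct (Z_le_dec _ _); [reflexivity | lia].
  - apply FinFun.Injective_map_NoDup; [intros a b; lia | apply seq_NoDup].
  - intros m Hm. destruct (Z_le_dec _ _) as [H|]; [ | reflexivity].
    exfalso. apply Hm. apply in_map_iff. exists (Z.to_nat (m + Z.of_nat M)).
    split; [lia | ]. apply in_seq. lia.
Qed.

(** * Theta inversion as the mesh tends to zero *)

Section Inversion.
Variable tau : C.
Hypothesis Htau : (0 < Im tau)%R.

Lemma tau_neq0 : tau <> 0.
Proof. intros E. rewrite E, im_RtoC in Htau. lra. Qed.

(** With this constant [G] is e(-u^2 / (2 tau)), whose integer translates add up to the inverted
    theta function. *)
Definition gc : C := - / (2 * tau).

Lemma im_inv_neg : (0 < Im (- / tau))%R.
Proof.
  pose proof tau_neq0 as H0. destruct tau as [a b]. unfold Im in *. simpl in *.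
  assert (0 < a * (a * 1) + b * (b * 1))%R by nra.
  replace (- (- b / (a * (a * 1) + b * (b * 1))))%R with (b / (a * (a * 1) + b * (b * 1)))%R
    by (field; lra).
  now apply Rdiv_lt_0_compat.
Qed.

Lemma gc_pos : (0 < Im gc)%R.
Proof.
  unfold gc. replace (- / (2 * tau)) with (- / tau * RtoC (/ 2)).
  - rewrite im_scal_r. pose proof im_inv_neg. lra.
  - rewrite RtoC_inv by lra. field. apply tau_neq0.
Qed.

Notation Gt := (G gc).

Definition per (z : C) : C := tsum (fun n : Z => Gt (z + IZR n)).

Lemma summ_per z : summ (fun n : Z => Gt (z + IZR n)).
Proof.
  apply summ_ext with (2 := summ_grid gc gc_pos 1 z ltac:(lra)).
  intros n. unfold grid. now rewrite Rmult_1_l.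
Qed.

(** Completing the square trades the frequency m for a translation by m tau and produces the theta
    coefficient q^(m^2/2). *)
Lemma G_twist (u : C) (m : Z) :
  Gt u * e (- (IZR m * u)) = e (tau * (IZR m * IZR m) / 2) * Gt (u + IZR m * tau).
Proof.
  unfold G, gc. rewrite <- !e_plus. f_equal. field. apply tau_neq0.
Qed.

(** The numbers a M are Riemann sums of the Gaussian integral. What is kept about them is that they
    are bounded and given by an expression free of z. *)
Lemma inversion_lim (z : C) : exists a : nat -> C,
  (exists B, forall M, (Cmod (a M) <= B)%R) /\
  (forall M, a M = / INR (2 * M + 1) * tsum (fun l => Gt (grid (/ INR (2 * M + 1)) 0 l))) /\
  cvg (fun M => per z - a M * th tau z) 0.
Proof.
  set (a := fun M => / INR (2 * M + 1) * tsum (fun l => Gt (grid (/ INR (2 * M + 1)) 0 l))).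
  assert (PN : forall M, (1 <= INR (2 * M + 1))%R) by (intros M; apply (le_INR 1); lia).
  assert (PN' : forall M, RtoC (INR (2 * M + 1)) <> 0)
    by (intros M E; apply RtoC_inj in E; specialize (PN M); lra).
  assert (PE : forall M, (0 < / INR (2 * M + 1) <= 1)%R).
  { intros M. specialize (PN M). split; [apply Rinv_0_lt_compat; lra | ].
    rewrite <- Rinv_1. apply Rinv_le_contravar; lra. }
  assert (PM : forall M, Cmod (/ INR (2 * M + 1)) = (/ INR (2 * M + 1))%R).
  { intros M. rewrite Cmod_inv by auto. rewrite Cmod_R, Rabs_pos_eq; auto.
    specialize (PN M); lra. }
  (* A bound for normalized grid sums uniform in M. It is stated for any dominated F so that it
     covers the twisted sums as well as a M. *)
  assert (BG : exists B, (0 <= B)%R /\ forall M u, (Cmod u <= Cmod z)%R -> forall F,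
    (forall l, Cmod (F l) <= Cmod (Gt (grid (/ INR (2 * M + 1)) u l)))%R ->
    (Cmod (/ INR (2 * M + 1) * tsum F) <= B)%R).
  { destruct (G_bound gc gc_pos (Cmod z)) as [K [HK H]]. exists (K * 4)%R.
    split; [lra | ]. intros M u Hu F HF. specialize (PE M). specialize (PN M).
    rewrite Cmod_mult, PM. set (eps := (/ INR (2 * M + 1))%R) in *.
    replace (K * 4)%R with (eps * (K * (4 / eps)))%R by (field; lra).
    apply Rmult_le_compat_l; [lra | ].
    apply tsum_bound with (fun l : Z => K * exp (- Rabs (eps * IZR l)))%R.
    - intros l. apply Rle_trans with (1 := HF l). apply H. exact Hu.
    - apply bndR_scal; auto. now apply grid_bnd. }
  destruct BG as [B [HB BG]].
  exists a. split; [ | split; [reflexivity | ]].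
  { exists B. intros M. apply BG with (RtoC 0); [rewrite Cmod_0; apply Cmod_ge_0 | ].
    intros; apply Rle_refl. }
  set (E := fun m : Z => e (tau * (IZR m * IZR m) / 2 + IZR m * z)).
  set (t := fun (M : nat) (m : Z) => / INR (2 * M + 1) * tsum (fun l =>
     Gt (grid (/ INR (2 * M + 1)) z l) * e (- RtoC (IZR l * (IZR m * / INR (2 * M + 1)))))).
  (* The m-th Fourier coefficient is the theta term E m times an untwisted sum based at z + m tau,
     which [grid_sum_move] can compare with a M. *)
  assert (Et : forall M m, t M m = E m * (/ INR (2 * M + 1) *
     tsum (fun l => Gt (grid (/ INR (2 * M + 1)) (z + IZR m * tau) l)))).
  { intros M m. unfold t.
    transitivity (/ INR (2 * M + 1) * (E m *
      tsum (fun l => Gt (grid (/ INR (2 * M + 1)) (z + IZR m * tau) l)))); [ | ring].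
    f_equal. rewrite <- tsum_scal by exact (summ_grid gc gc_pos _ _ (PE M)).
    apply tsum_ext. intros l.
    set (u := grid (/ INR (2 * M + 1)) z l).
    replace (e (- RtoC (IZR l * (IZR m * / INR (2 * M + 1)))))
      with (e (- (IZR m * u)) * e (IZR m * z)).
    2: { rewrite <- e_plus. f_equal. unfold u, grid. rewrite !RtoC_mult. ring. }
    rewrite Cmult_assoc, G_twist. unfold E. rewrite e_plus.
    replace (grid (/ INR (2 * M + 1)) (z + IZR m * tau) l) with (u + IZR m * tau)
      by (unfold u, grid; ring). ring. }
  assert (Ew : forall M, per z = tsum (fun m : Z =>
      if Z_le_dec (Z.abs m) (Z.of_nat M) then t M m else 0)).
  { intros M. rewrite tsum_window. unfold per, t. symmetry.
    apply (fourier_window gc gc_pos z M). }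
  (* A majorant summable in m and uniform in M: the quadratic decay of [twist_decay] for nonzero m,
     the trivial bound B at m = 0. *)
  assert (Bt : exists K, (0 <= K)%R /\ forall M m, (Z.abs m <= Z.of_nat M)%Z ->
      (Cmod (t M m) <= K * / (1 + IZR m * IZR m))%R).
  { destruct (twist_decay gc gc_pos z) as [K [HK H]]. exists (2 * K + B)%R. split; [lra | ].
    intros M m Hm. specialize (PE M). specialize (PN M).
    assert (Bz : (Cmod (t M m) <= B)%R).
    { apply BG with z; [apply Rle_refl | ]. intros l. rewrite Cmod_mult, Cmod_e.
      rewrite im_opp, im_RtoC, Ropp_0, Rmult_0_r, Ropp_0, exp_0, Rmult_1_r. apply Rle_refl. }
    destruct (Z.eq_dec m 0) as [->|Hm0].
    - replace (1 + 0 * 0)%R with 1%R by ring. rewrite Rinv_1. lra.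
    - assert (Hm1 : (1 <= IZR m * IZR m)%R).
      { rewrite <- mult_IZR. apply IZR_le. nia. }
      set (eps := (/ INR (2 * M + 1))%R) in *.
      assert (Ht : (Rabs (IZR m * eps) <= 1 / 2)%R).
      { rewrite Rabs_mult, (Rabs_pos_eq eps), <- abs_IZR by lra.
        apply IZR_le in Hm. rewrite <- INR_IZR_INZ in Hm. unfold eps.
        apply Rmult_le_reg_r with (INR (2 * M + 1)); [lra | ].
        rewrite Rmult_assoc, Rinv_l by lra. rewrite plus_INR, mult_INR. simpl. lra. }
      specialize (H eps (IZR m * eps)%R PE Ht).
      set (S := tsum (fun l => Gt (grid eps z l) * e (- RtoC (IZR l * (IZR m * eps))))) in *.
      assert (H2 : (IZR m * IZR m * (eps * Cmod S) <= K)%R).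
      { apply Rmult_le_reg_l with eps; [lra | ].
        replace (eps * (IZR m * IZR m * (eps * Cmod S)))%R
          with (IZR m * eps * (IZR m * eps) * Cmod S)%R by ring. lra. }
      assert (Em : Cmod (t M m) = (eps * Cmod S)%R).
      { unfold t. fold eps. fold S. rewrite Cmod_mult, PM. reflexivity. }
      rewrite Em. apply Rmult_le_reg_r with (1 + IZR m * IZR m)%R; [lra | ].
      replace ((2 * K + B) * / (1 + IZR m * IZR m) * (1 + IZR m * IZR m))%R
        with (2 * K + B)%R by (field; lra).
      assert (0 <= eps * Cmod S)%R by (apply Rmult_le_pos; [lra | apply Cmod_ge_0]).
      nra. }
  destruct Bt as [K [HK Bt]].
  set (W := fun M => tsum (fun m : Z => if Z_le_dec (Z.abs m) (Z.of_nat M) then E m else 0)).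
  assert (SE : summ E) by exact (summ_th tau z Htau).
  assert (CW : cvg W (th tau z)).
  { unfold W, th. apply tannery with (fun m => Cmod (E m)); auto.
    - intros n m. destruct (Z_le_dec _ _); [apply Rle_refl | ]. rewrite Cmod_0. apply Cmod_ge_0.
    - intros m. apply cvg_eventually with (fun _ => E m) (Z.abs_nat m); [ | apply cvg_const].
      intros n Hn. destruct (Z_le_dec _ _); [reflexivity | lia]. }
  assert (Sw : forall M (f : Z -> C), summ (fun m : Z =>
      if Z_le_dec (Z.abs m) (Z.of_nat M) then f m else 0)).
  { intros M f. exists (lsumR (fun k : nat => Cmod (f (Z.of_nat k - Z.of_nat M)%Z)) (seq 0 (2 * M + 1))).
    intros l Hl.
    set (L := map (fun k => Z.of_nat k - Z.of_nat M)%Z (seq 0 (2 * M + 1))).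
    assert (NL : NoDup L).
    { apply FinFun.Injective_map_NoDup; [intros x y; lia | apply seq_NoDup]. }
    apply Rle_trans with (lsumR (fun m => Cmod (f m)) (filter (fun m => if Z_le_dec (Z.abs m) (Z.of_nat M) then true else false) l)).
    - clear. induction l as [|m l IH]; simpl; [lra | ].
      destruct (Z_le_dec _ _); simpl; [lra | rewrite Cmod_0; lra].
    - rewrite <- (lsumR_map (fun m => Cmod (f m)) (fun k => Z.of_nat k - Z.of_nat M)%Z).
      apply lsumR_incl; auto using NoDup_filter.
      + intros; apply Cmod_ge_0.
      + intros m Hm. apply filter_In in Hm. destruct Hm as [_ Hm].
        destruct (Z_le_dec _ _); [ | discriminate].
        apply in_map_iff. exists (Z.to_nat (m + Z.of_nat M)). split; [lia | ]. apply in_seq. lia. }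
  (* Within the window |m| <= M the difference has terms t M m - a M * E m. Each is of order 1 / (2M
     + 1) for fixed m, and the majorant allows termwise passage to the limit. *)
  assert (CF : cvg (fun M => per z - a M * W M) 0).
  { set (F := fun (M : nat) (m : Z) =>
      if Z_le_dec (Z.abs m) (Z.of_nat M) then t M m - a M * E m else 0).
    assert (EF : forall M, tsum (F M) = per z - a M * W M).
    { intros M. rewrite (Ew M). unfold W. rewrite <- tsum_scal by apply Sw.
      rewrite <- tsum_minus; [ | apply Sw | apply summ_scal, Sw].
      apply tsum_ext. intros m. unfold F. destruct (Z_le_dec _ _); ring. }
    apply cvg_ext with (1 := EF).
    replace (RtoC 0) with (tsum (fun _ : Z => RtoC 0)).
    2: { rewrite (tsum_single (fun _ : Z => RtoC 0) 0%Z); auto. }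
    apply tannery with (fun m : Z => K * / (1 + IZR m * IZR m) + B * Cmod (E m))%R.
    - apply summR_plus; apply summR_scal; auto. apply summR_inv_sq.
    - intros M m. unfold F. destruct (Z_le_dec _ _) as [Hm|].
      + eapply Rle_trans; [apply Cmod_minus_le | ]. rewrite Cmod_mult.
        apply Rplus_le_compat; [auto | ]. apply Rmult_le_compat_r; [apply Cmod_ge_0 | ].
        apply BG with (RtoC 0); [rewrite Cmod_0; apply Cmod_ge_0 | intros; apply Rle_refl].
      + rewrite Cmod_0. assert (0 < / (1 + IZR m * IZR m))%R by (apply Rinv_0_lt_compat; nra).
        pose proof (Cmod_ge_0 (E m)). nra.
    - intros m. destruct (grid_sum_move gc gc_pos (z + IZR m * tau)) as [Km [HKm Hmove]].
      apply cvg_squeeze with (fun M => Cmod (E m) * Km * / INR (2 * M + 1))%R.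
      + intros M. specialize (PE M).
        assert (P0 : (0 <= Cmod (E m) * Km * / INR (2 * M + 1))%R).
        { apply Rmult_le_pos; [ | lra]. apply Rmult_le_pos; auto. apply Cmod_ge_0. }
        unfold F. destruct (Z_le_dec _ _) as [Hm|].
        * rewrite Et. unfold a. cbv beta.
          set (s := tsum (fun l : Z => Gt (grid (/ INR (2 * M + 1)) (z + IZR m * tau) l))).
          set (s' := tsum (fun l : Z => Gt (grid (/ INR (2 * M + 1)) 0 l))).
          replace (E m * (/ INR (2 * M + 1) * s) - / INR (2 * M + 1) * s' * E m - 0)
            with (E m * (/ INR (2 * M + 1) * (s - s'))) by ring.
          rewrite !Cmod_mult, PM. rewrite Rmult_assoc.
          apply Rmult_le_compat_l; [apply Cmod_ge_0 | ]. rewrite Rmult_comm.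
          apply Rmult_le_compat_r; [lra | ]. apply Hmove. lia.
        * replace (0 - 0) with (RtoC 0) by ring. rewrite Cmod_0. exact P0.
      + replace (Finite 0) with (Rbar_mult (Cmod (E m) * Km)%R (Finite 0))
          by (simpl; f_equal; ring).
        apply is_lim_seq_scal_l.
        apply (is_lim_seq_subseq (fun n => / INR n)%R 0 (fun M => 2 * M + 1)%nat).
        * apply eventually_subseq. intros; lia.
        * replace (Finite 0) with (Rbar_inv p_infty) by reflexivity.
          apply is_lim_seq_inv; [apply is_lim_seq_INR | discriminate]. }
  apply cvg_ext with (fun M => (per z - a M * W M) + a M * (W M - th tau z)); [intros; ring | ].
  replace (RtoC 0) with (0 + 0) by ring. apply cvg_plus; [exact CF | ].
  intros eps Heps. destruct (CW (eps / (B + 1))%R) as [N HN].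
  { apply Rdiv_lt_0_compat; lra. }
  exists N. intros n Hn. specialize (HN n Hn).
  replace (a n * (W n - th tau z) - 0) with (a n * (W n - th tau z)) by ring.
  rewrite Cmod_mult.
  assert (Ba : (Cmod (a n) <= B)%R).
  { apply BG with (RtoC 0); [rewrite Cmod_0; apply Cmod_ge_0 | intros; apply Rle_refl]. }
  apply Rlt_div_r in HN; [ | lra].
  pose proof (Cmod_ge_0 (W n - th tau z)).
  assert (Cmod (a n) * Cmod (W n - th tau z) <= B * Cmod (W n - th tau z))%R
    by (apply Rmult_le_compat_r; auto).
  lra.
Qed.

(** The sequence a M is the same for z and for 0, so cross-multiplying the two limits eliminates
    it. *)
Lemma per_prop (z : C) : per z * th tau 0 = per 0 * th tau z.
Proof.
  destruct (inversion_lim z) as [a [_ [Ha Hz]]].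
  destruct (inversion_lim 0) as [a' [_ [Ha' H0]]].
  assert (H0' : cvg (fun M => per 0 - a M * th tau 0) 0).
  { apply cvg_ext with (2 := H0). intros M. now rewrite Ha, Ha'. }
  pose proof (cvg_scal (th tau 0) _ _ Hz) as K1. pose proof (cvg_scal (th tau z) _ _ H0') as K2.
  pose proof (cvg_minus _ _ _ _ K1 K2) as K3.
  assert (K4 : cvg (fun _ => per z * th tau 0 - per 0 * th tau z) (th tau 0 * 0 - th tau z * 0)).
  { apply cvg_ext with (2 := K3). intros; ring. }
  pose proof (cvg_unique _ _ _ K4 (cvg_const _)) as K5.
  replace (per z * th tau 0) with ((per z * th tau 0 - per 0 * th tau z) + per 0 * th tau z) by ring.
  rewrite <- K5. ring.
Qed.

Lemma th_per (z : C) : th (- / tau) (z / tau) = e (z * z / (2 * tau)) * per z.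
Proof.
  unfold per. rewrite (tsum_neg _ (summ_per z)).
  rewrite <- tsum_scal.
  2: { apply (summ_inj (fun n : Z => Gt (z + IZR n)) Z.opp); [intros; lia | apply summ_per]. }
  apply tsum_ext. intros n. unfold G, gc. rewrite <- e_plus. f_equal.
  zpush. field. apply tau_neq0.
Qed.

End Inversion.

(** Classically the square root of -i tau. As a quotient of theta constants it needs no choice of
    branch. *)
Definition th_mult (tau : C) : C := th (- / tau) 0 / th tau 0.

Lemma one_plus_e_0 (w : C) : 1 + e w = 0 -> exists n : Z, w = IZR n - / 2.
Proof.
  intros H. assert (E : e (w + / 2) = 1).
  { rewrite e_plus, e_half. transitivity (1 - (1 + e w)); [ring | ]. rewrite H. ring. }
  destruct (e_eq1 _ E) as [n Hn]. exists n. rewrite <- Hn. ring.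
Qed.

Lemma one_plus_e_neq0_im (tau : C) (x r : R) : (0 < Im tau)%R -> r <> 0%R ->
  1 + e (x + r * tau) <> 0.
Proof.
  intros H Hr K. destruct (one_plus_e_0 _ K) as [n Hn]. apply (f_equal Im) in Hn.
  rewrite im_affine, im_RtoC in Hn. rewrite <- RtoC_inv, <- RtoC_minus, im_RtoC in Hn by lra.
  assert (H0 : (r * Im tau = 0)%R) by lra.
  destruct (Rmult_integral _ _ H0); lra.
Qed.

Lemma th_neq0_off (tau : C) (x r : R) : (0 < Im tau)%R ->
  (forall n : Z, (r + / 2 + IZR n)%R <> 0%R) -> th tau (x + r * tau) <> 0.
Proof.
  intros H Hr. apply th_neq0; auto. intros n.
  replace (x + r * tau + tau / 2 + IZR n * tau) with (x + RtoC (r + / 2 + IZR n) * tau).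
  - now apply one_plus_e_neq0_im.
  - rewrite !RtoC_plus, RtoC_inv by lra. field.
Qed.

Lemma half_int_neq0 (n : Z) : (/ 2 + IZR n)%R <> 0%R.
Proof.
  intros E. assert (H : (IZR (2 * n + 1) = 0)%R) by (rewrite plus_IZR, mult_IZR; lra).
  apply eq_IZR in H. lia.
Qed.

Lemma th00_neq0 tau (x : R) : (0 < Im tau)%R -> th tau x <> 0.
Proof.
  intros H. replace (RtoC x) with (RtoC x + RtoC 0 * tau) by ring. apply th_neq0_off; auto.
  intros n. rewrite Rplus_0_l. apply half_int_neq0.
Qed.

Lemma th_inversion (tau z : C) : (0 < Im tau)%R ->
  th (- / tau) (z / tau) = th_mult tau * e (z * z / (2 * tau)) * th tau z.
Proof.
  intros H. pose proof (th00_neq0 tau 0 H) as N0. pose proof (tau_neq0 tau H) as T0.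
  unfold th_mult.
  assert (E0 : th (- / tau) 0 = per tau 0).
  { pose proof (th_per tau H 0) as E. replace (0 / tau) with (RtoC 0) in E by (field; auto).
    rewrite E. replace (0 * 0 / (2 * tau)) with (RtoC 0) by (field; auto). rewrite e_0. ring. }
  rewrite th_per, E0 by auto.
  transitivity (e (z * z / (2 * tau)) * (per tau z * th tau 0) / th tau 0); [field; auto | ].
  rewrite per_prop by auto. field. auto.
Qed.

Lemma th_mult_neq0 tau : (0 < Im tau)%R -> th_mult tau <> 0.
Proof.
  intros H. unfold th_mult. apply Cmult_neq_0.
  - apply th00_neq0. now apply im_inv_neg.
  - intros E. pose proof (th00_neq0 tau 0 H) as N.
    assert (K : th tau 0 * / th tau 0 = 1) by (field; auto).
    rewrite E, Cmult_0_r in K. apply RtoC_inj in K. lra.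
Qed.

(** * Scaling of the multiplier and inversion of eta *)

Lemma tsum_mod (f : Z -> C) (M : nat) (N := (2 * M + 1)%nat) : summ f ->
  tsum f = lsum (fun k : nat => tsum (fun j : Z =>
    f (Z.of_nat N * j + (Z.of_nat k - Z.of_nat M))%Z)) (seq 0 N).
Proof.
  intros H.
  set (g := fun (k : nat) (n : Z) =>
    if Z.eq_dec ((n + Z.of_nat M) mod Z.of_nat N) (Z.of_nat k) then f n else 0).
  assert (Sg : forall k, summ (g k)).
  { intros k. apply summ_dom with (2 := H). intros n. unfold g.
    destruct (Z.eq_dec _ _); [apply Rle_refl | ]. rewrite Cmod_0. apply Cmod_ge_0. }
  destruct (lsum_tsum g (seq 0 N) Sg) as [_ E].
  rewrite (tsum_ext f (fun n => lsum (fun k => g k n) (seq 0 N))).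
  - rewrite <- E. apply lsum_ext. intros k Hk. apply in_seq in Hk.
    rewrite (tsum_supp (g k) (fun j => Z.of_nat N * j + (Z.of_nat k - Z.of_nat M))%Z); auto.
    + apply tsum_ext. intros j. unfold g. destruct (Z.eq_dec _ _) as [|n]; [reflexivity | ].
      exfalso. apply n.
      replace (Z.of_nat N * j + (Z.of_nat k - Z.of_nat M) + Z.of_nat M)%Z
        with (Z.of_nat k + j * Z.of_nat N)%Z by ring.
      rewrite Z_mod_plus_full. apply Z.mod_small. lia.
    + intros a a' Ha. unfold N in *. nia.
    + intros b Hb. unfold g. destruct (Z.eq_dec _ _) as [e0|]; [ | reflexivity].
      exfalso. apply (Hb ((b + Z.of_nat M) / Z.of_nat N)%Z).
      pose proof (Z_div_mod_eq_full (b + Z.of_nat M) (Z.of_nat N)). lia.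
  - intros n. set (r := Z.to_nat ((n + Z.of_nat M) mod Z.of_nat N)).
    pose proof (Z.mod_pos_bound (n + Z.of_nat M) (Z.of_nat N) ltac:(unfold N; lia)) as Hr.
    assert (Hin : In r (seq 0 N)) by (apply in_seq; unfold r; lia).
    destruct (in_split _ _ Hin) as [l1 [l2 E2]].
    assert (Z0 : forall l, ~ In r l -> lsum (fun k => g k n) l = 0).
    { induction l as [|k l IH]; simpl; intros Hl; [reflexivity | ].
      rewrite IH by tauto. unfold g. destruct (Z.eq_dec _ _) as [e0|]; [ | ring].
      exfalso. apply Hl. left. unfold r. lia. }
    pose proof (seq_NoDup N 0) as ND. rewrite E2 in ND |- *.
    apply NoDup_remove_2 in ND. rewrite lsum_app. simpl.
    rewrite !Z0 by (intros K; apply ND, in_or_app; tauto).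
    unfold g. destruct (Z.eq_dec _ _) as [|n0]; [ring | ]. exfalso. apply n0. unfold r. lia.
Qed.

(** Sorting the terms of th(-1 / (N^2 tau), 0) by residues r modulo N gives values of th at -1 /
    tau. Each is inverted to th(tau, -r / N), and summing these over r keeps the indices divisible
    by N, that is N th(N^2 tau, 0). *)
Lemma th_mult_sq (tau : C) (M : nat) (N := (2 * M + 1)%nat) : (0 < Im tau)%R ->
  th_mult (RtoC (INR N * INR N) * tau) = INR N * th_mult tau.
Proof.
  intros H.
  assert (PN : (0 < INR N)%R) by (apply lt_0_INR; unfold N; lia).
  assert (PN' : RtoC (INR N) <> 0) by (intros E; apply RtoC_inj in E; lra).
  pose proof (tau_neq0 tau H) as T0.
  set (t2 := RtoC (INR N * INR N) * tau).
  assert (H2 : (0 < Im t2)%R) by (apply Im_scal_pos; auto; nra).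
  pose proof (th00_neq0 t2 0 H2) as N0.
  assert (H' : (0 < Im (- / t2))%R) by now apply im_inv_neg.
  assert (E1 : th (- / t2) 0 =
    lsum (fun k : nat => th_mult tau * th tau (- (IZR (Z.of_nat k - Z.of_nat M) * / INR N)%R)) (seq 0 N)).
  { unfold th at 1. rewrite (tsum_mod _ M (summ_th _ _ H')). fold N. apply lsum_ext. intros k _.
    set (r := (Z.of_nat k - Z.of_nat M)%Z).
    pose proof (th_inversion tau (- (IZR r * / INR N)%R) H) as Hi.
    replace (th_mult tau * th tau (- (IZR r * / INR N)%R))
      with (e (- ((IZR r * / INR N)%R * (IZR r * / INR N)%R / (2 * tau))) *
            th (- / tau) (- (IZR r * / INR N)%R / tau)).
    2: { rewrite Hi. rewrite e_opp.
         replace (- (IZR r * / INR N)%R * - (IZR r * / INR N)%R)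
           with ((IZR r * / INR N)%R * (IZR r * / INR N)%R) by ring.
         field. apply e_neq0. }
    unfold th. rewrite <- tsum_scal by now apply summ_th, im_inv_neg.
    apply tsum_ext. intros j. rewrite <- e_plus. f_equal.
    zpush. rewrite <- INR_IZR_INZ. unfold t2. rewrite ?RtoC_mult, RtoC_inv by lra.
    field. auto. }
  unfold th_mult at 1. rewrite E1, lsum_scal.
  assert (E2 : lsum (fun k : nat => th tau (- (IZR (Z.of_nat k - Z.of_nat M) * / INR N)%R)) (seq 0 N)
    = INR N * th t2 0).
  { unfold th.
    destruct (lsum_tsum (fun (k : nat) (n : Z) => e (tau * (IZR n * IZR n) / 2
       + IZR n * - (IZR (Z.of_nat k - Z.of_nat M) * / INR N)%R)) (seq 0 N)
       (fun k => summ_th _ _ H)) as [SL ->].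
    assert (Ex : forall l : Z, lsum (fun k : nat => e (tau * (IZR l * IZR l) / 2
       + IZR l * - (IZR (Z.of_nat k - Z.of_nat M) * / INR N)%R)) (seq 0 N)
       = e (tau * (IZR l * IZR l) / 2) *
         (if Z.eq_dec (l mod Z.of_nat N) 0 then RtoC (INR N) else 0)).
    { intros l. unfold N at 3 4. rewrite <- root_sum. fold N. rewrite <- lsum_scal.
      apply lsum_ext. intros k _. rewrite <- e_plus. f_equal. rewrite !RtoC_mult. ring. }
    rewrite (tsum_ext _ _ Ex).
    rewrite <- tsum_scal by now apply summ_th.
    rewrite (tsum_supp _ (fun n => Z.of_nat N * n)%Z).
    - apply tsum_ext. intros n.
      destruct (Z.eq_dec ((Z.of_nat N * n) mod Z.of_nat N) 0) as [_|E].
      + rewrite Cmult_comm. f_equal. f_equal. zpush. rewrite <- INR_IZR_INZ. unfold t2.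
        rewrite RtoC_mult. field.
      + exfalso. apply E. rewrite Z.mul_comm. apply Z_mod_mult.
    - unfold N; intros; nia.
    - intros l Hl. destruct (Z.eq_dec (l mod Z.of_nat N) 0) as [E|_]; [ | ring].
      exfalso. apply (Hl (l / Z.of_nat N)%Z). symmetry. apply Z_div_exact_full_2; auto. unfold N; lia.
    - apply summ_ext with (1 := Ex). exact SL. }
  rewrite E2. field. exact N0.
Qed.

Lemma th_mult_continuous (t : nat -> C) tau : (0 < Im tau)%R -> cvg t tau ->
  cvg (fun n => th_mult (t n)) (th_mult tau).
Proof.
  intros H Ht. unfold th_mult. apply cvg_div.
  - now apply th00_neq0.
  - apply th_continuous; [now apply im_inv_neg | | apply cvg_const].
    apply cvg_opp, cvg_inv; auto. now apply tau_neq0.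
  - apply th_continuous; auto. apply cvg_const.
Qed.

(** On squares of quotients of odd numbers this is a Gaussian-sum identity; those
    squares are dense. *)
Lemma th_mult_scal (r : R) (tau : C) : (0 < r)%R -> (0 < Im tau)%R ->
  th_mult (r * tau) = sqrt r * th_mult tau.
Proof.
  intros Hr H. set (x := sqrt r). assert (Hx : (0 < x)%R) by now apply sqrt_lt_R0.
  assert (Hxn : forall n : nat, (0 <= x * INR n)%R).
  { intros n. apply Rmult_le_pos; [lra | apply pos_INR]. }
  (* Rounding x n down to f n makes s n = (2 f n + 1) / (2n + 1) a quotient of odd integers that
     tends to x = sqrt r. *)
  set (f := fun n => proj1_sig (nfloor_ex (x * INR n) (Hxn n))).
  set (s := fun n => (INR (2 * f n + 1) / INR (2 * n + 1))%R).
  assert (Q : forall n : nat, (1 <= INR (2 * n + 1))%R) by (intros n; apply (le_INR 1); lia).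
  assert (Hs : forall n, (Rabs (s n - x) <= (1 + x) * / INR (2 * n + 1))%R).
  { intros n. unfold s, f. destruct (nfloor_ex (x * INR n) (Hxn n)) as [k Hk]. simpl proj1_sig.
    specialize (Q n).
    replace (INR (2 * k + 1) / INR (2 * n + 1) - x)%R
      with ((INR (2 * k + 1) - x * INR (2 * n + 1)) * / INR (2 * n + 1))%R by (field; lra).
    rewrite Rabs_mult, (Rabs_pos_eq (/ _)) by (left; apply Rinv_0_lt_compat; lra).
    apply Rmult_le_compat_r; [left; apply Rinv_0_lt_compat; lra | ].
    rewrite !plus_INR, !mult_INR. simpl (INR 2). simpl (INR 1). apply Rabs_le. lra. }
  assert (Ls : cvg (fun n => RtoC (s n)) x).
  { apply cvg_squeeze with (fun n => (1 + x) * / INR (2 * n + 1))%R.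
    - intros n. rewrite <- RtoC_minus, Cmod_R. apply Hs.
    - replace (Finite 0) with (Rbar_mult (1 + x)%R (Finite 0)) by (simpl; f_equal; ring).
      apply is_lim_seq_scal_l.
      apply (is_lim_seq_subseq (fun n => / INR n)%R 0 (fun n => 2 * n + 1)%nat).
      + apply eventually_subseq. intros; lia.
      + replace (Finite 0) with (Rbar_inv p_infty) by reflexivity.
        apply is_lim_seq_inv; [apply is_lim_seq_INR | discriminate]. }
  assert (E : forall n, th_mult (s n * s n * tau) = s n * th_mult tau).
  { intros n. pose proof (Q n) as Qn. pose proof (Q (f n)) as Qf.
    set (p := INR (2 * f n + 1)) in *. set (q := INR (2 * n + 1)) in *.
    (* Both tau and s^2 tau are odd squares, q^2 and p^2, times this common point, so [th_mult_sq]
       applies to each. *)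
    set (t0 := RtoC (/ (q * q)) * tau).
    assert (H0 : (0 < Im t0)%R) by (apply Im_scal_pos; auto; apply Rinv_0_lt_compat; nra).
    assert (Q0 : RtoC q <> 0) by (intros K; apply RtoC_inj in K; lra).
    pose proof (th_mult_sq t0 (f n) H0) as E1. pose proof (th_mult_sq t0 n H0) as E2.
    fold p in E1. fold q in E2.
    replace (RtoC (q * q) * t0) with tau in E2.
    2: { unfold t0. rewrite RtoC_inv by nra. rewrite RtoC_mult. field. auto. }
    replace (RtoC (p * p) * t0) with (s n * s n * tau) in E1.
    2: { unfold t0, s. fold p q. unfold Rdiv. rewrite !RtoC_mult, !RtoC_inv, RtoC_mult by nra.
         field. auto. }
    rewrite E1, E2. unfold s. fold p q. unfold Rdiv. rewrite RtoC_mult, RtoC_inv by lra.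
    field. auto. }
  apply cvg_unique with (fun n => th_mult (s n * s n * tau)).
  - apply th_mult_continuous.
    + now apply Im_scal_pos.
    + replace (RtoC r) with (RtoC x * RtoC x).
      * apply cvg_mult; [ | apply cvg_const]. now apply cvg_mult.
      * rewrite <- RtoC_mult. unfold x. rewrite sqrt_sqrt by lra. reflexivity.
  - apply cvg_ext with (fun n => s n * th_mult tau); [intros; symmetry; apply E | ].
    apply cvg_mult; [exact Ls | apply cvg_const].
Qed.

Lemma im_div2 (tau : C) : (0 < Im tau)%R -> (0 < Im (tau / 2))%R.
Proof.
  intros H. unfold Cdiv. rewrite <- RtoC_inv by lra. rewrite im_scal_r. lra.
Qed.

(** Modulo 3, the classes of 0 and -1 each give the pentagonal series, and the class of 1 gives [th]
    at its zero. *)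
Lemma phi_third tau : (0 < Im tau)%R ->
  th (/ 3 * tau) ((tau + 1) / 6) = (1 + e (- / 6)) * phi tau.
Proof.
  intros H. assert (H3 := Im_scal_pos tau 3 ltac:(lra) H).
  assert (H' : (0 < Im (/ 3 * tau))%R) by (rewrite <- RtoC_inv by lra; apply Im_scal_pos; lra).
  rewrite phi_pentagonal by auto.
  unfold th at 1. rewrite (tsum_mod _ 1 (summ_th _ _ H')). simpl seq. simpl lsum.
  assert (E1 : tsum (fun j : Z => e (/ 3 * tau * (IZR (3 * j + (0 - 1)) * IZR (3 * j + (0 - 1))) / 2
      + IZR (3 * j + (0 - 1)) * ((tau + 1) / 6))) = e (- / 6) * th (3 * tau) (/ 2 - tau / 2)).
  { unfold th. rewrite <- tsum_scal by now apply summ_th. apply tsum_ext. intros j.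
    rewrite <- e_plus. f_equal. zpush. field. }
  assert (E2 : tsum (fun j : Z => e (/ 3 * tau * (IZR (3 * j + (1 - 1)) * IZR (3 * j + (1 - 1))) / 2
      + IZR (3 * j + (1 - 1)) * ((tau + 1) / 6))) = th (3 * tau) (/ 2 - tau / 2)).
  { rewrite <- (th_neg _ (/ 2 - tau / 2)), <- (th_1 _ (- _)) by auto.
    unfold th. apply tsum_ext. intros j. f_equal. zpush. field. }
  assert (E3 : tsum (fun j : Z => e (/ 3 * tau * (IZR (3 * j + (2 - 1)) * IZR (3 * j + (2 - 1))) / 2
      + IZR (3 * j + (2 - 1)) * ((tau + 1) / 6)))
      = e ((2 * tau + 1) / 6) * th (3 * tau) (/ 2 + 3 * tau / 2)).
  { unfold th. rewrite <- tsum_scal by now apply summ_th. apply tsum_ext. intros j.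
    rewrite <- e_plus. f_equal. zpush. field. }
  rewrite th_zero in E3 by auto.
  transitivity (e (- / 6) * th (3 * tau) (/ 2 - tau / 2)
    + (th (3 * tau) (/ 2 - tau / 2) + (e ((2 * tau + 1) / 6) * 0 + 0))); [ | ring].
  f_equal; [exact E1 | ]. f_equal; [exact E2 | ]. f_equal. exact E3.
Qed.

(** The pentagonal series at 3 * (-1 / tau) is the inversion of [th] at tau / 3, and [phi_third]
    brings that value back to [phi]. *)
Lemma eta_inversion tau : (0 < Im tau)%R -> eta (- / tau) = th_mult tau * eta tau.
Proof.
  intros H. pose proof (tau_neq0 tau H) as T0.
  assert (H' : (0 < Im (/ 3 * tau))%R) by (rewrite <- RtoC_inv by lra; apply Im_scal_pos; lra).
  rewrite !eta_phi. rewrite (phi_pentagonal (- / tau)) by now apply im_inv_neg.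
  pose proof (th_inversion (/ 3 * tau) ((tau + 1) / 6) H') as E.
  rewrite phi_third in E by auto.
  replace (- / (/ 3 * tau)) with (3 * (- / tau)) in E by (field; auto).
  replace ((tau + 1) / 6 / (/ 3 * tau)) with (/ 2 - - / tau / 2) in E by (field; auto).
  rewrite E. clear E.
  rewrite <- RtoC_inv by lra. rewrite th_mult_scal by lra.
  (* The sum of exponentials is 2 cos(pi / 6) = sqrt 3; it cancels the factor that the scaling law
     gives at r = 1/3. *)
  assert (S3 : sqrt (/ 3) * (e (/ 12) + e (- / 12)) = 1).
  { rewrite <- RtoC_inv, <- RtoC_opp, !e_real by lra.
    replace (2 * PI * / 12)%R with (PI / 6)%R by field.
    replace (2 * PI * - / 12)%R with (- (PI / 6))%R by field.
    rewrite cos_neg, sin_neg, cos_PI6, sqrt_inv.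
    pose proof (sqrt_lt_R0 3 ltac:(lra)).
    apply injective_projections; simpl; field; lra. }
  set (X := (tau + 1) / 6 * ((tau + 1) / 6) / (2 * (RtoC (/ 3) * tau))).
  assert (EX : e (- / tau / 24) * e X = e (tau / 24) * e (/ 12)).
  { rewrite <- !e_plus. f_equal. unfold X. rewrite RtoC_inv by lra. field. auto. }
  assert (E6 : e (/ 12) * (1 + e (- / 6)) = e (/ 12) + e (- / 12)).
  { rewrite Cmult_plus_distr_l, <- e_plus. f_equal; [ring | ]. f_equal. field. }
  transitivity ((e (- / tau / 24) * e X) * (sqrt (/ 3) * th_mult tau * ((1 + e (- / 6)) * phi tau)));
    [ring | ].
  rewrite EX.
  transitivity (e (tau / 24) * (sqrt (/ 3) * (e (/ 12) * (1 + e (- / 6)))) * th_mult tau * phi tau);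
    [ring | ].
  rewrite E6, S3. ring.
Qed.

Lemma eta_neq0 tau : (0 < Im tau)%R -> eta tau <> 0.
Proof.
  intros H. rewrite eta_phi. apply Cmult_neq_0; [apply e_neq0 | now apply phi_neq0].
Qed.

(** * Appell sums at torsion points as theta quotients *)

Section Appell.
Variable tau : C.
Hypothesis Htau : (0 < Im tau)%R.

(** Decay at the rate of the theta coefficients q^(m^2/2), up to an exponential in |m|. The class is
    closed under shifts and differences, and its Laurent series converge for every y. *)
Definition gdecay (h : Z -> C) : Prop := exists K B : R, (0 <= K)%R /\ (0 <= B)%R /\
  forall m, (Cmod (h m) <= K * exp (- (PI * Im tau) * (IZR m * IZR m) + B * Rabs (IZR m)))%R.

Definition ser (h : Z -> C) (y : C) : C := tsum (fun m : Z => h m * e (IZR m * y)).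

Lemma exp_mult_abs (x y : R) : (- (2 * PI * (x * y)) <= 2 * PI * Rabs y * Rabs x)%R.
Proof.
  pose proof (Rle_abs (- (x * y))) as H. rewrite Rabs_Ropp, Rabs_mult in H.
  pose proof PI_RGT_0.
  assert (PI * (- (x * y)) <= PI * (Rabs x * Rabs y))%R by (apply Rmult_le_compat_l; lra). lra.
Qed.

Lemma summ_ser h y : gdecay h -> summ (fun m : Z => h m * e (IZR m * y)).
Proof.
  intros [K [B [HK [HB H]]]].
  apply summ_dom with (fun m : Z => K * exp (- (PI * Im tau) * (IZR m * IZR m)
    + (B + 2 * PI * Rabs (Im y)) * Rabs (IZR m) + 0))%R.
  - intros m. rewrite Cmod_mult, Cmod_e, im_scal_l.
    eapply Rle_trans; [apply Rmult_le_compat_r; [left; apply exp_pos | apply H] | ].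
    rewrite Rmult_assoc, <- exp_plus. apply Rmult_le_compat_l; auto. apply exp_le.
    pose proof (exp_mult_abs (IZR m) (Im y)). lra.
  - apply summR_scal; auto. apply summR_gauss. pose proof PI_RGT_0. nra.
Qed.

Lemma gdecay_shift h : gdecay h -> gdecay (fun m => h (m - 1)%Z).
Proof.
  intros [K [B [HK [HB H]]]]. pose proof PI_RGT_0 as Pp.
  exists (K * exp (B + PI * Im tau))%R, (B + 2 * PI * Im tau)%R.
  assert (0 <= PI * Im tau)%R by nra.
  split; [apply Rmult_le_pos; auto; left; apply exp_pos | split; [lra | ]].
  intros m. eapply Rle_trans; [apply H | ]. rewrite Rmult_assoc, <- exp_plus.
  apply Rmult_le_compat_l; auto. apply exp_le. rewrite minus_IZR.
  set (x := IZR m).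
  assert (Rabs (x - 1) <= Rabs x + 1)%R.
  { pose proof (Rabs_triang x (- 1)) as T. rewrite (Rabs_left (- 1)) in T by lra.
    replace (x - 1)%R with (x + - 1)%R by ring. lra. }
  pose proof (Rle_abs x).
  assert (PI * Im tau * x <= PI * Im tau * Rabs x)%R by (apply Rmult_le_compat_l; auto).
  assert (B * Rabs (x - 1) <= B * (Rabs x + 1))%R by (apply Rmult_le_compat_l; auto).
  nra.
Qed.

Lemma gdecay_minus h h' : gdecay h -> gdecay h' -> gdecay (fun m => h m - h' m).
Proof.
  intros [K [B [HK [HB H]]]] [K' [B' [HK' [HB' H']]]].
  exists (K + K')%R, (B + B')%R. split; [lra | split; [lra | ]]. intros m.
  eapply Rle_trans; [apply Cmod_minus_le | ]. rewrite Rmult_plus_distr_r.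
  pose proof (Rabs_pos (IZR m)) as P.
  apply Rplus_le_compat; (eapply Rle_trans; [first [apply H | apply H'] | ]);
    (apply Rmult_le_compat_l; [assumption | apply exp_le]); nra.
Qed.

Lemma gdecay_th w : gdecay (fun m : Z => e (tau * (IZR m * IZR m) / 2 + IZR m * w)).
Proof.
  pose proof PI_RGT_0. exists 1%R, (2 * PI * Rabs (Im w))%R.
  split; [lra | split; [pose proof (Rabs_pos (Im w)); nra | ]].
  intros m. rewrite Rmult_1_l. eapply Rle_trans; [apply (quad_dom _ _ _ (Rabs (Im w))); lra | ].
  right. f_equal. ring.
Qed.

Lemma ser_th w y : ser (fun m : Z => e (tau * (IZR m * IZR m) / 2 + IZR m * w)) y = th tau (y + w).
Proof.
  apply tsum_ext. intros m. rewrite <- e_plus. f_equal. field.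
Qed.

Lemma ser_continuous h (u : nat -> C) y : gdecay h -> cvg u y ->
  cvg (fun n => ser h (u n)) (ser h y).
Proof.
  intros [K [B [HK [HB H]]]] Hu.
  destruct (Hu 1%R ltac:(lra)) as [N HN]. intros eps He.
  assert (T : cvg (fun n => ser h (u (n + N)%nat)) (ser h y)).
  { apply tannery with (fun m : Z => K * exp (- (PI * Im tau) * (IZR m * IZR m)
      + (B + 2 * PI * (Rabs (Im y) + 1)) * Rabs (IZR m) + 0))%R.
    - apply summR_scal; auto. apply summR_gauss. pose proof PI_RGT_0. nra.
    - intros n m. rewrite Cmod_mult, Cmod_e, im_scal_l.
      eapply Rle_trans; [apply Rmult_le_compat_r; [left; apply exp_pos | apply H] | ].
      rewrite Rmult_assoc, <- exp_plus. apply Rmult_le_compat_l; auto. apply exp_le.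
      pose proof (exp_mult_abs (IZR m) (Im (u (n + N)%nat))).
      assert (Hi : (Rabs (Im (u (n + N)%nat)) <= Rabs (Im y) + 1)%R).
      { specialize (HN (n + N)%nat ltac:(lia)).
        pose proof (im_le_Cmod (u (n + N)%nat - y)) as Hb.
        pose proof (Rabs_triang (Im y) (Im (u (n + N)%nat - y))) as Ht.
        replace (Im y + Im (u (n + N)%nat - y))%R with (Im (u (n + N)%nat)) in Ht
          by (unfold Im, Cminus, Cplus, Copp; simpl; ring). lra. }
      pose proof PI_RGT_0. pose proof (Rabs_pos (IZR m)) as Pm.
      assert (PI * Rabs (Im (u (n + N)%nat)) * Rabs (IZR m)
        <= PI * (Rabs (Im y) + 1) * Rabs (IZR m))%R.
      { apply Rmult_le_compat_r; auto. apply Rmult_le_compat_l; lra. }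
      lra.
    - intros m. apply cvg_scal. apply cvg_e. apply cvg_scal.
      apply (cvg_subseq u _ (fun n => n + N)%nat); [intros; lia | exact Hu]. }
  destruct (T eps He) as [M HM]. exists (M + N)%nat. intros n Hn.
  specialize (HM (n - N)%nat ltac:(lia)). replace (n - N + N)%nat with n in HM by lia. exact HM.
Qed.

(** In units of pi Im tau the exponent contains the form 2k^2 + 2km + m^2. It stays nonnegative
    after a quarter of k^2 + m^2 is removed, and that quarter gives a majorant that is a product in
    k and m. *)
Lemma summ_double h c y : gdecay h ->
  summ (fun p : Z * Z => e (IZR (fst p) * c + 2 * IZR (fst p) * y + tau * (IZR (fst p) * IZR (fst p)))
     * (h (snd p) * e (IZR (snd p) * (y + IZR (fst p) * tau)))).
Proof.
  intros [K [B [HK [HB H]]]]. pose proof PI_RGT_0 as Pp.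
  assert (Ha : (0 < PI * Im tau / 4)%R) by nra.
  apply summ_dom with (fun p : Z * Z =>
    (exp (- (PI * Im tau / 4) * (IZR (fst p) * IZR (fst p))
          + (2 * PI * Rabs (Im c + 2 * Im y)) * Rabs (IZR (fst p)) + 0)) *
    (K * exp (- (PI * Im tau / 4) * (IZR (snd p) * IZR (snd p))
          + (B + 2 * PI * Rabs (Im y)) * Rabs (IZR (snd p)) + 0)))%R.
  - intros [k m]. simpl fst. simpl snd. rewrite !Cmod_mult, !Cmod_e.
    replace (Im (IZR k * c + 2 * IZR k * y + tau * (IZR k * IZR k)))
      with (IZR k * (Im c + 2 * Im y) + Im tau * (IZR k * IZR k))%R.
    2: { destruct c, y, tau. unfold Im, Cmult, Cplus, RtoC. simpl. ring. }
    replace (Im (IZR m * (y + IZR k * tau))) with (IZR m * Im y + IZR m * IZR k * Im tau)%R.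
    2: { destruct y, tau. unfold Im, Cmult, Cplus, RtoC. simpl. ring. }
    set (X := exp (- (2 * PI * (IZR k * (Im c + 2 * Im y) + Im tau * (IZR k * IZR k))))).
    set (Y := exp (- (2 * PI * (IZR m * Im y + IZR m * IZR k * Im tau)))).
    apply Rle_trans with (X * ((K * exp (- (PI * Im tau) * (IZR m * IZR m)
      + B * Rabs (IZR m))) * Y))%R.
    { apply Rmult_le_compat_l; [left; apply exp_pos | ].
      apply Rmult_le_compat_r; [left; apply exp_pos | apply H]. }
    replace (X * ((K * exp (- (PI * Im tau) * (IZR m * IZR m) + B * Rabs (IZR m))) * Y))%R
      with (K * (X * (exp (- (PI * Im tau) * (IZR m * IZR m) + B * Rabs (IZR m)) * Y)))%R by ring.
    match goal with |- (_ <= ?a * (K * ?b))%R =>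
      replace (a * (K * b))%R with (K * (a * b))%R by ring end.
    apply Rmult_le_compat_l; auto. unfold X, Y. rewrite <- !exp_plus. apply exp_le.
    pose proof (exp_mult_abs (IZR k) (Im c + 2 * Im y)).
    pose proof (exp_mult_abs (IZR m) (Im y)).
    set (a := IZR k) in *. set (b := IZR m) in *.
    assert (Q : (0 <= 7 / 4 * (a * a) + 2 * (a * b) + 3 / 4 * (b * b))%R).
    { pose proof (pow2_ge_0 (a + 4 / 7 * b)). nra. }
    assert (Q2 := Rmult_le_pos (PI * Im tau) _ ltac:(nra) Q). lra.
  - apply (summR_prod
      (fun k : Z => exp (- (PI * Im tau / 4) * (IZR k * IZR k)
          + (2 * PI * Rabs (Im c + 2 * Im y)) * Rabs (IZR k) + 0))
      (fun m : Z => K * exp (- (PI * Im tau / 4) * (IZR m * IZR m)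
          + (B + 2 * PI * Rabs (Im y)) * Rabs (IZR m) + 0))%R).
    + intros; left; apply exp_pos.
    + intros. apply Rmult_le_pos; auto. left; apply exp_pos.
    + now apply summR_gauss.
    + apply summR_scal; auto. now apply summR_gauss.
Qed.

(** A function [sum_k e(kc) x^(2k) q^(k^2) H(x q^k)] transforms like a theta
    function of index 1, so it lies in a fixed two-dimensional space. *)
Lemma index_one h c : gdecay h -> exists g0 g1 : C, forall y,
  tsum (fun k : Z => e (IZR k * c + 2 * IZR k * y + tau * (IZR k * IZR k)) * ser h (y + IZR k * tau))
  = g0 * th (2 * tau) (2 * y + c) + g1 * (e y * th (2 * tau) (2 * y + c + tau)).
Proof.
  intros H. assert (H2 := Im_scal_pos tau 2 ltac:(lra) Htau).
  exists (tsum (fun k : Z => e (IZR k * c - tau * (IZR k * IZR k)) * h (- 2 * k)%Z)),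
         (tsum (fun k : Z => e (IZR k * c + tau * (IZR k - IZR k * IZR k)) * h (1 - 2 * k)%Z)).
  intros y.
  set (f := fun p : Z * Z => e (IZR (fst p) * c + 2 * IZR (fst p) * y + tau * (IZR (fst p) * IZR (fst p)))
     * (h (snd p) * e (IZR (snd p) * (y + IZR (fst p) * tau)))).
  assert (Sf : summ f) by exact (summ_double h c y H).
  transitivity (tsum f).
  { rewrite (tsum_fubini f Sf). apply tsum_ext. intros k. unfold f, ser. simpl.
    rewrite tsum_scal; [reflexivity | ]. now apply summ_ser. }
  (* Terms are grouped by the total power 2k + m of e(y): 2j in [p0], 2j + 1 in [p1]. *)
  set (p0 := fun p : Z * Z => (snd p, 2 * fst p - 2 * snd p)%Z).
  set (p1 := fun p : Z * Z => (snd p, 2 * fst p + 1 - 2 * snd p)%Z).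
  assert (I0 : forall a a', p0 a = p0 a' -> a = a').
  { intros [a b] [a' b'] E. unfold p0 in E. cbn [fst snd] in E.
    pose proof (f_equal fst E) as E1. pose proof (f_equal snd E) as E2. cbn [fst snd] in E1, E2.
    f_equal; lia. }
  assert (I1 : forall a a', p1 a = p1 a' -> a = a').
  { intros [a b] [a' b'] E. unfold p1 in E. cbn [fst snd] in E.
    pose proof (f_equal fst E) as E1. pose proof (f_equal snd E) as E2. cbn [fst snd] in E1, E2.
    f_equal; lia. }
  rewrite (tsum_split f p0 p1); auto.
  2: { intros [a b] [a' b'] E. unfold p0, p1 in E. cbn [fst snd] in E.
       pose proof (f_equal fst E) as E1. pose proof (f_equal snd E) as E2. cbn [fst snd] in E1, E2. lia. }
  2: { intros [k m]. destruct (Z.Even_or_Odd m) as [[j Hj]|[j Hj]].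
       - left. exists ((j + k)%Z, k). unfold p0. cbn [fst snd]. f_equal. lia.
       - right. exists ((j + k)%Z, k). unfold p1. cbn [fst snd]. f_equal. lia. }
  pose proof (summ_inj f p0 I0 Sf) as S0. pose proof (summ_inj f p1 I1 Sf) as S1.
  rewrite (tsum_fubini _ S0), (tsum_fubini _ S1). f_equal.
  (* Recentring k at j separates the variables: a theta term in j times a term in k alone, whose sum
     is the constant g0. *)
  - assert (E0 : forall j k : Z, f (p0 (j, (k + j)%Z)) =
      e (2 * tau * (IZR j * IZR j) / 2 + IZR j * (2 * y + c)) *
      (e (IZR k * c - tau * (IZR k * IZR k)) * h (- 2 * k)%Z)).
    { intros j k. unfold f, p0. cbn [fst snd].
      replace (2 * j - 2 * (k + j))%Z with (- 2 * k)%Z by ring.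
      rewrite (Cmult_comm (h _)), !Cmult_assoc, <- !e_plus. f_equal. f_equal. zpush. field. }
    unfold th. rewrite <- tsum_scal by now apply summ_th.
    apply tsum_ext. intros j.
    pose proof (summ_slice (fun p => f (p0 p)) j S0) as Sj.
    rewrite (tsum_shift _ j Sj), (tsum_ext _ _ (E0 j)), tsum_scal; [apply Cmult_comm | ].
    apply summ_ext with (2 := summ_scal (/ e (2 * tau * (IZR j * IZR j) / 2 + IZR j * (2 * y + c))) _
      (summ_shift _ j Sj)).
    intros k. cbv beta. rewrite E0. field. apply e_neq0.
  - assert (E0 : forall j k : Z, f (p1 (j, (k + j)%Z)) =
      e (y + (2 * tau * (IZR j * IZR j) / 2 + IZR j * (2 * y + c + tau))) *
      (e (IZR k * c + tau * (IZR k - IZR k * IZR k)) * h (1 - 2 * k)%Z)).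
    { intros j k. unfold f, p1. cbn [fst snd].
      replace (2 * j + 1 - 2 * (k + j))%Z with (1 - 2 * k)%Z by ring.
      rewrite (Cmult_comm (h _)), !Cmult_assoc, <- !e_plus. f_equal. f_equal. zpush. field. }
    unfold th. rewrite <- (tsum_scal (e y)) by now apply summ_th.
    rewrite <- tsum_scal by now apply summ_scal, summ_th.
    apply tsum_ext. intros j. rewrite <- e_plus.
    pose proof (summ_slice (fun p => f (p1 p)) j S1) as Sj.
    rewrite (tsum_shift _ j Sj), (tsum_ext _ _ (E0 j)), tsum_scal; [apply Cmult_comm | ].
    apply summ_ext with (2 := summ_scal
      (/ e (y + (2 * tau * (IZR j * IZR j) / 2 + IZR j * (2 * y + c + tau)))) _ (summ_shift _ j Sj)).
    intros k. cbv beta. rewrite E0. field. apply e_neq0.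
Qed.

(** [(1 + e y) * ser hcoef y = th tau (y + tau/2)]: division by the factor
    vanishing at [y = 1/2]. *)
Definition tail (a : Z) : C := tsum (fun i : nat =>
  e (INR i * / 2) * e (tau * (IZR (a + Z.of_nat i) * IZR (a + Z.of_nat i)) / 2
                       + IZR (a + Z.of_nat i) * (tau / 2))).
(** The division requires c_p + c_(p-1) = q^(p(p+1)/2), which the alternating tail starting at p + 1
    satisfies. The right side is invariant under p -> -1 - p; the absolute value uses this symmetry
    to get decay at both ends. *)
Definition hcoef (p : Z) : C := tail (Z.abs (p + 1)).

Lemma Cmod_e_real (x : C) : Im x = 0%R -> Cmod (e x) = 1%R.
Proof. intros H. rewrite Cmod_e, H, Rmult_0_r, Ropp_0. apply exp_0. Qed.

Lemma im_half_INR (i : R) : Im (i * / 2) = 0%R.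
Proof. rewrite <- RtoC_inv, <- RtoC_mult by lra. apply im_RtoC. Qed.

Lemma summ_tail a : summ (fun i : nat =>
  e (INR i * / 2) * e (tau * (IZR (a + Z.of_nat i) * IZR (a + Z.of_nat i)) / 2
                       + IZR (a + Z.of_nat i) * (tau / 2))).
Proof.
  assert (Hi : forall i j : nat, (a + Z.of_nat i)%Z = (a + Z.of_nat j)%Z -> i = j) by (intros; lia).
  apply summ_dom with (2 := summ_inj _ (fun i : nat => (a + Z.of_nat i)%Z) Hi (summ_th tau (tau / 2) Htau)).
  intros i. rewrite Cmod_mult, Cmod_e_real by apply im_half_INR. lra.
Qed.

Lemma tail_step a : tail a + tail (a + 1) = e (tau * (IZR a * IZR a) / 2 + IZR a * (tau / 2)).
Proof.
  unfold tail at 1. rewrite (tsum_split _ (fun _ : unit => 0%nat) S).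
  - rewrite (tsum_single _ tt) by (intros [] H; congruence).
    rewrite Z.add_0_r. simpl (INR 0). rewrite Cmult_0_l, e_0, Cmult_1_l.
    rewrite (tsum_ext _ (fun i : nat => (-1) * (e (INR i * / 2) *
      e (tau * (IZR (a + 1 + Z.of_nat i) * IZR (a + 1 + Z.of_nat i)) / 2
         + IZR (a + 1 + Z.of_nat i) * (tau / 2))))).
    + rewrite tsum_scal by apply summ_tail. fold (tail (a + 1)). ring.
    + intros i. replace (a + Z.of_nat (S i))%Z with (a + 1 + Z.of_nat i)%Z by lia.
      rewrite S_INR, RtoC_plus, Cmult_plus_distr_r, e_plus, Cmult_1_l, e_half. ring.
  - intros [] []; reflexivity.
  - intros; lia.
  - intros; lia.
  - intros [|n]; [left; now exists tt | right; now exists n].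
  - apply summ_tail.
Qed.

Lemma hcoef_step p : hcoef p + hcoef (p - 1) = e (tau * (IZR p * IZR p) / 2 + IZR p * (tau / 2)).
Proof.
  unfold hcoef. replace (p - 1 + 1)%Z with p by ring.
  destruct (Z_le_gt_dec 0 p).
  - rewrite (Z.abs_eq (p + 1)), (Z.abs_eq p) by lia. rewrite Cplus_comm. apply tail_step.
  - rewrite (Z.abs_neq (p + 1)), (Z.abs_neq p) by lia.
    replace (- p)%Z with (- (p + 1) + 1)%Z by ring. rewrite tail_step. f_equal.
    zpush. field.
Qed.

Lemma tail_bound_gauss : exists K, (0 <= K)%R /\ forall a, (0 <= a)%Z ->
  (Cmod (tail a) <= K * exp (- (PI * Im tau) * (IZR a * IZR a)))%R.
Proof.
  pose proof PI_RGT_0 as Pp. assert (Pt : (0 < PI * Im tau)%R) by nra.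
  destruct (summR_gauss (PI * Im tau) 0 0 Pt) as [K HK].
  assert (HK' : bndR (fun i : nat => exp (- (PI * Im tau) * (IZR (Z.of_nat i) * IZR (Z.of_nat i))
      + 0 * Rabs (IZR (Z.of_nat i)) + 0)) K).
  { refine (bndR_inj (fun n : Z => exp (- (PI * Im tau) * (IZR n * IZR n)
      + 0 * Rabs (IZR n) + 0)) Z.of_nat K _ HK). intros; lia. }
  exists K. split; [exact (bndR_nonneg _ _ HK) | ]. intros a Ha.
  rewrite Rmult_comm. eapply tsum_bound; [ | apply bndR_scal; [left; apply exp_pos | exact HK']].
  intros i. rewrite Cmod_mult, Cmod_e_real, Rmult_1_l, Cmod_e_quad by apply im_half_INR.
  rewrite <- exp_plus. apply exp_le. rewrite plus_IZR.
  apply IZR_le in Ha. pose proof (IZR_le 0 (Z.of_nat i) ltac:(lia)) as Hi.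
  set (x := IZR a) in *. set (n := IZR (Z.of_nat i)) in *.
  replace (Im (tau / 2)) with (Im tau / 2)%R.
  2: { unfold Cdiv. rewrite <- RtoC_inv by lra. rewrite im_scal_r. reflexivity. }
  assert (0 <= (PI * Im tau) * (2 * x * n + x + n))%R by (apply Rmult_le_pos; nra).
  lra.
Qed.

Lemma gdecay_hcoef : gdecay hcoef.
Proof.
  pose proof PI_RGT_0 as Pp. assert (Pt : (0 < PI * Im tau)%R) by nra.
  destruct tail_bound_gauss as [K [HK H]]. exists K, (2 * (PI * Im tau))%R.
  split; [exact HK | split; [lra | ]]. intros p. unfold hcoef.
  eapply Rle_trans; [apply H; lia | ]. apply Rmult_le_compat_l; auto. apply exp_le.
  assert (E : (IZR (Z.abs (p + 1)) * IZR (Z.abs (p + 1)) = IZR p * IZR p + 2 * IZR p + 1)%R).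
  { rewrite <- mult_IZR. replace (Z.abs (p + 1) * Z.abs (p + 1))%Z with (p * p + 2 * p + 1)%Z by nia.
    now rewrite !plus_IZR, !mult_IZR. }
  rewrite E. pose proof (Rle_abs (- IZR p)) as T. rewrite Rabs_Ropp in T.
  assert (PI * Im tau * (- IZR p) <= PI * Im tau * Rabs (IZR p))%R
    by (apply Rmult_le_compat_l; lra).
  lra.
Qed.

Lemma ser_shift h y : gdecay h -> ser (fun m => h (m - 1)%Z) y = e y * ser h y.
Proof.
  intros H. unfold ser. rewrite <- tsum_scal by now apply summ_ser.
  rewrite (tsum_shift _ 1) by exact (summ_ser _ y (gdecay_shift h H)).
  apply tsum_ext. intros m. replace (m + 1 - 1)%Z with m by ring.
  replace (e (IZR (m + 1) * y)) with (e y * e (IZR m * y)); [ring | ].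
  rewrite <- e_plus. f_equal. zpush. ring.
Qed.

Lemma ser_minus h h' y : gdecay h -> gdecay h' ->
  ser (fun m => h m - h' m) y = ser h y - ser h' y.
Proof.
  intros H H'. unfold ser. rewrite <- tsum_minus by now apply summ_ser.
  apply tsum_ext. intros; ring.
Qed.

Lemma ser_hcoef y : (1 + e y) * ser hcoef y = th tau (y + tau / 2).
Proof.
  pose proof gdecay_hcoef as H.
  rewrite Cmult_plus_distr_r, <- ser_shift, Cmult_1_l by auto.
  rewrite <- ser_th. unfold ser.
  rewrite <- tsum_plus; [ | now apply summ_ser | now apply (summ_ser _ y (gdecay_shift _ H))].
  apply tsum_ext. intros m. rewrite <- hcoef_step. ring.
Qed.

Lemma inv_succ_not_int (n : nat) (k : Z) : (1 <= n)%nat -> (/ (INR n + 1) <> IZR k)%R.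
Proof.
  intros Hn E. assert (PN : (1 <= INR n)%R) by (apply (le_INR 1); exact Hn).
  assert (H0 : (0 < / (INR n + 1))%R) by (apply Rinv_0_lt_compat; lra).
  assert (H1 : (/ (INR n + 1) < 1)%R).
  { rewrite <- Rinv_1. apply Rinv_lt_contravar; lra. }
  rewrite E in H0, H1. apply lt_IZR in H0, H1. lia.
Qed.

Lemma cvg_near (z : C) : cvg (fun n => z + (/ (INR n + 1))%R) z.
Proof.
  replace z with (z + RtoC 0) at 1 by ring. apply cvg_plus; [apply cvg_const | ].
  apply cvg_RtoC. replace (Finite 0) with (Rbar_inv p_infty) by reflexivity.
  apply is_lim_seq_inv; [ | discriminate].
  replace p_infty with (Rbar_plus p_infty (Finite 1)) by reflexivity.
  eapply is_lim_seq_plus; [apply is_lim_seq_INR | apply is_lim_seq_const | reflexivity].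
Qed.

(** The value at its zero of theta divided by the vanishing factor: the triple product exhibits the
    cofactor of 1 + e(y), and continuity carries it to y = 1/2. It stands in for the classical fact
    that theta_11'(0) is a multiple of eta^3. *)
Lemma ser_hcoef_half : ser hcoef (/ 2) = - (phi tau * phi tau * phi tau).
Proof.
  set (u := fun n => / 2 + (/ (INR n + 1))%R).
  pose proof (cvg_near (/ 2)) as Hu. fold u in Hu.
  pose proof (ser_continuous hcoef u (/ 2) gdecay_hcoef Hu) as H1.
  assert (H2 : cvg (fun n => phi tau * (e (- u n) * (pp tau (u n + tau) * pp tau (- u n + tau))))
    (phi tau * (e (- / 2) * (pp tau (/ 2 + tau) * pp tau (- / 2 + tau))))).
  { apply cvg_scal. apply cvg_mult; [apply cvg_e, cvg_opp, Hu | ].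
    apply cvg_mult; apply pp_continuous; auto.
    - apply cvg_plus; [exact Hu | apply cvg_const].
    - apply cvg_plus; [apply cvg_opp, Hu | apply cvg_const]. }
  assert (E : forall n, (1 <= n)%nat -> phi tau * (e (- u n) * (pp tau (u n + tau) * pp tau (- u n + tau)))
     = ser hcoef (u n)).
  { intros n Hn. assert (Hne : 1 + e (u n) <> 0).
    { intros K. unfold u in K. rewrite e_plus, e_half in K.
      assert (K' : e (/ (INR n + 1))%R = 1).
      { transitivity (1 - (1 + -1 * e (/ (INR n + 1))%R)); [ring | ].
        rewrite K. ring. }
      destruct (e_eq1 _ K') as [k Hk]. apply RtoC_inj in Hk.
      exact (inv_succ_not_int n k Hn Hk). }
    pose proof (ser_hcoef (u n)) as E1. rewrite jtp in E1 by auto.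
    replace (u n + tau / 2 + tau / 2) with (u n + tau) in E1 by field.
    replace (- (u n + tau / 2) + tau / 2) with (- u n) in E1 by field.
    rewrite (pp_step tau Htau (- u n)) in E1.
    assert (E2 : 1 + e (- u n) = e (- u n) * (1 + e (u n))).
    { rewrite e_opp. field. apply e_neq0. }
    rewrite E2 in E1.
    transitivity ((1 + e (u n)) * ser hcoef (u n) / (1 + e (u n))); [ | field; exact Hne].
    rewrite E1. field. exact Hne. }
  pose proof (cvg_eventually _ _ _ 1%nat E H2) as H3.
  rewrite (cvg_unique _ _ _ H1 H3).
  replace (- / 2 + tau) with (tau + / 2 + IZR (-1)) by field.
  rewrite pp_shift, (Cplus_comm (/ 2)), <- phi_pp, e_opp, e_half. field.
Qed.

Definition good (y : C) : Prop := forall k : Z, 1 + e (y + IZR k * tau) <> 0.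

(** In one direction the factors tend to 1. In the other 1 + X = X (1 + 1/X) reduces to the same
    case, with |X| >= |e(y)|. *)
Lemma good_bounded_below y : good y ->
  exists c : R, (0 < c)%R /\ forall k : Z, (c <= Cmod (1 + e (y + IZR k * tau)))%R.
Proof.
  intros H.
  destruct (geo_bounded_below (fun n => e (y + INR n * tau)) (geo_e tau Htau y)) as [c [Hc Hb]].
  { intros n. rewrite INR_IZR_INZ. apply H. }
  assert (E : forall k : Z, 1 + e (y + IZR k * tau)
    = e (y + IZR k * tau) * (1 + e (- y + IZR (- k) * tau))).
  { intros k. rewrite Cmult_plus_distr_l, <- e_plus.
    replace (y + IZR k * tau + (- y + IZR (- k) * tau)) with (RtoC 0) by (zpush; ring).
    rewrite e_0. ring. }
  destruct (geo_bounded_below (fun n => e (- y + INR n * tau)) (geo_e tau Htau (- y))) as [c' [Hc' Hb']].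
  { intros n K. apply (H (- Z.of_nat n)%Z). rewrite E, Z.opp_involutive, <- INR_IZR_INZ, K. ring. }
  assert (Pe : (0 < Cmod (e y))%R) by (apply Cmod_gt_0, e_neq0).
  exists (Rmin c (Cmod (e y) * c')). split; [apply Rmin_pos; auto; now apply Rmult_lt_0_compat | ].
  intros k. destruct (Z_le_gt_dec 0 k) as [Hk|Hk].
  - apply Rle_trans with (1 := Rmin_l _ _). rewrite <- (Z2Nat.id k) by lia.
    rewrite <- INR_IZR_INZ. apply Hb.
  - apply Rle_trans with (1 := Rmin_r _ _). rewrite E, Cmod_mult.
    apply Rmult_le_compat; [lra | lra | | ].
    + rewrite !Cmod_e, im_affine. apply exp_le. pose proof PI_RGT_0.
      assert (IZR k <= 0)%R by (apply (IZR_le k 0); lia).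
      assert (0 <= PI * (- IZR k * Im tau))%R by (apply Rmult_le_pos; nra). nra.
    + replace (- k)%Z with (Z.of_nat (Z.to_nat (- k))) by lia. rewrite <- INR_IZR_INZ. apply Hb'.
Qed.

Lemma summ_appell (y w : C) (g : Z -> C) B : (forall k, (Cmod (g k) <= B)%R) ->
  summ (fun k : Z => e (tau * (IZR k * IZR k) / 2 + IZR k * w) * g k).
Proof.
  intros Hg. apply summ_dom with
    (fun k : Z => B * Cmod (e (tau * (IZR k * IZR k) / 2 + IZR k * w)))%R.
  - intros k. rewrite Cmod_mult, Rmult_comm. apply Rmult_le_compat_r; [apply Cmod_ge_0 | auto].
  - apply summR_scal; [ | now apply summ_th].
    apply Rle_trans with (2 := Hg 0%Z). apply Cmod_ge_0.
Qed.

Lemma bounded_inv y : good y -> exists B, forall k : Z,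
  (Cmod (1 / (1 + e (y + IZR k * tau))) <= B)%R.
Proof.
  intros H. destruct (good_bounded_below y H) as [c [Hc Hb]]. exists (/ c)%R. intros k.
  rewrite Cmod_div, Cmod_1 by apply H. unfold Rdiv. rewrite Rmult_1_l.
  apply Rinv_le_contravar; auto.
Qed.

Lemma bounded_tan y : good y -> exists B, forall k : Z,
  (Cmod ((1 - e (y + IZR k * tau)) / (1 + e (y + IZR k * tau))) <= B)%R.
Proof.
  intros H. destruct (bounded_inv y H) as [B HB]. exists (2 * B + 1)%R. intros k.
  specialize (HB k).
  replace ((1 - e (y + IZR k * tau)) / (1 + e (y + IZR k * tau)))
    with (2 * (1 / (1 + e (y + IZR k * tau))) - 1) by (field; apply H).
  eapply Rle_trans; [apply Cmod_minus_le | ]. rewrite Cmod_mult, Cmod_1, Cmod_R, Rabs_right by lra.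
  lra.
Qed.

(** The kernel (1 - X)/(1 + X) is odd under X -> 1/X, the symmetry that the correction term
    restores. For d = 1/2 the terms acquire the sign (-1)^k. *)
Definition appU (d y : C) : C := tsum (fun k : Z =>
  e (tau * (IZR k * IZR k) / 2 + IZR k * (y + d)) *
  ((1 - e (y + IZR k * tau)) / (1 + e (y + IZR k * tau)))).

Definition appW (y : C) : C := tsum (fun k : Z =>
  e (tau * (IZR k * IZR k) / 2 + IZR k * (y + / 2 + tau / 2)) *
  (1 / (1 + e (y + IZR k * tau)))).

Lemma summ_appU d y : good y -> summ (fun k : Z =>
  e (tau * (IZR k * IZR k) / 2 + IZR k * (y + d)) *
  ((1 - e (y + IZR k * tau)) / (1 + e (y + IZR k * tau)))).
Proof. intros H. destruct (bounded_tan y H) as [B HB]. exact (summ_appell y _ _ B HB). Qed.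

Lemma summ_appW y : good y -> summ (fun k : Z =>
  e (tau * (IZR k * IZR k) / 2 + IZR k * (y + / 2 + tau / 2)) *
  (1 / (1 + e (y + IZR k * tau)))).
Proof. intros H. destruct (bounded_inv y H) as [B HB]. exact (summ_appell y _ _ B HB). Qed.

(** Quasi-periodicity brings out the factor 1 + e(y + k tau) for any chosen k, so one theta value
    cancels the denominator of every term of an Appell sum. *)
Lemma th_shift_hcoef y (k : Z) : th tau (y + tau / 2) =
  e (tau * (IZR k * IZR k) / 2 + IZR k * (y + tau / 2)) *
  ((1 + e (y + IZR k * tau)) * ser hcoef (y + IZR k * tau)).
Proof.
  rewrite ser_hcoef. rewrite (th_quasi tau (y + tau / 2) k Htau). f_equal. f_equal. ring.
Qed.

(** Puts the candidate theta products into the form treated by [index_one], hence into the same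
    two-dimensional space as the Appell sums. *)
Lemma th_product (v w y : C) : th tau (y + v) * th tau (y + w) =
  tsum (fun k : Z => e (IZR k * (v + w) + 2 * IZR k * y + tau * (IZR k * IZR k)) *
    ser (fun m : Z => e (tau * (IZR m * IZR m) / 2 + IZR m * w)) (y + IZR k * tau)).
Proof.
  unfold th at 1. rewrite Cmult_comm, <- tsum_scal by now apply summ_th.
  apply tsum_ext. intros k. rewrite ser_th, (th_quasi tau (y + w) k Htau).
  replace (y + IZR k * tau + w) with (y + w + IZR k * tau) by ring.
  rewrite (Cmult_comm _ (th _ _)), <- Cmult_assoc, <- e_plus, Cmult_comm.
  f_equal. f_equal. field.
Qed.

End Appell.

(** * Appell sums identified by two of their values *)

Section AppellTheta.
Variable tau : C.
Hypothesis Htau : (0 < Im tau)%R.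

Lemma neg_self_0 (x : C) : x = - x -> x = 0.
Proof.
  intros H. replace x with ((x + x) / 2) by field. rewrite H at 1. field.
Qed.

(** The quotient keeps the other zeros of theta; consequently the cleared Appell sums reduce to
    their term k = 0 at y = 1/2. *)
Lemma ser_hcoef_vanish (k : Z) : k <> 0%Z -> ser (hcoef tau) (/ 2 + IZR k * tau) = 0.
Proof.
  intros Hk. pose proof (ser_hcoef tau Htau (/ 2 + IZR k * tau)) as E.
  assert (Z0 : th tau (/ 2 + IZR k * tau + tau / 2) = 0).
  { pose proof (th_quasi tau (/ 2 + tau / 2) k Htau) as Q. rewrite th_zero in Q by auto.
    replace (/ 2 + IZR k * tau + tau / 2) with (/ 2 + tau / 2 + IZR k * tau) by ring.
    transitivity (e (tau * (IZR k * IZR k) / 2 + IZR k * (/ 2 + tau / 2)) *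
      th tau (/ 2 + tau / 2 + IZR k * tau) / e (tau * (IZR k * IZR k) / 2 + IZR k * (/ 2 + tau / 2)));
      [field; apply e_neq0 | ].
    rewrite <- Q. field. apply e_neq0. }
  rewrite Z0 in E.
  assert (N : 1 + e (/ 2 + IZR k * tau) <> 0).
  { rewrite <- RtoC_inv by lra. apply one_plus_e_neq0_im; auto. now apply not_0_IZR. }
  transitivity ((1 + e (/ 2 + IZR k * tau)) * ser (hcoef tau) (/ 2 + IZR k * tau)
    / (1 + e (/ 2 + IZR k * tau))); [field; exact N | ].
  rewrite E. field. exact N.
Qed.

Lemma good_0 : good tau 0.
Proof.
  intros k. destruct (Z.eq_dec k 0) as [->|Hk].
  - replace (0 + 0 * tau) with (RtoC 0) by ring. rewrite e_0. intros E.
    rewrite <- RtoC_plus in E. apply RtoC_inj in E. lra.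
  - apply (one_plus_e_neq0_im tau 0); auto. now apply not_0_IZR.
Qed.

Lemma good_mid : good tau (/ 2 + tau / 2).
Proof.
  intros k. replace (/ 2 + tau / 2 + IZR k * tau) with ((/ 2)%R + RtoC (/ 2 + IZR k) * tau).
  - apply one_plus_e_neq0_im; auto. apply half_int_neq0.
  - rewrite RtoC_plus, RtoC_inv by lra. field.
Qed.

(** At y = 0 the substitution k -> -k sends X to 1/X and reverses the sign of each term. *)
Lemma appU_0 (d : C) : d = 0 \/ d = / 2 -> appU tau d 0 = 0.
Proof.
  intros Hd. apply neg_self_0. unfold appU at 1.
  rewrite (tsum_neg _ (summ_appU tau Htau d 0 good_0)).
  unfold appU. rewrite <- tsum_opp by exact (summ_appU tau Htau d 0 good_0).
  apply tsum_ext. intros k.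
  assert (E : e (tau * (IZR (- k) * IZR (- k)) / 2 + IZR (- k) * (0 + d))
    = e (tau * (IZR k * IZR k) / 2 + IZR k * (0 + d))).
  { destruct Hd as [->| ->].
    - f_equal. zpush. field.
    - apply e_shift with (- k)%Z. zpush. field. }
  rewrite E. replace (0 + IZR (- k) * tau) with (- (0 + IZR k * tau)) by (zpush; ring).
  rewrite e_opp. pose proof (good_0 k) as N. field. repeat split; auto using e_neq0.
Qed.

(** At this point k -> -1 - k sends X to 1/X, and the factor X thus gained turns each term into its
    negative. *)
Lemma appW_mid : appW tau (/ 2 + tau / 2) = 0.
Proof.
  apply neg_self_0. pose proof (summ_appW tau Htau _ good_mid) as S.
  unfold appW at 1. rewrite (tsum_bij _ (fun k => - 1 - k)%Z (fun k => - 1 - k)%Z);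
    [ | intros; ring | intros; ring | exact S].
  unfold appW. rewrite <- tsum_opp by exact S. apply tsum_ext. intros k.
  assert (E1 : e (/ 2 + tau / 2 + IZR (- 1 - k) * tau) = / e (/ 2 + tau / 2 + IZR k * tau)).
  { rewrite <- e_opp. apply e_shift with 1%Z. zpush. field. }
  pose proof (good_mid k) as N1. pose proof (e_neq0 (/ 2 + tau / 2 + IZR k * tau)) as N2.
  assert (E2 : e (tau * (IZR (- 1 - k) * IZR (- 1 - k)) / 2 +
      IZR (- 1 - k) * (/ 2 + tau / 2 + / 2 + tau / 2)) * e (/ 2 + tau / 2 + IZR k * tau)
    = - e (tau * (IZR k * IZR k) / 2 + IZR k * (/ 2 + tau / 2 + / 2 + tau / 2))).
  { replace (- e (tau * (IZR k * IZR k) / 2 + IZR k * (/ 2 + tau / 2 + / 2 + tau / 2)))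
      with (e (tau * (IZR k * IZR k) / 2 + IZR k * (/ 2 + tau / 2 + / 2 + tau / 2) + / 2))
      by (rewrite e_plus, e_half; ring).
    rewrite <- e_plus. apply e_shift with (-1 - 2 * k)%Z. zpush. field. }
  rewrite E1.
  transitivity (e (tau * (IZR (- 1 - k) * IZR (- 1 - k)) / 2 +
      IZR (- 1 - k) * (/ 2 + tau / 2 + / 2 + tau / 2)) * e (/ 2 + tau / 2 + IZR k * tau)
      * (1 / (1 + e (/ 2 + tau / 2 + IZR k * tau)))).
  - field. repeat split; auto.
  - rewrite E2. ring.
Qed.

Lemma scal_eq_0 (a b : C) : b <> 0 -> a * b = 0 -> a = 0.
Proof. intros Hb H. transitivity (a * b / b); [field; auto | ]. rewrite H. field. auto. Qed.

(** Both sides lie in the space of [index_one] with the same c. At y = 0 both vanish; at y = 1/2 the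
    sum reduces to k = 0 and [th_triple] matches the constants. *)
Lemma appU_theta (d y : C) : d = 0 \/ d = / 2 -> good tau y ->
  th tau (y + tau / 2) * appU tau d y
  = - (th tau (d + / 2) * (th tau (y + tau / 2 + / 2) * th tau (y + d + / 2))).
Proof.
  intros Hd Hy. assert (H2 := Im_scal_pos tau 2 ltac:(lra) Htau).
  set (c := d + tau / 2).
  set (hU := fun m => hcoef tau m - hcoef tau (m - 1)).
  pose proof (gdecay_hcoef tau Htau) as G0.
  assert (GU : gdecay tau hU) by (apply gdecay_minus; auto; now apply gdecay_shift).
  assert (EU : forall u, ser hU u = (1 - e u) * ser (hcoef tau) u).
  { intros u. unfold hU. rewrite (ser_minus tau), (ser_shift tau); auto; [ring | now apply gdecay_shift]. }
  destruct (index_one tau Htau hU c GU) as [a0 [a1 EA]].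
  destruct (index_one tau Htau _ c (gdecay_th tau (tau / 2 + / 2))) as [b0 [b1 EB]].
  set (SU := fun u => tsum (fun k : Z => e (IZR k * c + 2 * IZR k * u + tau * (IZR k * IZR k))
    * ser hU (u + IZR k * tau))) in *.
  assert (F1 : forall u, good tau u -> th tau (u + tau / 2) * appU tau d u = SU u).
  { intros u Hu. unfold appU, SU. rewrite <- tsum_scal by now apply summ_appU.
    apply tsum_ext. intros k. rewrite (th_shift_hcoef tau Htau u k), EU.
    replace (e (IZR k * c + 2 * IZR k * u + tau * (IZR k * IZR k)))
      with (e (tau * (IZR k * IZR k) / 2 + IZR k * (u + tau / 2)) *
            e (tau * (IZR k * IZR k) / 2 + IZR k * (u + d))).
    - field. apply Hu.
    - rewrite <- e_plus. f_equal. unfold c. field. }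
  assert (F2 : forall u, th tau (u + (d - / 2)) * th tau (u + (tau / 2 + / 2))
    = b0 * th (2 * tau) (2 * u + c) + b1 * (e u * th (2 * tau) (2 * u + c + tau))).
  { intros u. rewrite <- EB, th_product by auto.
    replace (d - / 2 + (tau / 2 + / 2)) with c by (unfold c; ring). reflexivity. }
  set (K := th tau (d + / 2)).
  set (g0 := a0 + K * b0). set (g1 := a1 + K * b1).
  assert (F3 : forall u, SU u + K * (th tau (u + (d - / 2)) * th tau (u + (tau / 2 + / 2)))
    = g0 * th (2 * tau) (2 * u + c) + g1 * (e u * th (2 * tau) (2 * u + c + tau))).
  { intros u. rewrite F2. unfold SU. rewrite EA. unfold g0, g1. ring. }
  (* Passing from y = 0 to y = 1/2 leaves both theta values unchanged and replaces e(y) = 1 by -1,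
     so the two conditions on g0, g1 differ by one sign and separate. *)
  assert (P0 : g0 * th (2 * tau) c + g1 * th (2 * tau) (c + tau) = 0).
  { pose proof (F3 0) as E. replace (2 * 0 + c) with c in E by ring.
    rewrite <- F1, appU_0 in E by (auto using good_0).
    replace (0 + (tau / 2 + / 2)) with (/ 2 + tau / 2) in E by ring.
    rewrite th_zero, e_0 in E by auto.
    transitivity (g0 * th (2 * tau) c + g1 * (1 * th (2 * tau) (c + tau))); [ring | ].
    rewrite <- E. ring. }
  assert (P1 : g0 * th (2 * tau) c - g1 * th (2 * tau) (c + tau) = 0).
  { pose proof (F3 (/ 2)) as E.
    replace (2 * / 2 + c) with (c + 1) in E by field.
    replace (c + 1 + tau) with (c + tau + 1) in E by ring.
    rewrite !th_1, e_half in E.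
    assert (ES : SU (/ 2) = - (2 * (phi tau * phi tau * phi tau))).
    { unfold SU. rewrite (tsum_single _ 0%Z).
      - rewrite EU. replace (/ 2 + 0 * tau) with (/ 2) by ring.
        rewrite ser_hcoef_half, e_half by auto.
        replace (0 * c + 2 * 0 * / 2 + tau * (0 * 0)) with (RtoC 0) by ring. rewrite e_0. ring.
      - intros k Hk. rewrite EU, ser_hcoef_vanish by auto. ring. }
    assert (ET : K * (th tau (/ 2 + (d - / 2)) * th tau (/ 2 + (tau / 2 + / 2)))
      = 2 * (phi tau * phi tau * phi tau)).
    { rewrite <- th_triple by auto. replace (/ 2 + (d - / 2)) with d by ring.
      replace (/ 2 + (tau / 2 + / 2)) with (tau / 2 + 1) by field. rewrite th_1. unfold K.
      destruct Hd as [->| ->].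
      - rewrite Cplus_0_l. ring.
      - replace (/ 2 + / 2) with (0 + 1) by field. rewrite th_1. ring. }
    rewrite ES, ET in E.
    transitivity (g0 * th (2 * tau) c + g1 * (-1 * th (2 * tau) (c + tau))); [ring | ].
    rewrite <- E. ring. }
  assert (D : exists x : R, d = x).
  { destruct Hd as [->| ->]; [now exists 0%R | ]. exists (/ 2)%R. now rewrite RtoC_inv by lra. }
  destruct D as [x Hx].
  (* The zeros of [th] at 2 tau lie at half-odd multiples of 2 tau in the tau direction; c and c +
     tau sit at the multiples 1/4 and 3/4. *)
  assert (Q : forall n : Z, (4 * n + 3 <> 0 /\ 4 * n + 5 <> 0)%Z) by (intros; lia).
  assert (N0 : th (2 * tau) c <> 0).
  { replace c with (RtoC x + (/ 4)%R * (2 * tau)).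
    - apply th_neq0_off; auto. intros n E. destruct (Q n) as [Q1 _]. apply Q1.
      apply eq_IZR. rewrite plus_IZR, mult_IZR. lra.
    - unfold c. rewrite Hx, RtoC_inv by lra. field. }
  assert (N1 : th (2 * tau) (c + tau) <> 0).
  { replace (c + tau) with (RtoC x + (3 * / 4)%R * (2 * tau)).
    - apply th_neq0_off; auto. intros n E. destruct (Q n) as [_ Q1]. apply Q1.
      apply eq_IZR. rewrite plus_IZR, mult_IZR. lra.
    - unfold c. rewrite Hx, RtoC_mult, RtoC_inv by lra. field. }
  assert (Z0 : g0 = 0).
  { apply (scal_eq_0 _ _ N0). transitivity (((g0 * th (2 * tau) c + g1 * th (2 * tau) (c + tau))
      + (g0 * th (2 * tau) c - g1 * th (2 * tau) (c + tau))) / 2); [field | ].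
    rewrite P0, P1. field. }
  assert (Z1 : g1 = 0).
  { apply (scal_eq_0 _ _ N1). transitivity (((g0 * th (2 * tau) c + g1 * th (2 * tau) (c + tau))
      - (g0 * th (2 * tau) c - g1 * th (2 * tau) (c + tau))) / 2); [field | ].
    rewrite P0, P1. field. }
  pose proof (F3 y) as E. rewrite Z0, Z1 in E. rewrite F1 by exact Hy. fold K.
  replace (y + d + / 2) with (y + (d - / 2) + 1) by field. rewrite th_1.
  replace (y + tau / 2 + / 2) with (y + (tau / 2 + / 2)) by ring.
  transitivity ((SU y + K * (th tau (y + (d - / 2)) * th tau (y + (tau / 2 + / 2))))
    - K * (th tau (y + (tau / 2 + / 2)) * th tau (y + (d - / 2)))); [ring | ].
  rewrite E. ring.
Qed.

(** The comparison points are now 1/2 and 1/2 + tau/2. At the first the basis function of g0 is at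
    its zero, so g1 is found alone; at the second both sides vanish, which gives g0. *)
Lemma appW_theta (y : C) : good tau y ->
  th tau (y + tau / 2) * appW tau y
  = e (tau / 2) * th tau (tau / 2) / 2 * (th tau (y + / 2) * th tau (y + tau)).
Proof.
  intros Hy. assert (H2 := Im_scal_pos tau 2 ltac:(lra) Htau).
  set (c := / 2 + tau). pose proof (gdecay_hcoef tau Htau) as G0.
  destruct (index_one tau Htau _ c G0) as [a0 [a1 EA]].
  destruct (index_one tau Htau _ c (gdecay_th tau tau)) as [b0 [b1 EB]].
  set (SW := fun u => tsum (fun k : Z => e (IZR k * c + 2 * IZR k * u + tau * (IZR k * IZR k))
    * ser (hcoef tau) (u + IZR k * tau))) in *.
  assert (F1 : forall u, good tau u -> th tau (u + tau / 2) * appW tau u = SW u).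
  { intros u Hu. unfold appW, SW. rewrite <- tsum_scal by now apply summ_appW.
    apply tsum_ext. intros k. rewrite (th_shift_hcoef tau Htau u k).
    replace (e (IZR k * c + 2 * IZR k * u + tau * (IZR k * IZR k)))
      with (e (tau * (IZR k * IZR k) / 2 + IZR k * (u + tau / 2)) *
            e (tau * (IZR k * IZR k) / 2 + IZR k * (u + / 2 + tau / 2))).
    - field. apply Hu.
    - rewrite <- e_plus. f_equal. unfold c. field. }
  set (K := e (tau / 2) * th tau (tau / 2) / 2).
  set (g0 := a0 - K * b0). set (g1 := a1 - K * b1).
  assert (F3 : forall u, SW u - K * (th tau (u + / 2) * th tau (u + tau))
    = g0 * th (2 * tau) (2 * u + c) + g1 * (e u * th (2 * tau) (2 * u + c + tau))).
  { intros u. rewrite th_product by auto. fold c. rewrite EB. unfold SW. rewrite EA.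
    unfold g0, g1. ring. }
  assert (Q : forall n : Z, (2 * n + 3 <> 0)%Z) by (intros; lia).
  assert (Q1 : th (2 * tau) (c + tau) <> 0).
  { replace (c + tau) with ((/ 2)%R + 1%R * (2 * tau)).
    - apply th_neq0_off; auto. intros n E. apply (Q n).
      apply eq_IZR. rewrite plus_IZR, mult_IZR. lra.
    - unfold c. rewrite RtoC_inv by lra. ring. }
  assert (Z1 : g1 = 0).
  { pose proof (F3 (/ 2)) as E.
    replace (2 * / 2 + c + tau) with (c + tau + 1) in E by field.
    replace (2 * / 2 + c) with (/ 2 + 2 * tau / 2 + 1) in E by (unfold c; field).
    rewrite !th_1, th_zero, e_half in E by auto.
    assert (ES : SW (/ 2) = - (phi tau * phi tau * phi tau)).
    { unfold SW. rewrite (tsum_single _ 0%Z).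
      - replace (/ 2 + 0 * tau) with (/ 2) by ring. rewrite ser_hcoef_half by auto.
        replace (0 * c + 2 * 0 * / 2 + tau * (0 * 0)) with (RtoC 0) by ring. rewrite e_0. ring.
      - intros k Hk. rewrite ser_hcoef_vanish by auto. ring. }
    assert (ET : K * (th tau (/ 2 + / 2) * th tau (/ 2 + tau)) = - (phi tau * phi tau * phi tau)).
    { replace (/ 2 + / 2) with (0 + 1) by field. rewrite th_1, th_tau by auto.
      replace (- / 2 - tau / 2) with (- (tau / 2) + / 2 + IZR (-1)) by field.
      rewrite e_plus, e_Z, e_plus, e_half, e_opp.
      transitivity (- (th tau 0 * th tau (/ 2) * th tau (tau / 2)) / 2);
        [unfold K; field; apply e_neq0 | ].
      rewrite th_triple by auto. field. }
    rewrite ES, ET in E. apply (scal_eq_0 _ _ Q1).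
    transitivity (- (g0 * 0 + g1 * (-1 * th (2 * tau) (c + tau)))); [ring | ].
    rewrite <- E. ring. }
  assert (Z0 : g0 = 0).
  { pose proof (F3 (/ 2 + tau / 2)) as E. rewrite Z1 in E.
    rewrite <- F1, appW_mid in E by (auto using good_mid).
    replace (2 * (/ 2 + tau / 2) + c) with (c + tau + 1) in E by field.
    replace (/ 2 + tau / 2 + tau) with (/ 2 + tau / 2 + tau) in E by ring.
    rewrite (th_tau tau (/ 2 + tau / 2)), th_zero, th_1 in E by auto.
    apply (scal_eq_0 _ _ Q1).
    match type of E with _ = _ + ?x => transitivity (g0 * th (2 * tau) (c + tau) + x); [ring | ] end.
    rewrite <- E. ring. }
  pose proof (F3 y) as E. rewrite Z0, Z1 in E. rewrite F1 by exact Hy.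
  transitivity ((SW y - K * (th tau (y + / 2) * th tau (y + tau)))
    + K * (th tau (y + / 2) * th tau (y + tau))); [ring | ].
  rewrite E. ring.
Qed.

End AppellTheta.

(** * The error function *)

Section ErrorFunction.
Local Open Scope R_scope.

Definition gf (t : R) : R := exp (- (PI * (t * t))).

Lemma gf_continuous t : continuous gf t.
Proof. apply (ex_derive_continuous gf). unfold gf. auto_derive. auto. Qed.

Lemma gf_ex_RInt a b : ex_RInt gf a b.
Proof. apply (ex_RInt_continuous (V := R_CompleteNormedModule)). intros; apply gf_continuous. Qed.

Lemma E_opp x : E (- x) = - E x.
Proof.
  unfold E. fold gf. rewrite <- Ropp_mult_distr_r_reverse. f_equal.
  pose proof (RInt_comp_lin gf (-1) 0 0 x) as L.
  replace (-1 * 0 + 0) with 0 in L by ring. replace (-1 * x + 0) with (- x) in L by ring.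
  rewrite <- L by apply gf_ex_RInt.
  transitivity (RInt (fun t => opp (gf t)) 0 x).
  2: exact (RInt_opp gf 0 x (gf_ex_RInt 0 x)).
  apply RInt_ext.
  - intros t _. unfold gf, scal, opp. simpl. unfold mult. simpl.
    replace ((-1 * t + 0) * (-1 * t + 0)) with (t * t) by ring. ring.
Qed.

(** The classical companion of the Gaussian: the square of its primitive plus 1/pi times the
    integral of [gg] over [0, 1] is constant. *)
Definition gg (x t : R) : R := exp (- (PI * (x * x)) * (1 + t * t)) / (1 + t * t).
Definition gg' (x t : R) : R := - (2 * PI * x) * exp (- (PI * (x * x)) * (1 + t * t)).

Lemma gg_derive x t : is_derive (fun u => gg u t) x (gg' x t).
Proof. unfold gg, gg'. auto_derive; [nra | field; nra]. Qed.

Lemma gg_ex_RInt x : ex_RInt (gg x) 0 1.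
Proof.
  apply (ex_RInt_continuous (V := R_CompleteNormedModule)). intros t _. apply (ex_derive_continuous (gg x)).
  unfold gg. auto_derive. nra.
Qed.

Lemma gg'_continuous x t : continuity_2d_pt gg' x t.
Proof.
  unfold gg'. apply continuity_2d_pt_mult.
  - apply continuity_2d_pt_opp, continuity_2d_pt_mult;
      [apply continuity_2d_pt_const | apply continuity_2d_pt_id1].
  - apply continuity_1d_2d_pt_comp.
    + apply derivable_continuous_pt, derivable_pt_exp.
    + repeat first [apply continuity_2d_pt_mult | apply continuity_2d_pt_opp
        | apply continuity_2d_pt_plus | apply continuity_2d_pt_const
        | apply continuity_2d_pt_id1 | apply continuity_2d_pt_id2].
Qed.

Lemma gg_RInt_derive x : is_derive (fun u => RInt (gg u) 0 1) x (RInt (gg' x) 0 1).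
Proof.
  evar_last.
  - apply is_derive_RInt_param.
    + apply filter_forall. intros u t _. eexists. apply gg_derive.
    + intros t _. apply continuity_2d_pt_ext with gg'.
      * intros u v. symmetry. apply is_derive_unique, gg_derive.
      * apply gg'_continuous.
    + apply filter_forall. intros u. apply gg_ex_RInt.
  - apply RInt_ext. intros t _. apply is_derive_unique, gg_derive.
Qed.

(** The substitution t -> u t shows that the derivative is 0; at x = 0 the value is arctan(1) / pi =
    1/4. *)
Lemma gauss_sq x : 0 <= x -> (RInt gf 0 x) ^ 2 + RInt (gg x) 0 1 / PI = 1 / 4.
Proof.
  pose proof PI_RGT_0 as Pp.
  set (H := fun u => (RInt gf 0 u) ^ 2 + RInt (gg u) 0 1 / PI).
  assert (D : forall u : R, is_derive H u 0).
  { intros u. unfold H.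
    assert (D1 : is_derive (fun u => RInt gf 0 u) u (gf u)).
    { apply (is_derive_RInt gf _ 0).
      - apply filter_forall. intros v. exact (RInt_correct (V := R_CompleteNormedModule) gf 0 v (gf_ex_RInt 0 v)).
      - apply gf_continuous. }
    set (k := fun t => exp (- (PI * (u * u)) * (t * t))).
    assert (Kx : ex_RInt k 0 1).
    { apply (ex_RInt_continuous (V := R_CompleteNormedModule)). intros t _.
      apply (ex_derive_continuous k). unfold k. auto_derive. auto. }
    assert (E : RInt gf 0 u = u * RInt k 0 1).
    { pose proof (RInt_comp_lin gf u 0 0 1) as L.
      replace (u * 0 + 0) with 0 in L by ring. replace (u * 1 + 0) with u in L by ring.
      rewrite <- L by apply gf_ex_RInt.
      transitivity (RInt (fun t => scal u (k t)) 0 1); [ | exact (RInt_scal k 0 1 u Kx)].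
      apply RInt_ext. intros t _. unfold gf, k. do 2 f_equal. ring. }
    evar_last.
    - apply (is_derive_plus (fun u => RInt gf 0 u ^ 2) (fun u => RInt (gg u) 0 1 / PI)).
      + apply is_derive_pow, D1.
      + apply (is_derive_ext (fun u => / PI * RInt (gg u) 0 1)); [intros; apply Rmult_comm | ].
        apply is_derive_scal, gg_RInt_derive.
    - assert (E2 : RInt (gg' u) 0 1 = - (2 * PI * u) * gf u * RInt k 0 1).
      { transitivity (RInt (fun t => scal (- (2 * PI * u) * gf u) (k t)) 0 1);
          [ | exact (RInt_scal k 0 1 _ Kx)].
        apply RInt_ext. intros t _. unfold gg', gf, k, scal. simpl. unfold mult. simpl.
        replace (- (PI * (u * u)) * (1 + t * t))
          with (- (PI * (u * u)) + - (PI * (u * u)) * (t * t)) by ring.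
        rewrite exp_plus. ring. }
      rewrite E2. simpl. rewrite E. unfold plus, mult. simpl. field. lra. }
  assert (H0 : H 0 = 1 / 4).
  { unfold H. rewrite RInt_point. unfold zero. simpl.
    rewrite (RInt_ext _ (fun t => / (1 + t ^ 2))).
    - assert (I : is_RInt (fun t => / (1 + t ^ 2)) 0 1 (minus (atan 1) (atan 0))).
      { apply (is_RInt_derive atan).
        - intros t _. apply is_derive_Reals.
          apply derivable_pt_lim_atan.
        - intros t _. apply (ex_derive_continuous (fun t => / (1 + t ^ 2))). auto_derive. nra. }
      rewrite (is_RInt_unique _ _ _ _ I), atan_1, atan_0. unfold minus, plus, opp. simpl. field. lra.
    - intros t _. unfold gg. replace (- (PI * (0 * 0)) * (1 + t * t)) with 0 by ring.
      rewrite exp_0. simpl. field. nra. }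
  intros [Hx|<-]; [ | exact H0].
  rewrite <- H0. symmetry. apply (eq_is_derive H 0 x); auto.
Qed.

(** With I the integral of the Gaussian, [gauss_sq] says that (1 - 2I)(1 + 2I) is 4/pi times the
    integral of [gg], hence at most exp(-pi x^2); and 1 + 2I >= 1. *)
Lemma E_bound x : 0 <= x -> Rabs (1 - E x) <= exp (- (PI * (x * x))).
Proof.
  intros Hx. pose proof PI_RGT_0 as Pp. pose proof (gauss_sq x Hx) as S.
  pose proof (gauss_sq 0 (Rle_refl 0)) as S0. rewrite RInt_point in S0.
  set (I := RInt gf 0 x) in *.
  assert (HI : 0 <= I).
  { apply RInt_ge_0; auto; [apply gf_ex_RInt | ]. intros; left; apply exp_pos. }
  assert (HG : 0 <= RInt (gg x) 0 1).
  { apply RInt_ge_0; [lra | apply gg_ex_RInt | ]. intros t _. unfold gg.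
    apply Rmult_le_pos; [left; apply exp_pos | left; apply Rinv_0_lt_compat; nra]. }
  assert (HG' : RInt (gg x) 0 1 <= exp (- (PI * (x * x))) * RInt (gg 0) 0 1).
  { change (exp (- (PI * (x * x))) * RInt (gg 0) 0 1) with (scal (exp (- (PI * (x * x)))) (RInt (gg 0) 0 1)).
    rewrite <- RInt_scal by apply gg_ex_RInt.
    apply RInt_le; [lra | apply gg_ex_RInt | | ].
    - apply (ex_RInt_scal (gg 0)), gg_ex_RInt.
    - intros t _. unfold gg, scal. simpl. unfold mult. simpl.
      replace (- (PI * (0 * 0)) * (1 + t * t)) with 0 by ring. rewrite exp_0.
      unfold Rdiv. rewrite Rmult_1_l. apply Rmult_le_compat_r; [left; apply Rinv_0_lt_compat; nra | ].
      apply exp_le. assert (0 <= PI * ((x * x) * (t * t))); [ | lra].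
      apply Rmult_le_pos; [lra | ]. apply Rmult_le_pos; nra. }
  unfold zero in S0. simpl in S0.
  assert (G0 : RInt (gg 0) 0 1 = PI / 4).
  { apply (Rmult_eq_reg_r (/ PI)); [ | apply Rinv_neq_0_compat; lra].
    replace (PI / 4 * / PI) with (1 / 4) by (field; lra).
    rewrite <- S0. simpl. unfold Rdiv. rewrite Rmult_0_l, Rplus_0_l. reflexivity. }
  rewrite G0 in HG'. unfold E. fold gf. fold I.
  set (X := exp (- (PI * (x * x)))) in *.
  assert (Q : RInt (gg x) 0 1 / PI <= X / 4).
  { apply Rmult_le_reg_r with PI; auto. unfold Rdiv at 1. rewrite Rmult_assoc, Rinv_l by lra. lra. }
  assert (Q' : 0 <= RInt (gg x) 0 1 / PI).
  { apply Rmult_le_pos; auto. left. now apply Rinv_0_lt_compat. }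
  assert (HI2 : 2 * I <= 1) by nra.
  rewrite Rabs_pos_eq by lra. nra.
Qed.

End ErrorFunction.

(** * The functions of the statement in terms of [th], [appU] and [appW] *)

Lemma INR_half : (INR 2 / 2)%R = 1%R.
Proof. simpl. field. Qed.

Lemma CSumZ_scal (F g : Z -> C) (c : C) : (forall j, F j = c * g j) -> summ g ->
  CSumZ F = c * tsum g.
Proof.
  intros E H. rewrite CSumZ_tsum.
  - rewrite <- tsum_scal by exact H. now apply tsum_ext.
  - apply summ_ext with (fun j => c * g j); [intros; now rewrite E | now apply summ_scal].
Qed.

Lemma vartheta_th (a b : nat) tau z : (0 < Im tau)%R ->
  vartheta a b tau z = e (tau * (INR a * INR a) / 8 + INR a * (z + INR b / 2) / 2)
                       * th tau (z + INR b / 2 + INR a * tau / 2).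
Proof.
  intros H. unfold vartheta, th. apply CSumZ_scal; [ | now apply summ_th].
  intros j. rewrite <- e_plus. unfold e. f_equal. field.
Qed.

Lemma theta_th (k : R) tau z : (0 < Im tau)%R ->
  theta k 1 tau z = e (k * z / 2 + tau * (k * k) / 4) * th (2 * tau) (z + k * tau).
Proof.
  intros H. assert (H2 := Im_scal_pos tau 2 ltac:(lra) H).
  unfold theta, th. apply CSumZ_scal; [ | now apply summ_th].
  intros j. cbv zeta. replace (IZR j + k / (2 * 1))%R with (IZR j + k * / 2)%R by field.
  rewrite RtoC_plus, RtoC_mult, RtoC_inv by lra.
  rewrite <- Cexp_plus, <- e_plus. unfold e. f_equal. field.
Qed.

(** The indices 1 and -1 agree modulo 2m = 2, so the two series differ by a shift of the summation
    variable. *)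
Lemma theta_sym_1 tau z : (0 < Im tau)%R -> theta 1 1 tau z = theta (- (1)) 1 tau z.
Proof.
  intros H. assert (H2 := Im_scal_pos tau 2 ltac:(lra) H). rewrite !theta_th by auto.
  replace (z + 1 * tau) with ((z + RtoC (- (1)) * tau) + 2 * tau) by (rewrite RtoC_opp; ring).
  rewrite th_tau by auto. rewrite Cmult_assoc, <- e_plus. f_equal. f_equal.
  rewrite RtoC_opp. field.
Qed.

Lemma theta_sym_2 tau z : (0 < Im tau)%R -> theta 2 1 tau z = theta (- (2)) 1 tau z.
Proof.
  intros H. assert (H2 := Im_scal_pos tau 2 ltac:(lra) H). rewrite !theta_th by auto.
  replace (z + 2 * tau) with ((z + RtoC (- (2)) * tau) + 2 * tau + 2 * tau) by (rewrite RtoC_opp; ring).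
  rewrite !th_tau by auto. rewrite !Cmult_assoc, <- !e_plus. f_equal. f_equal.
  rewrite RtoC_opp. field.
Qed.

(** For s = 1 the correction runs over k = 1 and k = 2, where k and -k are congruent modulo 2. This
    is why honest and modified characters agree for m2 = 1. *)
Lemma Phi_add_2_2 tau z1 z2 t : (0 < Im tau)%R -> Phi_add 2 2 tau z1 z2 t = 0.
Proof.
  intros H. unfold Phi_add. rewrite INR_half. cbn [Csum].
  replace (IZR 2 / 2 + INR 0)%R with 1%R by (simpl; field).
  replace (IZR 2 / 2 + INR 1)%R with 2%R by (simpl; field).
  rewrite theta_sym_1, theta_sym_2 by exact H. ring.
Qed.

Lemma Phi_mod_2_2 tau z1 z2 t : (0 < Im tau)%R -> Phi_mod 2 2 tau z1 z2 t = Phi 2 2 tau z1 z2 t.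
Proof. intros H. unfold Phi_mod. rewrite Phi_add_2_2 by exact H. ring. Qed.

Lemma Phi1_e S tau z1 z2 t : Phi1 2 S tau z1 z2 t = e (- t) * CSumZ (fun j =>
  e (IZR j * (z1 + z2) + IZR S / 2 * z1 + tau * (IZR j * IZR j + IZR S / 2 * IZR j))
  / (1 - e (z1 + IZR j * tau))).
Proof.
  unfold Phi1. rewrite INR_half. f_equal; [unfold e; f_equal; ring | ].
  f_equal. apply functional_extensionality. intros j.
  rewrite RtoC_div by lra. unfold e. rewrite <- !Cexp_plus. f_equal; [f_equal; field | ].
  do 2 f_equal. ring.
Qed.

Lemma Phi2_e S tau z1 z2 t : Phi2 2 S tau z1 z2 t = e (- t) * CSumZ (fun j =>
  e (- (IZR j * (z1 + z2)) - IZR S / 2 * z2 + tau * (IZR j * IZR j + IZR S / 2 * IZR j))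
  / (1 - e (- z2 + IZR j * tau))).
Proof.
  unfold Phi2. rewrite INR_half. f_equal; [unfold e; f_equal; ring | ].
  f_equal. apply functional_extensionality. intros j.
  rewrite RtoC_div by lra. unfold e. rewrite <- !Cexp_plus. f_equal; [f_equal; field | ].
  do 2 f_equal. ring.
Qed.

(** In the correction terms the error functions cancel in pairs at the points
    that occur in the characters. *)
Section Rjm.
Variable tau : C.
Hypothesis Htau : (0 < Im tau)%R.
Variable d : Z.

Notation w := (tau / 2 - IZR d / 2).

Lemma im_w : Im w = (Im tau / 2)%R.
Proof.
  unfold Cdiv. rewrite <- RtoC_inv by lra. unfold Cminus. rewrite im_plus, im_opp, im_scal_r.
  rewrite <- RtoC_mult, im_RtoC. field.
Qed.

(** Here 2m Im w / Im(2 tau) = 1/2, so the argument of [E] is the integer N = n - 1/2 times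
    sqrt(Im(2 tau)). The sign is +1 exactly for l >= 0. *)
Definition rcoef (N l : Z) : C :=
  RtoC (sign (2 * IZR l + 3 / 2) - E (IZR N * sqrt (Im (2 * tau)))).

Lemma R_jm_e (j : Z) : R_jm (IZR j + 1 / 2) 1 (2 * tau) w = CSumZ (fun l =>
  rcoef (2 * l + j) l *
  (e (- (tau * (IZR (2 * l + j) * IZR (2 * l + j)) / 2) + tau / 8) *
   e (- (IZR (2 * l + j) + / 2) * (IZR d / 2)))).
Proof.
  unfold R_jm. f_equal. apply functional_extensionality. intros l. cbv zeta.
  rewrite im_w, im_scal_l. unfold rcoef. f_equal.
  - f_equal. f_equal.
    + f_equal. field.
    + f_equal. f_equal.
      * rewrite plus_IZR, mult_IZR. field. lra.
      * rewrite im_scal_l. f_equal. field.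
  - rewrite <- e_plus. unfold e. f_equal.
    replace (IZR j + 1 / 2 + 2 * 1 * IZR l)%R with (IZR (2 * l + j) + / 2)%R
      by (rewrite plus_IZR, mult_IZR; field).
    rewrite RtoC_plus, RtoC_inv by lra. field.
Qed.

Lemma sign_pos (x : R) : (0 < x)%R -> sign x = 1%R.
Proof. apply sign_eq_1. Qed.

Lemma sign_neg (x : R) : (x < 0)%R -> sign x = (-1)%R.
Proof. apply sign_eq_m1. Qed.

Lemma sign_int (l : Z) : sign (2 * IZR l + 3 / 2) = if Z_le_dec 0 l then 1%R else (-1)%R.
Proof.
  destruct (Z_le_dec 0 l) as [H|H].
  - apply sign_pos. apply IZR_le in H. lra.
  - apply sign_neg. assert (K : (l <= -1)%Z) by lia. apply IZR_le in K. lra.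
Qed.

Lemma CSeries_opp (f : nat -> C) : CSeries (fun n => - f n) = - CSeries f.
Proof.
  unfold CSeries. unfold Copp at 3. simpl. f_equal.
  - rewrite <- Series_opp. reflexivity.
  - rewrite <- Series_opp. reflexivity.
Qed.

(** The map l -> -1 - l sends N = 2l + 1 to -N, negates the coefficient and preserves the
    exponential, so the two halves of [CSumZ] cancel. *)
Lemma R_three_half : R_jm (3 / 2) 1 (2 * tau) w = 0.
Proof.
  replace (3 / 2)%R with (IZR 1 + 1 / 2)%R by field. rewrite R_jm_e.
  set (F := fun l : Z => _).
  assert (EF : forall n : nat, F (- Z.of_nat (S n))%Z = - F (Z.of_nat n)).
  { intros n. unfold F.
    replace (2 * - Z.of_nat (S n) + 1)%Z with (- (2 * Z.of_nat n + 1))%Z by lia.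
    set (N := (2 * Z.of_nat n + 1)%Z).
    assert (Er : rcoef (- N) (- Z.of_nat (S n)) = - rcoef N (Z.of_nat n)).
    { unfold rcoef. rewrite !sign_int.
      destruct (Z_le_dec 0 (- Z.of_nat (S n))); [lia | ].
      destruct (Z_le_dec 0 (Z.of_nat n)); [ | lia].
      rewrite opp_IZR. replace (- IZR N * sqrt (Im (2 * tau)))%R with (- (IZR N * sqrt (Im (2 * tau))))%R by ring.
      rewrite E_opp, <- RtoC_opp. f_equal. ring. }
    rewrite Er.
    assert (Ee : e (- (IZR (- N) + / 2) * (IZR d / 2)) = e (- (IZR N + / 2) * (IZR d / 2))).
    { apply e_shift with (N * d)%Z. zpush. field. }
    rewrite Ee. rewrite opp_IZR, RtoC_opp.
    replace (- IZR N * - IZR N) with (IZR N * IZR N) by ring. ring. }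
  unfold CSumZ. replace (fun n => F (- Z.of_nat (S n))%Z) with (fun n => - F (Z.of_nat n)).
  - rewrite (CSeries_opp (fun n => F (Z.of_nat n))). ring.
  - apply functional_extensionality. intros n. now rewrite EF.
Qed.

(** Now N = 2l, and l -> -l cancels every term except l = 0, where the sign is 1 and the error
    function is 0. *)
Lemma R_one_half : R_jm (1 / 2) 1 (2 * tau) w = e (tau / 8 - IZR d / 4).
Proof.
  pose proof PI_RGT_0 as Pp.
  replace (1 / 2)%R with (IZR 0 + 1 / 2)%R by (simpl; field). rewrite R_jm_e.
  set (g := fun l : Z => rcoef (2 * l) l * e (- (tau * (IZR (2 * l) * IZR (2 * l)) / 2))).
  assert (H2 := Im_scal_pos tau 2 ltac:(lra) Htau). rewrite im_scal_l in H2.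
  set (s := sqrt (Im (2 * tau))).
  assert (Hs : (0 <= s)%R) by apply sqrt_pos.
  assert (Hss : (s * s = 2 * Im tau)%R).
  { unfold s. rewrite im_scal_l. apply sqrt_sqrt. lra. }
  assert (R0 : rcoef 0 0 = 1).
  { unfold rcoef. rewrite sign_int. simpl. rewrite Rmult_0_l.
    assert (E0 : E 0 = 0%R).
    { unfold E. rewrite RInt_point. unfold zero. simpl. ring. }
    rewrite E0, Rminus_0_r. reflexivity. }
  assert (Rn : forall l : Z, l <> 0%Z -> rcoef (2 * - l) (- l) = - rcoef (2 * l) l).
  { intros l Hl. unfold rcoef. rewrite !sign_int.
    replace (2 * - l)%Z with (- (2 * l))%Z by ring. rewrite (opp_IZR (2 * l)).
    replace (- IZR (2 * l) * sqrt (Im (2 * tau)))%R with (- (IZR (2 * l) * sqrt (Im (2 * tau))))%R by ring.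
    rewrite E_opp, <- RtoC_opp. f_equal.
    destruct (Z_le_dec 0 (- l)), (Z_le_dec 0 l); try lia; ring. }
  assert (Rp : forall l : Z, (0 < l)%Z -> (Cmod (rcoef (2 * l) l) <=
     exp (- (PI * ((IZR (2 * l) * s) * (IZR (2 * l) * s)))))%R).
  { intros l Hl. unfold rcoef. rewrite sign_int. destruct (Z_le_dec 0 l); [ | lia].
    rewrite Cmod_R. apply E_bound. apply Rmult_le_pos; auto.
    apply (IZR_le 0). lia. }
  (* The exponentials grow like exp(4 pi Im tau l^2); this decay of the error-function coefficients
     outweighs them and gives absolute convergence. *)
  assert (Rb : forall l : Z, (Cmod (rcoef (2 * l) l) <= exp (- (8 * (PI * Im tau)) * (IZR l * IZR l)))%R).
  { assert (X : forall l : Z, (PI * ((IZR (2 * l) * s) * (IZR (2 * l) * s)) = 8 * (PI * Im tau) * (IZR l * IZR l))%R).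
    { intros l. rewrite mult_IZR.
      transitivity (4 * PI * (IZR l * IZR l) * (s * s))%R; [ring | ]. rewrite Hss. ring. }
    intros l. rewrite Ropp_mult_distr_l_reverse. rewrite <- X.
    destruct (Z.eq_dec l 0) as [->|Hl].
    - change (2 * 0)%Z with 0%Z. rewrite R0, Cmod_1. simpl.
      replace (PI * (0 * s * (0 * s)))%R with 0%R by ring. rewrite Ropp_0, exp_0. lra.
    - destruct (Z_le_gt_dec 0 l); [apply Rp; lia | ].
      pose proof (Rp (- l)%Z ltac:(lia)) as B. rewrite (X (- l)%Z) in B. rewrite X.
      rewrite Rn, Cmod_opp in B by exact Hl.
      replace (IZR l * IZR l)%R with (IZR (- l) * IZR (- l))%R by (rewrite opp_IZR; ring). exact B. }
  assert (Sg : summ g).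
  { apply summ_dom with (fun l : Z => exp (- (4 * (PI * Im tau)) * (IZR l * IZR l) + 0 * Rabs (IZR l) + 0)).
    - intros l. unfold g. rewrite Cmod_mult, Cmod_e.
      eapply Rle_trans; [apply Rmult_le_compat_r; [left; apply exp_pos | apply Rb] | ].
      rewrite <- exp_plus. apply exp_le. rewrite im_opp.
      replace (tau * (IZR (2 * l) * IZR (2 * l)) / 2) with (RtoC (2 * (IZR l * IZR l)) * tau).
      + rewrite im_scal_l. right. ring.
      + rewrite mult_IZR, !RtoC_mult. field.
    - apply summR_gauss. nra. }
  rewrite (CSumZ_scal _ g (e (tau / 8 - IZR d / 4))); auto.
  - transitivity (e (tau / 8 - IZR d / 4) * 1); [f_equal | ring].
    set (g0 := fun l : Z => if Z.eq_dec l 0 then 1 else 0).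
    assert (S0 : summ g0).
    { apply summ_dom with (fun l : Z => exp (- (1) * (IZR l * IZR l) + 0 * Rabs (IZR l) + 0)).
      - intros l. unfold g0. destruct (Z.eq_dec l 0) as [->|].
        + rewrite Cmod_1. simpl. replace (- (1) * (0 * 0) + 0 * Rabs 0 + 0)%R with 0%R by ring.
          rewrite exp_0. lra.
        + rewrite Cmod_0. left. apply exp_pos.
      - apply summR_gauss. lra. }
    assert (Sd : summ (fun l => g l - g0 l)) by now apply summ_minus.
    assert (Z0 : tsum (fun l => g l - g0 l) = 0).
    { apply neg_self_0. rewrite (tsum_neg _ Sd) at 1. rewrite <- tsum_opp by exact Sd.
      apply tsum_ext. intros l. unfold g0, g. destruct (Z.eq_dec l 0) as [->|Hl].
      - simpl. rewrite R0. replace (- (tau * (0 * 0) / 2)) with (RtoC 0) by field. rewrite e_0. ring.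
      - destruct (Z.eq_dec (- l) 0); [lia | ]. rewrite Rn by exact Hl.
        replace (IZR (2 * - l) * IZR (2 * - l)) with (IZR (2 * l) * IZR (2 * l)) by (zpush; ring). ring. }
    rewrite tsum_minus in Z0 by auto.
    rewrite (tsum_single g0 0%Z) in Z0.
    + unfold g0 in Z0. simpl in Z0. transitivity (tsum g - 1 + 1); [ring | ]. rewrite Z0. ring.
    + intros l Hl. unfold g0. destruct (Z.eq_dec l 0); [contradiction | reflexivity].
  - intros l. unfold g. rewrite Z.add_0_r.
    assert (Ee : e (- (IZR (2 * l) + / 2) * (IZR d / 2)) = e (- (IZR d / 4))).
    { apply e_shift with (- (l * d))%Z. zpush. field. }
    rewrite Ee. rewrite e_plus. unfold Cminus. rewrite e_plus. ring.
Qed.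

End Rjm.

(** * Phi at the points of the statement as a single Appell sum *)

Section Reduction.
Variable tau : C.
Hypothesis Htau : (0 < Im tau)%R.

Lemma e_half_shift (m : Z) (a b : C) : a = b + / 2 + IZR m -> e a = - e b.
Proof. intros ->. rewrite !e_plus, e_half, e_Z. ring. Qed.

Lemma e_half_shift_opp (m : Z) (a b : C) : a + b = / 2 + IZR m -> e a = - / e b.
Proof.
  intros H. rewrite <- e_opp. apply e_half_shift with m.
  replace a with (a + b - b) by ring. rewrite H. ring.
Qed.

Lemma inj_even (a a' : Z) : (2 * a)%Z = (2 * a')%Z -> a = a'.
Proof. lia. Qed.

Lemma inj_odd (a a' : Z) : (- 2 * a - 1)%Z = (- 2 * a' - 1)%Z -> a = a'.
Proof. lia. Qed.

Lemma summ_even (f : Z -> C) : summ f -> summ (fun j => f (2 * j)%Z).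
Proof. apply (summ_inj f _ inj_even). Qed.

Lemma summ_odd (f : Z -> C) : summ f -> summ (fun j => f (- 2 * j - 1)%Z).
Proof. apply (summ_inj f _ inj_odd). Qed.

(** The denominators of [Phi2] contain 1/X; rewriting them with X gives an Appell term and a theta
    term. *)
Lemma quot_flip (x X : C) : X <> 0 -> 1 + X <> 0 -> x / (1 - - / X) = x * (1 - 1 / (1 + X)).
Proof. intros H1 H2. field. repeat split; auto. Qed.

Section Untwisted.
Variables (n : Z) (z : C).
Notation d := ((1 - IZR n) / 2).
Notation y := (z + tau / 2 + d).
Hypothesis Hy : good tau y.

(** The supercharacter is n = 0 and the character n = 1. Up to a common factor [Phi1] gives the even
    part of f and -[Phi2] gives the odd part of f minus that of g. The correction adds half of (odd
    g - even g), so the total is f - g/2, that is [appU] / 2. *)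
Lemma Phi_mod_2_1 :
  Phi_mod 2 1 (2 * tau) (z + tau / 2 - IZR n / 2) (z - tau / 2 + IZR n / 2) (tau / 8)
  = e (- tau / 8 + (z + tau / 2 - IZR n / 2) / 2) / 2 * appU tau d y.
Proof.
  assert (H2 := Im_scal_pos tau 2 ltac:(lra) Htau).
  set (z1 := z + tau / 2 - IZR n / 2). set (z2 := z - tau / 2 + IZR n / 2).
  set (g := fun k : Z => e (tau * (IZR k * IZR k) / 2 + IZR k * (y + d))).
  set (I := fun k : Z => 1 / (1 + e (y + IZR k * tau))).
  set (f := fun k : Z => g k * I k).
  assert (Sg : summ g) by exact (summ_th tau (y + d) Htau).
  assert (Sf : summ f).
  { destruct (bounded_inv tau Htau y Hy) as [B HB]. exact (summ_appell tau Htau y (y + d) I B HB). }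
  assert (EU : appU tau d y = 2 * tsum f - tsum g).
  { rewrite <- tsum_scal, <- tsum_minus by auto using summ_scal. apply tsum_ext. intros k.
    unfold f, g, I. field. apply Hy. }
  assert (X1 : Phi1 2 1 (2 * tau) z1 z2 (tau / 8)
    = e (- (tau / 8)) * (e (z1 / 2) * tsum (fun j => f (2 * j)%Z))).
  { rewrite Phi1_e. f_equal. apply CSumZ_scal; [ | now apply summ_even]. intros j.
    unfold f, g, I.
    rewrite (e_half_shift (-1) (z1 + IZR j * (2 * tau)) (y + IZR (2 * j) * tau))
      by (unfold z1; zpush; field).
    rewrite (e_shift (- (2 * j * (1 - n))) _
      (z1 / 2 + (tau * (IZR (2 * j) * IZR (2 * j)) / 2 + IZR (2 * j) * (y + d))))
      by (unfold z1, z2; zpush; field).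
    rewrite e_plus. field. pose proof (Hy (2 * j)%Z) as N.
    intros K. apply N. rewrite <- K. ring. }
  assert (X2 : Phi2 2 1 (2 * tau) z1 z2 (tau / 8)
    = e (- (tau / 8)) * (e (z1 / 2) * (tsum (fun j => g (- 2 * j - 1)%Z)
                                      - tsum (fun j => f (- 2 * j - 1)%Z)))).
  { rewrite Phi2_e. f_equal. rewrite <- tsum_minus by now apply summ_odd.
    apply CSumZ_scal; [ | now apply summ_minus; apply summ_odd]. intros j.
    set (k := (- 2 * j - 1)%Z). unfold f, g, I.
    rewrite (e_half_shift_opp (- n) (- z2 + IZR j * (2 * tau)) (y + IZR k * tau))
      by (unfold z2, k; zpush; field).
    rewrite quot_flip by (apply e_neq0 || apply Hy).
    rewrite (e_shift (- k * (1 - n)) _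
      (z1 / 2 + (tau * (IZR k * IZR k) / 2 + IZR k * (y + d))))
      by (unfold z1, z2, k; zpush; field).
    rewrite e_plus. field. apply Hy. }
  assert (X3 : Phi_add 2 1 (2 * tau) z1 z2 (tau / 8) = - (1 / 2) *
    (e (- (tau / 8)) * (e (z1 / 2) * (tsum (fun j => g (2 * j)%Z) - tsum (fun j => g (- 2 * j - 1)%Z))))).
  { unfold Phi_add. rewrite INR_half. cbn [Csum].
    replace (1 / 2 + INR 0)%R with (1 / 2)%R by (simpl; field).
    replace (1 / 2 + INR 1)%R with (3 / 2)%R by (simpl; field).
    replace ((z1 - z2) / 2) with (tau / 2 - IZR n / 2) by (unfold z1, z2; field).
    replace (z1 + z2) with (2 * z) by (unfold z1, z2; ring).
    rewrite R_one_half, R_three_half, !theta_th by auto.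
    assert (H4 := Im_scal_pos (2 * tau) 2 ltac:(lra) H2).
    assert (T1 : th (2 * (2 * tau)) (2 * z + (1 / 2)%R * (2 * tau)) = tsum (fun j => g (2 * j)%Z)).
    { apply tsum_ext. intros j. unfold g. apply e_shift with (- (2 * j * (1 - n)))%Z.
      rewrite RtoC_div by lra. zpush. field. }
    assert (T2 : th (2 * (2 * tau)) (2 * z + (- (1 / 2))%R * (2 * tau))
      = e z * tsum (fun j => g (- 2 * j - 1)%Z)).
    { rewrite <- th_neg, <- tsum_scal by (auto using summ_odd). apply tsum_ext. intros j. unfold g.
      rewrite <- e_plus. apply e_shift with ((2 * j + 1) * (1 - n))%Z.
      rewrite RtoC_opp, RtoC_div by lra. zpush. field. }
    rewrite T1, T2.
    replace (Cexp (- (2 * PI * Ci * RtoC 1 * (tau / 8)))) with (e (- (tau / 8)))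
      by (unfold e; f_equal; ring).
    assert (C1 : e (tau / 8 - IZR n / 4) * e ((1 / 2)%R * (2 * z) / 2
        + 2 * tau * ((1 / 2)%R * (1 / 2)%R) / 4) = e (z1 / 2)).
    { rewrite <- e_plus. f_equal. unfold z1. rewrite RtoC_div by lra. field. }
    assert (C2 : e (tau / 8 - IZR n / 4) * (e ((- (1 / 2))%R * (2 * z) / 2
        + 2 * tau * ((- (1 / 2))%R * (- (1 / 2))%R) / 4) * e z) = e (z1 / 2)).
    { rewrite <- !e_plus. f_equal. unfold z1. rewrite RtoC_opp, RtoC_div by lra. field. }
    set (x1 := e (_ + 2 * tau * ((1 / 2)%R * _) / 4)) in *.
    set (x2 := e (_ + 2 * tau * ((- (1 / 2))%R * _) / 4)) in *.
    set (x0 := e (tau / 8 - IZR n / 4)) in *.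
    transitivity (- (1 / 2) * e (- (tau / 8)) * ((x0 * x1) * tsum (fun j => g (2 * j)%Z)
      - (x0 * (x2 * e z)) * tsum (fun j => g (- 2 * j - 1)%Z))); [ring | ].
    rewrite C1, C2. ring. }
  unfold Phi_mod, Phi. rewrite X1, X2, X3, EU, (tsum_parity f Sf), (tsum_parity g Sg).
  replace (- tau / 8 + z1 / 2) with (- (tau / 8) + z1 / 2) by field. rewrite e_plus. field.
Qed.

(** Again [Phi1] gives the even indices and [Phi2] the odd ones. For s = 1 the numerator of [Phi2]
    times X is minus the Appell numerator, so the flipped denominator leaves no theta series
    behind. *)
Lemma Phi_2_2 :
  Phi 2 2 (2 * tau) (z + tau / 2 - IZR n / 2) (z - tau / 2 + IZR n / 2) (tau / 8)
  = e (- tau / 8 + (z + tau / 2 - IZR n / 2)) * appW tau y.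
Proof.
  set (z1 := z + tau / 2 - IZR n / 2). set (z2 := z - tau / 2 + IZR n / 2).
  set (f := fun k : Z => e (tau * (IZR k * IZR k) / 2 + IZR k * (y + / 2 + tau / 2))
     * (1 / (1 + e (y + IZR k * tau)))).
  assert (Sf : summ f) by exact (summ_appW tau Htau y Hy).
  assert (X1 : Phi1 2 2 (2 * tau) z1 z2 (tau / 8)
    = e (- (tau / 8)) * (e z1 * tsum (fun j => f (2 * j)%Z))).
  { rewrite Phi1_e. f_equal. apply CSumZ_scal; [ | now apply summ_even]. intros j. unfold f.
    rewrite (e_half_shift (-1) (z1 + IZR j * (2 * tau)) (y + IZR (2 * j) * tau))
      by (unfold z1; zpush; field).
    rewrite (e_shift (j * n - 2 * j) _
      (z1 + (tau * (IZR (2 * j) * IZR (2 * j)) / 2 + IZR (2 * j) * (y + / 2 + tau / 2))))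
      by (unfold z1, z2; zpush; field).
    rewrite e_plus. field. pose proof (Hy (2 * j)%Z) as N.
    intros K. apply N. rewrite <- K. ring. }
  assert (X2 : Phi2 2 2 (2 * tau) z1 z2 (tau / 8)
    = e (- (tau / 8)) * (- e z1 * tsum (fun j => f (- 2 * j - 1)%Z))).
  { rewrite Phi2_e. f_equal. apply CSumZ_scal; [ | now apply summ_odd]. intros j.
    set (k := (- 2 * j - 1)%Z). unfold f.
    rewrite (e_half_shift_opp (- n) (- z2 + IZR j * (2 * tau)) (y + IZR k * tau))
      by (unfold z2, k; zpush; field).
    rewrite quot_flip by (apply e_neq0 || apply Hy).
    pose proof (Hy k) as N.
    assert (K : e (- (IZR j * (z1 + z2)) - 2 / 2 * z2 + 2 * tau * (IZR j * IZR j + 2 / 2 * IZR j))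
      * e (y + IZR k * tau) =
      - (e z1 * e (tau * (IZR k * IZR k) / 2 + IZR k * (y + / 2 + tau / 2)))).
    { rewrite <- !e_plus. apply e_half_shift with (1 - n + 2 * j - j * n)%Z.
      unfold z1, z2, k. zpush. field. }
    match type of K with ?a * ?b = _ => transitivity (a * b / (1 + b)); [field; exact N | ] end.
    rewrite K. field. exact N. }
  unfold Phi. rewrite X1, X2. unfold appW. fold f. rewrite (tsum_parity f Sf).
  replace (- tau / 8 + z1) with (- (tau / 8) + z1) by field. rewrite e_plus. ring.
Qed.

End Untwisted.

Section Twisted.
Variable z : C.
Hypothesis Hz : good tau z.

Notation g := (fun k : Z => e (tau * (IZR k * IZR k) / 2 + IZR k * z)).
Notation f := (fun k : Z => e (tau * (IZR k * IZR k) / 2 + IZR k * z)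
                            * (1 / (1 + e (z + IZR k * tau)))).

Lemma summ_f : summ f.
Proof.
  destruct (bounded_inv tau Htau z Hz) as [B HB]. exact (summ_appell tau Htau z z _ B HB).
Qed.

(** The choices d = 0 and d = 1/2 differ in the sign of the odd part; their sum and difference
    isolate the even and odd indices, which make up the two twisted sectors. *)
Lemma appU_even_odd (d : C) (s : C) :
  (forall j : Z, e (IZR (2 * j) * d) = 1 /\ e (IZR (- 2 * j - 1) * d) = s) ->
  appU tau d z = (2 * tsum (fun j => f (2 * j)%Z) - tsum (fun j => g (2 * j)%Z))
    + s * (2 * tsum (fun j => f (- 2 * j - 1)%Z) - tsum (fun j => g (- 2 * j - 1)%Z)).
Proof.
  intros Hd. pose proof summ_f as Sf. pose proof (summ_th tau z Htau) as Sg.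
  unfold appU. rewrite (tsum_parity _ (summ_appU tau Htau d z Hz)).
  pose proof (summ_even f Sf). pose proof (summ_odd f Sf).
  pose proof (summ_even g Sg). pose proof (summ_odd g Sg). cbv beta in *.
  f_equal.
  - rewrite <- tsum_scal, <- tsum_minus by auto using summ_scal. apply tsum_ext. intros j.
    destruct (Hd j) as [E _].
    replace (e (tau * (IZR (2 * j) * IZR (2 * j)) / 2 + IZR (2 * j) * (z + d)))
      with (e (tau * (IZR (2 * j) * IZR (2 * j)) / 2 + IZR (2 * j) * z) * e (IZR (2 * j) * d))
      by (rewrite <- e_plus; f_equal; ring).
    rewrite E. field. apply Hz.
  - rewrite <- (tsum_scal 2), <- tsum_minus, <- tsum_scal by auto using summ_scal, summ_minus.
    apply tsum_ext. intros j.
    destruct (Hd j) as [_ E].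
    replace (e (tau * (IZR (- 2 * j - 1) * IZR (- 2 * j - 1)) / 2 + IZR (- 2 * j - 1) * (z + d)))
      with (e (tau * (IZR (- 2 * j - 1) * IZR (- 2 * j - 1)) / 2 + IZR (- 2 * j - 1) * z)
            * e (IZR (- 2 * j - 1) * d))
      by (rewrite <- e_plus; f_equal; ring).
    rewrite E. field. apply Hz.
Qed.

Lemma appU_0_even_odd :
  appU tau 0 z = (2 * tsum (fun j => f (2 * j)%Z) - tsum (fun j => g (2 * j)%Z))
    + (2 * tsum (fun j => f (- 2 * j - 1)%Z) - tsum (fun j => g (- 2 * j - 1)%Z)).
Proof.
  rewrite (appU_even_odd 0 1); [ring | ].
  intros j. rewrite !Cmult_0_r, e_0. split; reflexivity.
Qed.

Lemma appU_half_even_odd :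
  appU tau (/ 2) z = (2 * tsum (fun j => f (2 * j)%Z) - tsum (fun j => g (2 * j)%Z))
    - (2 * tsum (fun j => f (- 2 * j - 1)%Z) - tsum (fun j => g (- 2 * j - 1)%Z)).
Proof.
  rewrite (appU_even_odd (/ 2) (-1)); [ring | ].
  intros j. split.
  - rewrite <- (e_Z j). f_equal. zpush. field.
  - transitivity (- e 0); [ | rewrite e_0; ring].
    apply e_half_shift with (- j - 1)%Z. zpush. field.
Qed.

Lemma Phi_sigma_plus :
  Phi 2 2 (2 * tau) (z + tau - 1 / 2) (z - tau + 1 / 2) (tau / 2)
  = (appU tau (/ 2) z - appU tau 0 z) / 2.
Proof.
  set (z1 := z + tau - 1 / 2). set (z2 := z - tau + 1 / 2).
  pose proof summ_f as Sf. pose proof (summ_th tau z Htau) as Sg.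
  pose proof (summ_odd f Sf) as Sfo. pose proof (summ_odd g Sg) as Sgo.
  assert (X1 : Phi1 2 2 (2 * tau) z1 z2 (tau / 2)
    = e (- (tau / 2)) * (- e (tau / 2) * tsum (fun j => f (- 2 * j - 1)%Z))).
  { rewrite Phi1_e. f_equal.
    (* [Phi1] yields the odd index 2j + 1; the substitution j -> -1 - j matches it with the form -2j
       - 1. *)
    rewrite (tsum_bij _ (fun j => - 1 - j)%Z (fun j => - 1 - j)%Z); [ | intros; ring | intros; ring | exact Sfo].
    apply CSumZ_scal.
    2: { apply (summ_inj _ (fun j => - 1 - j)%Z) in Sfo; [exact Sfo | intros; lia]. }
    intros j. replace (- 2 * (- 1 - j) - 1)%Z with (2 * j + 1)%Z by ring.
    rewrite (e_half_shift (-1) (z1 + IZR j * (2 * tau)) (z + IZR (2 * j + 1) * tau))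
      by (unfold z1; zpush; field).
    rewrite (e_half_shift (-1) _
      (tau / 2 + (tau * (IZR (2 * j + 1) * IZR (2 * j + 1)) / 2 + IZR (2 * j + 1) * z)))
      by (unfold z1, z2; zpush; field).
    rewrite e_plus. field. pose proof (Hz (2 * j + 1)%Z) as N.
    intros K. apply N. rewrite <- K. ring. }
  assert (X2 : Phi2 2 2 (2 * tau) z1 z2 (tau / 2)
    = e (- (tau / 2)) * (- e (tau / 2) * (tsum (fun j => g (- 2 * j - 1)%Z)
                                        - tsum (fun j => f (- 2 * j - 1)%Z)))).
  { rewrite Phi2_e. f_equal. rewrite <- tsum_minus by auto.
    apply CSumZ_scal; [ | now apply summ_minus]. intros j.
    set (k := (- 2 * j - 1)%Z).
    rewrite (e_half_shift_opp (-1) (- z2 + IZR j * (2 * tau)) (z + IZR k * tau))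
      by (unfold z2, k; zpush; field).
    rewrite quot_flip by (apply e_neq0 || apply Hz).
    rewrite (e_half_shift (-1) _ (tau / 2 + (tau * (IZR k * IZR k) / 2 + IZR k * z)))
      by (unfold z1, z2, k; zpush; field).
    rewrite e_plus. field. apply Hz. }
  unfold Phi. rewrite X1, X2, appU_0_even_odd, appU_half_even_odd, e_opp. field. apply e_neq0.
Qed.

Lemma Phi_sigma_minus :
  Phi 2 2 (2 * tau) (z - 1 / 2) (z + 1 / 2) 0 = (appU tau (/ 2) z + appU tau 0 z) / 2.
Proof.
  set (z1 := z - 1 / 2). set (z2 := z + 1 / 2).
  pose proof summ_f as Sf. pose proof (summ_th tau z Htau) as Sg.
  pose proof (summ_even f Sf) as Sfe. pose proof (summ_even g Sg) as Sge.
  assert (X1 : Phi1 2 2 (2 * tau) z1 z2 0 = - (tsum (fun j => g (2 * j)%Z)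
                                              - tsum (fun j => f (2 * j)%Z))).
  { rewrite Phi1_e, Copp_0, e_0, Cmult_1_l. rewrite <- tsum_minus by auto.
    transitivity (- (1) * tsum (fun j => g (2 * j)%Z - f (2 * j)%Z)); [ | ring].
    apply CSumZ_scal; [ | now apply summ_minus]. intros j.
    rewrite (e_half_shift (-1) (z1 + IZR j * (2 * tau)) (z + IZR (2 * j) * tau))
      by (unfold z1; zpush; field).
    rewrite (e_half_shift (-1) _ ((tau * (IZR (2 * j) * IZR (2 * j)) / 2 + IZR (2 * j) * z)
      + (z + IZR (2 * j) * tau))) by (unfold z1, z2; zpush; field).
    rewrite (e_plus (_ / 2 + _)). pose proof (Hz (2 * j)%Z) as N. field.
    intros K. apply N. rewrite <- K. ring. }
  assert (X2 : Phi2 2 2 (2 * tau) z1 z2 0 = - tsum (fun j => f (2 * j)%Z)).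
  { rewrite Phi2_e, Copp_0, e_0, Cmult_1_l.
    rewrite (tsum_neg _ Sfe).
    transitivity (- (1) * tsum (fun j => f (2 * - j)%Z)); [ | ring].
    apply CSumZ_scal; [ | exact (summ_inj _ Z.opp Z.opp_inj Sfe)]. intros j.
    set (k := (2 * - j)%Z).
    rewrite (e_half_shift_opp (-1) (- z2 + IZR j * (2 * tau)) (z + IZR k * tau))
      by (unfold z2, k; zpush; field).
    rewrite quot_flip by (apply e_neq0 || apply Hz).
    rewrite (e_half_shift (-1) _ ((tau * (IZR k * IZR k) / 2 + IZR k * z) + (- (z + IZR k * tau))))
      by (unfold z1, z2, k; zpush; field).
    rewrite (e_plus (_ / 2 + _)), e_opp. field. split; [apply Hz | apply e_neq0]. }
  unfold Phi. rewrite X1, X2, appU_0_even_odd, appU_half_even_odd. field.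
Qed.

End Twisted.
End Reduction.

(** * Closed formulas for the characters *)

Definition t00 (tau z : C) : C := th tau z.
Definition t01 (tau z : C) : C := th tau (z + / 2).
Definition t10 (tau z : C) : C := e (tau / 8 + z / 2) * th tau (z + tau / 2).

Definition near (z : C) (n : nat) : C := z + (/ (INR n + 1))%R.

(** [C_lim] is computed along the sequence [near z]. *)
Lemma mquot_near (F D V : C -> C) (z : C) (N : nat) :
  (forall n, (N <= n)%nat -> F (near z n) / D (near z n) = V (near z n)) ->
  cvg (fun n => V (near z n)) (V z) -> mquot F D z = V z.
Proof.
  intros H Hc. apply cvg_eventually with (v := fun n => F (near z n) / D (near z n)) (N0 := N) in Hc.
  2: { intros n Hn. symmetry. auto. }
  destruct (cvg_Re_Im _ _ Hc) as [Hr Hi].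
  assert (En : forall n, near z n = ((fst z + / (INR n + 1))%R, snd z)).
  { intros n. unfold near. destruct z. unfold Cplus, RtoC. simpl. f_equal. ring. }
  unfold mquot, C_lim, Lim. simpl Rbar_loc_seq.
  rewrite (Lim_seq_ext _ (fun n => Re (F (near z n) / D (near z n)))) by (intros n; now rewrite En).
  rewrite (Lim_seq_ext (fun n => snd _) (fun n => Im (F (near z n) / D (near z n))))
    by (intros n; now rewrite En).
  rewrite (is_lim_seq_unique _ _ Hr), (is_lim_seq_unique _ _ Hi). simpl. now destruct (V z).
Qed.

Section Formulas.
Variable tau : C.
Hypothesis Htau : (0 < Im tau)%R.

(** Bad points on a horizontal line differ by integers, so at most one of the
    points [near z n] is bad. *)
Lemma good_near (z s : C) : exists N, forall n, (N <= n)%nat -> good tau (near z n + s).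
Proof.
  destruct (classic (forall n, good tau (near z n + s))) as [H|H]; [exists 0%nat; auto | ].
  apply not_all_ex_not in H. destruct H as [n0 H]. apply not_all_ex_not in H.
  destruct H as [k0 H]. apply NNPP in H.
  exists (S n0). intros n Hn k K.
  destruct (one_plus_e_0 _ H) as [a Ha]. destruct (one_plus_e_0 _ K) as [b Hb].
  assert (E : (/ (INR n0 + 1) - / (INR n + 1))%R + IZR (k0 - k) * tau = IZR (a - b)).
  { transitivity ((near z n0 + s + IZR k0 * tau) - (near z n + s + IZR k * tau)).
    - unfold near. zpush. ring.
    - rewrite Ha, Hb. zpush. ring. }
  assert (E1 := f_equal Im E). rewrite im_affine, !im_RtoC in E1.
  assert (E2 : (IZR (k0 - k) = 0)%R).
  { destruct (Rmult_integral (IZR (k0 - k)) (Im tau)); lra. }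
  rewrite E2 in E. rewrite Cmult_0_l, Cplus_0_r in E. apply RtoC_inj in E.
  pose proof (pos_INR n0). assert (INR (S n0) <= INR n)%R by now apply le_INR. rewrite S_INR in *.
  assert (L1 : (0 < / (INR n + 1) < / (INR n0 + 1))%R).
  { split; [apply Rinv_0_lt_compat; lra | ]. apply Rinv_lt_contravar; nra. }
  assert (L2 : (/ (INR n0 + 1) <= 1)%R).
  { rewrite <- Rinv_1. apply Rinv_le_contravar; lra. }
  assert (L3 : (0 < IZR (a - b) < 1)%R) by lra.
  destruct L3 as [L3 L4]. apply lt_IZR in L3, L4. lia.
Qed.

Lemma good_tau x : good tau x -> good tau (x + tau).
Proof.
  intros H k. replace (x + tau + IZR k * tau) with (x + IZR (k + 1) * tau) by (zpush; ring).
  apply H.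
Qed.

Lemma good_eq x x' : x = x' -> good tau x -> good tau x'.
Proof. now intros ->. Qed.

(** Excludes the zeros of [th] at w and at its half-period translates, which occur in the poles of F
    and in R. By [good_near] this discards finitely many points of the sequence that defines the
    limit. *)
Definition regular (w : C) : Prop :=
  good tau w /\ good tau (w + / 2) /\ good tau (w + tau / 2) /\ good tau (w + tau / 2 + / 2).

Lemma regular_near z : exists N, forall n, (N <= n)%nat -> regular (near z n).
Proof.
  destruct (good_near z 0) as [N1 H1]. destruct (good_near z (/ 2)) as [N2 H2].
  destruct (good_near z (tau / 2)) as [N3 H3]. destruct (good_near z (tau / 2 + / 2)) as [N4 H4].
  exists (max (max N1 N2) (max N3 N4)). intros n Hn. repeat split.
  - apply good_eq with (2 := H1 n ltac:(lia)). ring.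
  - apply H2. lia.
  - apply H3. lia.
  - apply good_eq with (2 := H4 n ltac:(lia)). ring.
Qed.

Lemma regular_th w : regular w ->
  th tau w <> 0 /\ th tau (w + / 2) <> 0 /\ th tau (w + tau / 2) <> 0 /\
  th tau (w + tau / 2 + / 2) <> 0.
Proof.
  intros [H1 [H2 [H3 H4]]]. repeat split; apply th_neq0; auto.
  - apply (good_eq (w + tau / 2 + / 2)); auto. ring.
  - apply (good_eq (w + tau)); [field | now apply good_tau].
  - apply (good_eq (w + / 2 + tau)); [field | now apply good_tau].
Qed.

Lemma mquot_formula (F D V : C -> C) z :
  (forall w, regular w -> F w / D w = V w) ->
  (forall u : nat -> C, cvg u z -> cvg (fun n => V (u n)) (V z)) -> mquot F D z = V z.
Proof.
  intros H Hc. destruct (regular_near z) as [N HN].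
  apply mquot_near with N; [auto | ]. apply Hc, cvg_near.
Qed.

Lemma t00_cvg (u : nat -> C) z : cvg u z -> cvg (fun n => t00 tau (u n)) (t00 tau z).
Proof. intros H. apply th_continuous; auto. apply cvg_const. Qed.

Lemma t01_cvg (u : nat -> C) z : cvg u z -> cvg (fun n => t01 tau (u n)) (t01 tau z).
Proof.
  intros H. apply th_continuous; auto; [apply cvg_const | ]. apply cvg_plus; auto. apply cvg_const.
Qed.

Lemma t10_cvg (u : nat -> C) z : cvg u z -> cvg (fun n => t10 tau (u n)) (t10 tau z).
Proof.
  intros H. apply cvg_mult.
  - apply cvg_e. apply cvg_plus; [apply cvg_const | ]. apply cvg_mult; auto. apply cvg_const.
  - apply th_continuous; auto; [apply cvg_const | ]. apply cvg_plus; auto. apply cvg_const.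
Qed.

Lemma e_neg_quarter : e (- / 4) = / Ci.
Proof. now rewrite e_opp, e_quarter. Qed.

Lemma v00 w : vartheta 0 0 tau w = th tau w.
Proof.
  rewrite vartheta_th by auto. simpl INR.
  replace (tau * (0 * 0) / 8 + 0 * (w + 0 / 2) / 2) with (RtoC 0) by field.
  rewrite e_0, Cmult_1_l. f_equal. field.
Qed.

Lemma v01 w : vartheta 0 1 tau w = th tau (w + / 2).
Proof.
  rewrite vartheta_th by auto. simpl INR.
  replace (tau * (0 * 0) / 8 + 0 * (w + 1 / 2) / 2) with (RtoC 0) by field.
  rewrite e_0, Cmult_1_l. f_equal. field.
Qed.

Lemma v10 w : vartheta 1 0 tau w = e (tau / 8 + w / 2) * th tau (w + tau / 2).
Proof.
  rewrite vartheta_th by auto. simpl INR. f_equal; f_equal; field.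
Qed.

Lemma v11 w : vartheta 1 1 tau w = e (tau / 8 + w / 2) * th tau (w + tau / 2 + / 2) / (- Ci).
Proof.
  rewrite vartheta_th by auto. simpl INR.
  replace (tau * (1 * 1) / 8 + 1 * (w + 1 / 2) / 2) with (tau / 8 + w / 2 + / 4) by field.
  replace (w + 1 / 2 + 1 * tau / 2) with (w + tau / 2 + / 2) by field.
  rewrite e_plus, e_quarter. rewrite <- Ci_inv. field. apply Ci_nz.
Qed.

Lemma eta_nz : eta tau <> 0 /\ eta (tau / 2) <> 0 /\ eta (2 * tau) <> 0.
Proof.
  repeat split; apply eta_neq0; auto; [now apply im_div2 | apply Im_scal_pos; auto; lra].
Qed.

Lemma div_eq (x y r : C) : y <> 0 -> x = r * y -> x / y = r.
Proof. intros H ->. field. exact H. Qed.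

(** This is [appU_theta] at y = w + tau/2 + 1/2. One theta value on each side is moved back by tau,
    and the two factors so produced differ by a sign that cancels the minus. *)
Lemma appU_m w : regular w -> appU tau ((1 - IZR 0) / 2) (w + tau / 2 + (1 - IZR 0) / 2)
  = th tau 0 * th tau w * th tau (w + tau / 2 + / 2) / th tau (w + / 2).
Proof.
  intros H. destruct (regular_th w H) as [N1 [N2 [N3 N4]]]. destruct H as [_ [_ [_ H]]].
  replace ((1 - IZR 0) / 2) with (/ 2) by field.
  pose proof (appU_theta tau Htau (/ 2) _ (or_intror eq_refl) H) as E.
  replace (w + tau / 2 + / 2 + tau / 2 + / 2) with (w + 1 + tau) in E by field.
  replace (w + tau / 2 + / 2 + tau / 2) with (w + / 2 + tau) in E by field.
  replace (w + tau / 2 + / 2 + / 2 + / 2) with (w + tau / 2 + / 2 + 1) in E by field.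
  replace (/ 2 + / 2) with (0 + 1) in E by field.
  rewrite !th_tau, !th_1 in E by auto.
  rewrite (e_half_shift 0 (- (w + / 2) - tau / 2) (- (w + 1) - tau / 2)) in E by field.
  set (x := e _) in E. assert (Nx : x <> 0) by apply e_neq0.
  set (U := appU _ _ _) in *. symmetry. apply div_eq; auto.
  transitivity (- / x * (- x * th tau (w + / 2) * U)); [rewrite E; field; auto | field; auto].
Qed.

Lemma appU_p w : regular w -> appU tau ((1 - IZR 1) / 2) (w + tau / 2 + (1 - IZR 1) / 2)
  = th tau (/ 2) * th tau (w + / 2) * th tau (w + tau / 2 + / 2) / th tau w.
Proof.
  intros H. destruct (regular_th w H) as [N1 [N2 [N3 N4]]]. destruct H as [_ [_ [H _]]].
  replace ((1 - IZR 1) / 2) with (RtoC 0) by field. rewrite Cplus_0_r.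
  pose proof (appU_theta tau Htau 0 _ (or_introl eq_refl) H) as E.
  replace (w + tau / 2 + tau / 2 + / 2) with (w + / 2 + tau) in E by field.
  replace (w + tau / 2 + tau / 2) with (w + tau) in E by field.
  rewrite Cplus_0_r, Cplus_0_l in E.
  rewrite !th_tau in E by auto.
  rewrite (e_half_shift (-1) (- (w + / 2) - tau / 2) (- w - tau / 2)) in E by field.
  set (x := e _) in E. assert (Nx : x <> 0) by apply e_neq0.
  set (U := appU _ _ _) in *. symmetry. apply div_eq; auto.
  transitivity (/ x * (x * th tau w * U)); [rewrite E; field; auto | field; auto].
Qed.

Lemma appW_m w : regular w -> appW tau (w + tau / 2 + (1 - IZR 0) / 2)
  = th tau (tau / 2) / 2 * th tau (w + tau / 2) * th tau (w + tau / 2 + / 2) / th tau (w + / 2).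
Proof.
  intros H. destruct (regular_th w H) as [N1 [N2 [N3 N4]]]. destruct H as [_ [_ [_ H]]].
  replace ((1 - IZR 0) / 2) with (/ 2) by field.
  pose proof (appW_theta tau Htau _ H) as E.
  replace (w + tau / 2 + / 2 + tau / 2) with (w + / 2 + tau) in E by field.
  replace (w + tau / 2 + / 2 + / 2) with (w + tau / 2 + 1) in E by field.
  rewrite !th_tau, !th_1 in E by auto.
  replace (- (w + tau / 2 + / 2) - tau / 2) with (- (w + / 2) - tau / 2 + - (tau / 2)) in E by field.
  rewrite e_plus, e_opp in E.
  set (x := e (- (w + / 2) - tau / 2)) in E. assert (Nx : x <> 0) by apply e_neq0.
  pose proof (e_neq0 (tau / 2)) as Nq.
  set (U := appW _ _) in *. symmetry. apply div_eq; auto.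
  transitivity (/ x * (x * th tau (w + / 2) * U)); [rewrite E; field; auto | field; auto].
Qed.

Lemma appW_p w : regular w -> appW tau (w + tau / 2 + (1 - IZR 1) / 2)
  = th tau (tau / 2) / 2 * th tau (w + tau / 2) * th tau (w + tau / 2 + / 2) / th tau w.
Proof.
  intros H. destruct (regular_th w H) as [N1 [N2 [N3 N4]]]. destruct H as [_ [_ [H _]]].
  replace ((1 - IZR 1) / 2) with (RtoC 0) by field. rewrite Cplus_0_r.
  pose proof (appW_theta tau Htau _ H) as E.
  rewrite (th_tau tau (w + tau / 2)) in E by auto.
  replace (w + tau / 2 + tau / 2) with (w + tau) in E by field.
  rewrite th_tau in E by auto.
  replace (- (w + tau / 2) - tau / 2) with (- w - tau / 2 + - (tau / 2)) in E by field.
  rewrite e_plus, e_opp in E.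
  set (x := e (- w - tau / 2)) in E. assert (Nx : x <> 0) by apply e_neq0.
  pose proof (e_neq0 (tau / 2)) as Nq.
  set (U := appW _ _) in *. symmetry. apply div_eq; auto.
  transitivity (/ x * (x * th tau w * U)); [rewrite E; field; auto | field; auto].
Qed.

Lemma appU_tw w : regular w ->
  appU tau 0 w = - (th tau (/ 2) * th tau (w + / 2) * th tau (w + tau / 2 + / 2) / th tau (w + tau / 2)) /\
  appU tau (/ 2) w = - (th tau 0 * th tau w * th tau (w + tau / 2 + / 2) / th tau (w + tau / 2)).
Proof.
  intros H. destruct (regular_th w H) as [N1 [N2 [N3 N4]]]. destruct H as [H _].
  pose proof (appU_theta tau Htau 0 _ (or_introl eq_refl) H) as E.
  pose proof (appU_theta tau Htau (/ 2) _ (or_intror eq_refl) H) as E'.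
  rewrite Cplus_0_r, Cplus_0_l in E.
  replace (w + / 2 + / 2) with (w + 1) in E' by field.
  replace (/ 2 + / 2) with (0 + 1) in E' by field. rewrite !th_1 in E'.
  split.
  - transitivity (th tau (w + tau / 2) * appU tau 0 w / th tau (w + tau / 2));
      [field; auto | rewrite E; field; auto].
  - transitivity (th tau (w + tau / 2) * appU tau (/ 2) w / th tau (w + tau / 2));
      [field; auto | rewrite E'; field; auto].
Qed.

Ltac good_arg := eapply good_eq; [ | eassumption]; field.
Ltac fsolve := field; repeat split; auto using Ci_nz, e_neq0.

(** In [R_m] theta_11 cancels the factor th(w + tau/2 + 1/2) and theta_01 cancels the poles. What
    remains is continuous in w, so the limit is its value at z. The other five formulas follow the
    same pattern. *)
Lemma mch_m0_formula z :
  mch_m 0 tau z = - (Ci / 2) * (eta (tau / 2) / eta tau ^ 3) * t00 tau 0 * t00 tau z.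
Proof.
  apply (mquot_formula _ _ (fun z => - (Ci / 2) * (eta (tau / 2) / eta tau ^ 3) * t00 tau 0 * t00 tau z)).
  2: { intros u Hu. apply cvg_scal, t00_cvg, Hu. }
  intros w Hw. destruct (regular_th w Hw) as [N1 [N2 [N3 N4]]]. destruct eta_nz as [M1 [M2 M3]].
  change (Z.of_nat 0 + 1)%Z with 1%Z.
  replace (w + tau / 2) with (w + tau / 2 - IZR 0 / 2) by field.
  replace (w - tau / 2) with (w - tau / 2 + IZR 0 / 2) by field.
  rewrite Phi_mod_2_1, appU_m; auto.
  2: { destruct Hw as [_ [_ [_ Hw]]]. good_arg. }
  unfold R_m, t00. rewrite v11, v01.
  replace (- tau / 8 + (w + tau / 2 - IZR 0 / 2) / 2) with (tau / 8 + w / 2) by field.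
  fsolve.
Qed.

Lemma mch_p0_formula z :
  mch_p 0 tau z = - (1 / 2) / (eta (tau / 2) * eta (2 * tau)) * t01 tau 0 * t01 tau z.
Proof.
  apply (mquot_formula _ _ (fun z =>
    - (1 / 2) / (eta (tau / 2) * eta (2 * tau)) * t01 tau 0 * t01 tau z)).
  2: { intros u Hu. apply cvg_scal, t01_cvg, Hu. }
  intros w Hw. destruct (regular_th w Hw) as [N1 [N2 [N3 N4]]]. destruct eta_nz as [M1 [M2 M3]].
  change (Z.of_nat 0 + 1)%Z with 1%Z.
  replace (w + tau / 2 - 1 / 2) with (w + tau / 2 - IZR 1 / 2) by field.
  replace (w - tau / 2 + 1 / 2) with (w - tau / 2 + IZR 1 / 2) by field.
  rewrite Phi_mod_2_1, appU_p; auto.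
  2: { destruct Hw as [_ [_ [Hw _]]]. good_arg. }
  unfold R_p, t01. rewrite v11, v00, Cplus_0_l.
  replace (- tau / 8 + (w + tau / 2 - IZR 1 / 2) / 2) with (tau / 8 + w / 2 + - / 4) by field.
  rewrite e_plus, e_neg_quarter. fsolve.
Qed.

Lemma ch_m1_formula z :
  ch_m 1 tau z = - (Ci / 2) * (eta (tau / 2) / eta tau ^ 3) * t10 tau 0 * t10 tau z.
Proof.
  apply (mquot_formula _ _ (fun z => - (Ci / 2) * (eta (tau / 2) / eta tau ^ 3) * t10 tau 0 * t10 tau z)).
  2: { intros u Hu. apply cvg_scal, t10_cvg, Hu. }
  intros w Hw. destruct (regular_th w Hw) as [N1 [N2 [N3 N4]]]. destruct eta_nz as [M1 [M2 M3]].
  change (Z.of_nat 1 + 1)%Z with 2%Z.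
  replace (w + tau / 2) with (w + tau / 2 - IZR 0 / 2) by field.
  replace (w - tau / 2) with (w - tau / 2 + IZR 0 / 2) by field.
  rewrite Phi_2_2, appW_m; auto.
  2: { destruct Hw as [_ [_ [_ Hw]]]. good_arg. }
  unfold R_m, t10. rewrite v11, v01.
  replace (- tau / 8 + (w + tau / 2 - IZR 0 / 2))
    with (tau / 8 + 0 / 2 + (tau / 8 + w / 2) + (tau / 8 + w / 2)) by field.
  rewrite !(e_plus (_ + _) (tau / 8 + w / 2)), Cplus_0_l. fsolve.
Qed.

Lemma ch_p1_formula z :
  ch_p 1 tau z = Ci / 2 / (eta (tau / 2) * eta (2 * tau)) * t10 tau 0 * t10 tau z.
Proof.
  apply (mquot_formula _ _ (fun z =>
    Ci / 2 / (eta (tau / 2) * eta (2 * tau)) * t10 tau 0 * t10 tau z)).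
  2: { intros u Hu. apply cvg_scal, t10_cvg, Hu. }
  intros w Hw. destruct (regular_th w Hw) as [N1 [N2 [N3 N4]]]. destruct eta_nz as [M1 [M2 M3]].
  change (Z.of_nat 1 + 1)%Z with 2%Z.
  replace (w + tau / 2 - 1 / 2) with (w + tau / 2 - IZR 1 / 2) by field.
  replace (w - tau / 2 + 1 / 2) with (w - tau / 2 + IZR 1 / 2) by field.
  rewrite Phi_2_2, appW_p; auto.
  2: { destruct Hw as [_ [_ [Hw _]]]. good_arg. }
  unfold R_p, t10. rewrite v11, v00.
  rewrite (e_half_shift (-1) (- tau / 8 + (w + tau / 2 - IZR 1 / 2))
    (tau / 8 + 0 / 2 + (tau / 8 + w / 2) + (tau / 8 + w / 2))) by field.
  rewrite !(e_plus (_ + _) (tau / 8 + w / 2)), Cplus_0_l. fsolve.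
Qed.

Lemma sqrt2_nz : RtoC (sqrt 2) <> 0.
Proof. intros H. apply RtoC_inj in H. pose proof (sqrt_lt_R0 2 ltac:(lra)). lra. Qed.

Lemma ch_sm_formula z :
  ch_tw_sm 1 tau z = Ci / 2 * (sqrt 2 * eta (2 * tau) / eta tau ^ 3)
    * (t00 tau 0 * t00 tau z + t01 tau 0 * t01 tau z).
Proof.
  apply (mquot_formula _ _ (fun z => Ci / 2 * (sqrt 2 * eta (2 * tau) / eta tau ^ 3)
    * (t00 tau 0 * t00 tau z + t01 tau 0 * t01 tau z))).
  2: { intros u Hu. apply cvg_scal, cvg_plus; apply cvg_scal; [apply t00_cvg | apply t01_cvg]; auto. }
  intros w Hw. destruct (regular_th w Hw) as [N1 [N2 [N3 N4]]]. destruct eta_nz as [M1 [M2 M3]].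
  change (Z.of_nat 1 + 1)%Z with 2%Z.
  destruct (appU_tw w Hw) as [E0 E1]. rewrite Phi_sigma_minus, E0, E1; auto.
  2: { apply Hw. }
  unfold R_tw, t00, t01. rewrite v11, v10, Cplus_0_l. pose proof sqrt2_nz. fsolve.
Qed.

Lemma ch_sp_formula z :
  ch_tw_sp 1 tau z = Ci / 2 * (sqrt 2 * eta (2 * tau) / eta tau ^ 3)
    * (t00 tau 0 * t00 tau z - t01 tau 0 * t01 tau z).
Proof.
  apply (mquot_formula _ _ (fun z => Ci / 2 * (sqrt 2 * eta (2 * tau) / eta tau ^ 3)
    * (t00 tau 0 * t00 tau z - t01 tau 0 * t01 tau z))).
  2: { intros u Hu. apply cvg_scal, cvg_minus; apply cvg_scal; [apply t00_cvg | apply t01_cvg]; auto. }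
  intros w Hw. destruct (regular_th w Hw) as [N1 [N2 [N3 N4]]]. destruct eta_nz as [M1 [M2 M3]].
  change (Z.of_nat 1 + 1)%Z with 2%Z.
  destruct (appU_tw w Hw) as [E0 E1]. rewrite Phi_sigma_plus, E0, E1; auto.
  2: { apply Hw. }
  unfold R_tw, t00, t01. rewrite v11, v10, Cplus_0_l. pose proof sqrt2_nz. fsolve.
Qed.

Lemma char_mod_2_2 (D : C -> C) (a b t : C -> C) z :
  mquot (fun w => Phi 2 2 (2 * tau) (a w) (b w) (t w)) D z
  = mquot (fun w => Phi_mod 2 2 (2 * tau) (a w) (b w) (t w)) D z.
Proof.
  f_equal. apply functional_extensionality. intros w. symmetry.
  apply Phi_mod_2_2. apply Im_scal_pos; auto. lra.
Qed.

End Formulas.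

(** * Transformation of theta values and eta under S and T *)

Section Modularity.
Variables tau : C.
Hypothesis Htau : (0 < Im tau)%R.

Notation T := (-1 / tau).

Lemma inv_neg_eq : T = - / tau.
Proof. field. now apply tau_neq0. Qed.

Lemma im_T : (0 < Im T)%R.
Proof. rewrite inv_neg_eq. now apply im_inv_neg. Qed.

Lemma t00_S z : t00 T (z / tau) = th_mult tau * e (z * z / (2 * tau)) * t00 tau z.
Proof. unfold t00. rewrite inv_neg_eq. now apply th_inversion. Qed.

(** After rescaling by tau the shift 1/2 becomes tau/2, so S exchanges [t01] and [t10]. *)
Lemma t01_S z : t01 T (z / tau) = th_mult tau * e (z * z / (2 * tau)) * t10 tau z.
Proof.
  pose proof (tau_neq0 tau Htau) as N. unfold t01, t10. rewrite inv_neg_eq.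
  replace (z / tau + / 2) with ((z + tau / 2) / tau) by (field; auto).
  rewrite th_inversion by auto. rewrite <- !Cmult_assoc. f_equal.
  rewrite !Cmult_assoc, <- !e_plus. f_equal. f_equal. field. auto.
Qed.

Lemma t10_S z : t10 T (z / tau) = th_mult tau * e (z * z / (2 * tau)) * t01 tau z.
Proof.
  pose proof (tau_neq0 tau Htau) as N. unfold t01, t10. rewrite inv_neg_eq.
  replace (z / tau + - / tau / 2) with ((z - / 2) / tau) by (field; auto).
  rewrite th_inversion by auto.
  replace (z + / 2) with (z - / 2 + 1) by field. rewrite th_1.
  rewrite (Cmult_comm (th_mult tau)), !Cmult_assoc, <- e_plus, (Cmult_comm (th_mult tau)).
  f_equal. f_equal. f_equal. field. auto.
Qed.

Lemma null_S (t t' : C -> C -> C) :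
  (forall z, t T (z / tau) = th_mult tau * e (z * z / (2 * tau)) * t' tau z) ->
  t T 0 = th_mult tau * t' tau 0.
Proof.
  intros H. pose proof (tau_neq0 tau Htau) as N. specialize (H 0).
  replace (0 / tau) with (RtoC 0) in H by (field; auto).
  replace (0 * 0 / (2 * tau)) with (RtoC 0) in H by (field; auto).
  rewrite e_0, Cmult_1_r in H. exact H.
Qed.

Lemma eta_S : eta T = th_mult tau * eta tau.
Proof. rewrite inv_neg_eq. now apply eta_inversion. Qed.

(** The argument is the inversion of 2 tau, and sqrt 2 is the scaling law at r = 2. *)
Lemma eta_S_half : eta (T / 2) = sqrt 2 * th_mult tau * eta (2 * tau).
Proof.
  pose proof (tau_neq0 tau Htau) as N.
  replace (T / 2) with (- / (2 * tau)) by (field; auto).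
  rewrite eta_inversion, th_mult_scal by (auto; try lra; apply Im_scal_pos; auto; lra).
  reflexivity.
Qed.

Lemma eta_S_double : eta (2 * T) = / sqrt 2 * th_mult tau * eta (tau / 2).
Proof.
  pose proof (tau_neq0 tau Htau) as N.
  replace (2 * T) with (- / (tau / 2)) by (field; auto).
  rewrite eta_inversion by now apply im_div2.
  replace (tau / 2) with (RtoC (/ 2) * tau) at 1 by (rewrite RtoC_inv by lra; field).
  rewrite th_mult_scal by (auto; lra). rewrite sqrt_inv, RtoC_inv; [reflexivity | ].
  pose proof (sqrt_lt_R0 2 ltac:(lra)). lra.
Qed.

(** The parities of n^2 and n agree, so e(n^2/2) = e(n/2). *)
Lemma th_T z : th (tau + 1) z = th tau (z + / 2).
Proof.
  apply tsum_ext. intros n.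
  destruct (Z.Even_or_Odd n) as [[k Hk]|[k Hk]]; subst n.
  - apply e_shift with (2 * k * k - k)%Z. zpush. field.
  - apply e_shift with (2 * k * k + k)%Z. zpush. field.
Qed.

Lemma t00_T z : t00 (tau + 1) z = t01 tau z.
Proof. apply th_T. Qed.

Lemma t01_T z : t01 (tau + 1) z = t00 tau z.
Proof.
  unfold t01, t00. rewrite th_T. replace (z + / 2 + / 2) with (z + 1) by field. apply th_1.
Qed.

Lemma t10_T z : t10 (tau + 1) z = e (/ 8) * t10 tau z.
Proof.
  unfold t10. rewrite th_T. replace (z + (tau + 1) / 2 + / 2) with (z + tau / 2 + 1) by field.
  rewrite th_1, Cmult_assoc, <- e_plus. f_equal. f_equal. field.
Qed.

Lemma phi_T t : phi (t + 1) = phi t.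
Proof.
  rewrite !phi_pp. rewrite (pp_tau_shift t _ 1).
  replace (t + 1 + / 2) with (t + / 2 + IZR 1) by ring. apply pp_shift.
Qed.

Lemma eta_T t : eta (t + 1) = e (/ 24) * eta t.
Proof.
  rewrite !eta_phi, phi_T, Cmult_assoc, <- e_plus. f_equal. f_equal. field.
Qed.

Lemma eta_T_double : eta (2 * (tau + 1)) = e (/ 12) * eta (2 * tau).
Proof.
  replace (2 * (tau + 1)) with (2 * tau + 1 + 1) by ring. rewrite !eta_T.
  rewrite Cmult_assoc, <- e_plus. f_equal. f_equal. field.
Qed.

Lemma eta_T_half : eta ((tau + 1) / 2) = e (/ 48) * eta tau ^ 3 / (eta (tau / 2) * eta (2 * tau)).
Proof.
  destruct (eta_nz tau Htau) as [M1 [M2 M3]].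
  symmetry. apply div_eq; [now apply Cmult_neq_0 | ].
  rewrite !eta_phi.
  transitivity (e (/ 48) * (e (tau / 24) * e (tau / 24) * e (tau / 24)) * (phi tau * phi tau * phi tau)).
  { simpl. ring. }
  rewrite <- phi_triple by auto.
  replace (e (/ 48) * (e (tau / 24) * e (tau / 24) * e (tau / 24)))
    with (e ((tau + 1) / 2 / 24) * e (tau / 2 / 24) * e (2 * tau / 24))
    by (rewrite <- !e_plus; f_equal; field).
  ring.
Qed.

End Modularity.

(** * The transformation formulas of the characters *)

Theorem corollary5p1 (tau z : C) (htau : (0 < Im tau)%R) :
  let fac := Cexp (PI * Ci * (z * z) / tau) in
  (ch_p 1 tau z = mch_p 1 tau z /\
   ch_m 1 tau z = mch_m 1 tau z /\
   ch_tw_sp 1 tau z = mch_tw_sp 1 tau z /\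
   ch_tw_sm 1 tau z = mch_tw_sm 1 tau z) /\
  (mch_p 0 (-1 / tau) (z / tau) = Ci * fac * ch_p 1 tau z /\
   ch_p 1 (-1 / tau) (z / tau) = - Ci * fac * mch_p 0 tau z /\
   mch_m 0 (-1 / tau) (z / tau)
     = - (1 / 2) * fac * (ch_tw_sm 1 tau z + mch_tw_sp 1 tau z) /\
   ch_m 1 (-1 / tau) (z / tau)
     = - (1 / 2) * fac * (ch_tw_sm 1 tau z - mch_tw_sp 1 tau z) /\
   ch_tw_sm 1 (-1 / tau) (z / tau)
     = - fac * (mch_m 0 tau z + ch_m 1 tau z) /\
   mch_tw_sp 1 (-1 / tau) (z / tau)
     = - fac * (mch_m 0 tau z - ch_m 1 tau z)) /\
  (mch_p 0 (tau + 1) z = - Cexp (7 / 24 * PI * Ci) * mch_m 0 tau z /\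
   ch_p 1 (tau + 1) z = - Cexp (7 / 24 * PI * Ci) * ch_m 1 tau z /\
   mch_m 0 (tau + 1) z = Cexp (7 / 24 * PI * Ci) * mch_p 0 tau z /\
   ch_m 1 (tau + 1) z = - Cexp (7 / 24 * PI * Ci) * ch_p 1 tau z /\
   ch_tw_sm 1 (tau + 1) z = Cexp (- (PI * Ci / 12)) * ch_tw_sm 1 tau z /\
   mch_tw_sp 1 (tau + 1) z = - Cexp (- (PI * Ci / 12)) * mch_tw_sp 1 tau z).
Proof.
  intros fac.
  pose proof (tau_neq0 tau htau) as Nt.
  assert (Hfac : fac = e (z * z / (2 * tau))).
  { unfold fac, e. f_equal. field. auto. }
  assert (HS : (0 < Im (-1 / tau))%R) by now apply im_T.
  assert (HT : (0 < Im (tau + 1))%R) by (rewrite im_plus, im_RtoC; lra).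
  assert (M : forall t w, (0 < Im t)%R -> mch_tw_sp 1 t w = ch_tw_sp 1 t w).
  { intros t w Ht. symmetry. now apply char_mod_2_2. }
  split; [repeat split; now apply char_mod_2_2 | ].
  destruct (eta_nz tau htau) as [M1 [M2 M3]].
  pose proof (th_mult_neq0 tau htau) as NC. pose proof sqrt2_nz as Ns. pose proof Ci_nz as Ni.
  rewrite (M tau z htau), (M _ (z / tau) HS), (M _ z HT).
  rewrite (mch_p0_formula tau htau z), (mch_p0_formula _ HS (z / tau)), (mch_p0_formula _ HT z).
  rewrite (mch_m0_formula tau htau z), (mch_m0_formula _ HS (z / tau)), (mch_m0_formula _ HT z).
  rewrite (ch_p1_formula tau htau z), (ch_p1_formula _ HS (z / tau)), (ch_p1_formula _ HT z).
  rewrite (ch_m1_formula tau htau z), (ch_m1_formula _ HS (z / tau)), (ch_m1_formula _ HT z).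
  rewrite (ch_sm_formula tau htau z), (ch_sm_formula _ HS (z / tau)), (ch_sm_formula _ HT z).
  rewrite (ch_sp_formula tau htau z), (ch_sp_formula _ HS (z / tau)), (ch_sp_formula _ HT z).
  rewrite !t00_S, !t01_S, !t10_S by auto.
  rewrite (null_S tau htau t00 t00 (t00_S tau htau)), (null_S tau htau t01 t10 (t01_S tau htau)),
    (null_S tau htau t10 t01 (t10_S tau htau)).
  rewrite eta_S, eta_S_half, eta_S_double by auto. rewrite Hfac.
  rewrite !t00_T, !t01_T, !t10_T, eta_T, eta_T_double, eta_T_half by auto.
  (* All roots of unity in the formulas are powers of this one; the denominator 48 comes from
     [eta_T_half]. *)
  set (u := e (/ 48)).
  assert (U : u ^ 24 = -1).
  { unfold u. rewrite <- e_pow, <- e_half. f_equal. rewrite INR_IZR_INZ. simpl Z.of_nat. field. }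
  assert (Nu : u <> 0) by apply e_neq0.
  assert (Eu : forall (k : nat) x, x = INR k * / 48 -> e x = u ^ k).
  { intros k x ->. apply e_pow. }
  assert (Ui : Ci = u ^ 12).
  { rewrite <- e_quarter. apply Eu. rewrite INR_IZR_INZ. simpl Z.of_nat. field. }
  replace (e (/ 24)) with (u ^ 2) by (symmetry; apply Eu; rewrite INR_IZR_INZ; simpl Z.of_nat; field).
  replace (e (/ 12)) with (u ^ 4) by (symmetry; apply Eu; rewrite INR_IZR_INZ; simpl Z.of_nat; field).
  replace (e (/ 8)) with (u ^ 6) by (symmetry; apply Eu; rewrite INR_IZR_INZ; simpl Z.of_nat; field).
  replace (Cexp (7 / 24 * PI * Ci)) with (u ^ 7).
  2: { rewrite <- (Eu 7%nat (7 / 48)) by (rewrite INR_IZR_INZ; simpl Z.of_nat; field). unfold e. f_equal. field. }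
  replace (Cexp (- (PI * Ci / 12))) with (/ u ^ 2).
  2: { rewrite <- (Eu 2%nat (/ 24)), <- e_opp by (rewrite INR_IZR_INZ; simpl Z.of_nat; field). unfold e. f_equal. field. }
  rewrite Ui.
  (* The multiplier and the exponential factor cancel as rational expressions. Where the powers of u
     do not match literally, the second [field] also uses u^24 = -1. *)
  repeat split; (field || field [U]); repeat split; assumption.
Qed.
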